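(* Let $n\ge1$, $k\ge 0$, $0=a_0<a_1<\dots<a_k$, and let $\xi(x)$, $x\in\mathbb{R}^n$, be a real-valued, measurable, mean-square continuous, homogeneous isotropic Gaussian random field with zero mean whose isotropic spectral density has the form $$\varphi(|\lambda|)=\frac{h_0(|\lambda|)}{|\lambda|^{n-\alpha_0}}+\sum_{i=1}^k\frac{h_i(|\lambda|-a_i)}{\big||\lambda|-a_i\big|^{1-\alpha_i}},$$ where $\varphi(|\cdot|)\in L_1(\mathbb{R}^n)$, $0<\alpha_0<n$, $0<\alpha_i<1$ for $i=1,\dots,k$, and each $h_i\ge 0$ ($i=0,\dots,k$) is a bounded function defined on $[-a_i,+\infty)$, continuous in some neighborhood of $0$, with $h_i(0)\neq 0$. Fix $j\in\{0,\dots,k\}$ and let $f_{j,r}:\mathbb{R}^n\to\mathbb{R}$, $r>0$, be radial, essentially non-zero functions such that $f_{j,r}\in L_1(\mathbb{R}^n)\cap L_2(\mathbb{R}^n)$, the Fourier transform of $r^{-n}f_{j,r}$, namely $\lambda\mapsto r^{-n}\int_{\mathbb{R}^n}e^{i\langle\lambda,x\rangle}f_{j,r}(x)\,dx$, equals $g_j(r(|\lambda|-a_j))$ for a function $g_j:\mathbb{R}\to\mathbb{R}$ independent of $r$, and $g_j$ is even with $g_j^2(s)\le C s^{-n}$ for all $s\ge s_0$, for some constants $s_0\ge0$, $C>0$. Define $A_j=1$ if $j=0$ and $A_j=2a_j^{n-1}$ if $j\neq 0$, and $$X_{r,j}(t)=\frac{1}{\sqrt{A_j h_j(0)}\,r^{n-\alpha_j/2}}\int_{\mathbb{R}^n}f_{j,rt^{1/n}}(x)\,\xi(x)\,dx\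 \ (t\in(0,1]),\qquad X_{r,j}(0)=0.$$ Then, as $r\to\infty$, the finite-dimensional distributions of the process $X_{r,j}(t)$, $t\in[0,1]$, converge weakly to those of the process $$X_j(t)=t\int_{\mathbb{R}^n}\frac{g_j(|u|t^{1/n})}{|u|^{(n-\alpha_j)/2}}\,dZ(u)\ \ (t\in(0,1]),\qquad X_j(0)=0,$$ where $Z(\cdot)$ is the Wiener measure (Gaussian white noise) on $(\mathbb{R}^n,\mathfrak{B}^n)$.
   Context: The isotropic spectral density $\varphi$ of the field means: the covariance $\mathsf{B}_n(|x|)=\mathsf{E}\xi(0)\xi(x)$ has the representation $\mathsf{B}_n(r)=2^{(n-2)/2}\Gamma(n/2)\int_0^\infty \frac{J_{(n-2)/2}(ru)}{(ru)^{(n-2)/2}}\,d\Phi(u)$ with $\Phi(u)=\frac{2\pi^{n/2}}{\Gamma(n/2)}\int_0^u z^{n-1}\varphi(z)\,dz$, $u^{n-1}\varphi(u)\in L_1([0,\infty))$, where $J_\nu$ is the Bessel function of the first kind. A function $f:\mathbb{R}^n\to\mathbb{R}$ is radial if $f(x)=\tilde f(|x|)$ for some $\tilde f$, and essentially non-zero if it is non-zero on a set of positive Lebesgue measure. $\mathfrak{B}^n$ is the Borel $\sigma$-algebra of $\mathbb{R}^n$. *)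

(* Defs.v *)
From HB Require Import structures.
From mathcomp Require Import all_boot all_order all_algebra.
From mathcomp Require Import all_classical all_reals all_analysis.
From Stdlib Require List.

Set Implicit Arguments.
Unset Strict Implicit.
Unset Printing Implicit Defensive.

Import Order.TTheory GRing.Theory Num.Theory.
Import numFieldNormedType.Exports.

Local Open Scope classical_set_scope.
Local Open Scope ring_scope.

Section Defs.
Context {R : realType}.

(* ---------- Euclidean space R^n = n.-tuple R (Borel = product sigma-algebra) *)

Definition inner_Rn (n : nat) (x y : n.-tuple R) : R :=
  \sum_(i < n) tnth x i * tnth y i.

Definition norm_Rn (n : nat) (x : n.-tuple R) : R := Num.sqrt (inner_Rn x x).

Definition dist_Rn (n : nat) (x y : n.-tuple R) : R :=
  Num.sqrt (\sum_(i < n) (tnth x i - tnth y i) ^+ 2).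

(* Lebesgue integral on R^n, written out as the iterated (Fubini/Tonelli)
   integral of the one-dimensional Lebesgue integral. *)
Fixpoint int_Rn (n : nat) : (n.-tuple R -> \bar R) -> \bar R :=
  match n with
  | 0 => fun f => f [tuple]
  | n'.+1 => fun f =>
      (\int[lebesgue_measure]_(x in [set: R])
          int_Rn (fun t : n'.-tuple R => f (cons_tuple x t)))%E
  end.

Definition Rint_Rn (n : nat) (f : n.-tuple R -> R) : R :=
  fine (int_Rn (fun x => (f x)%:E)).

Definition leb_Rn (n : nat) (A : set (n.-tuple R)) : \bar R :=
  int_Rn (fun x => (\1_A x)%:E).

Definition L1_Rn (n : nat) (f : n.-tuple R -> R) : Prop :=
  measurable_fun [set: n.-tuple R] f /\ (int_Rn (fun x => `|f x|%:E) < +oo)%E.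

Definition L2_Rn (n : nat) (f : n.-tuple R -> R) : Prop :=
  measurable_fun [set: n.-tuple R] f /\ (int_Rn (fun x => (f x ^+ 2)%:E) < +oo)%E.

Definition radial (n : nat) (f : n.-tuple R -> R) : Prop :=
  exists ft : R -> R, forall x, f x = ft (norm_Rn x).

Definition essentially_nonzero (n : nat) (f : n.-tuple R -> R) : Prop :=
  (0%E < leb_Rn [set x | f x != 0%R])%E.

Definition GammaR (s : R) : R :=
  Rintegral lebesgue_measure `[0%R, +oo[%classic
    (fun z => z `^ (s - 1) * expR (- z)).

(* besselJ_div nu z = J_nu(z) / z^nu, via the power series of J_nu *)
Definition besselJ_div (nu z : R) : R :=
  limn (fun N : nat => \sum_(0 <= m < N)
    ((-1) ^+ m * (z / 2) ^+ (2 * m) /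
       (2 `^ nu * (m`!)%:R * GammaR (m%:R + nu + 1)))).

(* B_n(rho) = 2^{(n-2)/2} Gamma(n/2) int_0^oo J_nu(rho u)/(rho u)^nu dPhi(u),
   dPhi(u) = 2 pi^{n/2}/Gamma(n/2) u^{n-1} phi(u) du,   nu = (n-2)/2 *)
Definition spectral_cov (n : nat) (phi : R -> R) (rho : R) : R :=
  let nu := (n%:R - 2) / 2 in
  2 `^ nu * GammaR (n%:R / 2) *
  Rintegral lebesgue_measure `[0%R, +oo[%classic
    (fun u => besselJ_div nu (rho * u) *
       (2 * pi `^ (n%:R / 2) / GammaR (n%:R / 2) * u ^+ n.-1 * phi u)).

Definition normal_law d (T : measurableType d) (P : probability T R)
    (X : T -> R) (m v : R) : Prop :=
  measurable_fun [set: T] X /\ 0 <= v /\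
  (if v == 0 then P (X @^-1` [set m]) = 1%E
   else forall B : set R, measurable B ->
          P (X @^-1` B) = normal_prob m (Num.sqrt v) B).

Definition gaussian_family d (T : measurableType d) (P : probability T R)
    (I : Type) (D : set I) (Y : I -> T -> R) : Prop :=
  forall s : seq (R * I), (forall p, List.In p s -> D p.2) ->
    exists m v, normal_law P (fun w => \sum_(p <- s) p.1 * Y p.2 w) m v.

Definition iso_gaussian_field (n : nat) d (T : measurableType d)
    (P : probability T R) (xi : n.-tuple R -> T -> R) (phi : R -> R) : Prop :=
  measurable_fun [set: (n.-tuple R * T)%type] (fun p => xi p.1 p.2) /\
  gaussian_family P [set: n.-tuple R] xi /\
  (forall x, ('E_P[xi x] = 0)%E) /\
  (forall x (e : R), 0 < e -> exists2 delta : R, 0 < delta &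
     forall y, dist_Rn x y < delta ->
       ('E_P[fun w => ((xi y w - xi x w) ^+ 2)%R] < e%:E)%E) /\
  lebesgue_measure.-integrable `[0%R, +oo[%classic
     (fun u => (u ^+ n.-1 * phi u)%:E) /\
  (forall x y, ('E_P[fun w => (xi x w * xi y w)%R]
               = (spectral_cov n phi (dist_Rn x y))%:E)%E).

Definition finite_borel (n : nat) (A : set (n.-tuple R)) : Prop :=
  measurable A /\ (leb_Rn A < +oo)%E.

Definition white_noise (n : nat) d (T : measurableType d)
    (P : probability T R) (Z : set (n.-tuple R) -> T -> R) : Prop :=
  gaussian_family P (@finite_borel n) Z /\
  (forall A, finite_borel A -> ('E_P[Z A] = 0)%E) /\
  (forall A B, finite_borel A -> finite_borel B ->
     ('E_P[fun w => (Z A w * Z B w)%R] = leb_Rn (A `&` B))%E).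

Definition simple_Rn (n : nat) (s : seq (R * set (n.-tuple R)))
    (u : n.-tuple R) : R :=
  \sum_(p <- s) p.1 * \1_(p.2) u.

Definition simple_Z (n : nat) d (T : measurableType d)
    (Z : set (n.-tuple R) -> T -> R) (s : seq (R * set (n.-tuple R))) (w : T) : R :=
  \sum_(p <- s) p.1 * Z p.2 w.

Definition wiener_integral (n : nat) d (T : measurableType d)
    (P : probability T R) (Z : set (n.-tuple R) -> T -> R)
    (F : n.-tuple R -> R) (Y : T -> R) : Prop :=
  L2_Rn F /\ measurable_fun [set: T] Y /\
  exists S : nat -> seq (R * set (n.-tuple R)),
    (forall k p, List.In p (S k) -> finite_borel p.2) /\
    ((fun k => int_Rn (fun u => ((simple_Rn (S k) u - F u) ^+ 2)%:E)) @ \oo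
       --> 0%E) /\
    ((fun k => ('E_P[fun w => ((simple_Z Z (S k) w - Y w) ^+ 2)%R])%E) @ \oo --> 0%E).

Definition spec_density (n k : nat) (a alpha : nat -> R) (h : nat -> R -> R)
    (u : R) : R :=
  h 0 u / u `^ (n%:R - alpha 0) +
  \sum_(1 <= i < k.+1) h i (u - a i) / `|u - a i| `^ (1 - alpha i).

Definition A_const (n : nat) (a : nat -> R) (j : nat) : R :=
  if j == 0 then 1 else 2 * a j ^+ n.-1.

Definition X_rj (n : nat) d (T : measurableType d)
    (xi : n.-tuple R -> T -> R) (f : R -> n.-tuple R -> R)
    (Aj hj0 alphaj r t : R) (w : T) : R :=
  if t == 0 then 0 else
  (Num.sqrt (Aj * hj0) * r `^ (n%:R - alphaj / 2))^-1 *
    Rint_Rn (fun x => f (r * t `^ (n%:R)^-1) x * xi x w).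

Definition Xj_integrand (n : nat) (g : R -> R) (alphaj t : R)
    (u : n.-tuple R) : R :=
  t * (g (norm_Rn u * t `^ (n%:R)^-1) / norm_Rn u `^ ((n%:R - alphaj) / 2)).

End Defs.

(* Main.v *)
Require Import Defs.
From HB Require Import structures.
From mathcomp Require Import all_boot all_order all_algebra.
From mathcomp Require Import all_classical all_reals all_analysis.
From mathcomp Require Import measurable_realfun.
From mathcomp Require Import ring lra.

(** All the random vectors involved are Gaussian, so that the problem reduces to the convergence
of the variances of linear combinations. The integral of [F * xi] is an L2-limit of finite
combinations of values of the field, and simultaneously of the same combinations in an explicit
model of the covariance; the model yields the variance as the integral of [F^]^2 against the
spectral measure, where [F^] is the (radial) Fourier transform of [F]. For [sum_i th_i X_r(t_i)]
this is a constant times [r^alpha * int q(u) G(r(u - a_j)) du], where [q(u) = u^(n-1) phi(u)] and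
[G(v) = (sum_i th_i t_i g(t_i^(1/n) v))^2]. The substitution [v = r(u - a_j)], the behaviour
[q(u) ~ c |u - a_j|^(alpha - 1)] at [a_j] and dominated convergence give the limit
[int |v|^(alpha - 1) G(v) dv], which in polar coordinates is the variance of the same combination of
Wiener integrals. Convergence of the expectations of cosines is finally extended to bounded
continuous functions by uniform approximation on boxes by trigonometric polynomials. *)

Set Implicit Arguments.
Unset Strict Implicit.
Unset Printing Implicit Defensive.

Import Order.TTheory GRing.Theory Num.Theory.
Import numFieldNormedType.Exports.

Local Open Scope classical_set_scope.
Local Open Scope ring_scope.

(** * Lebesgue measure on tuples *)

Section leb_tuple.
Context {R : realType}.

(** The covariance enters through a Bessel series, not through a random spectral measure, so the
    variance of an integral of the field cannot be read off an isometry. What two families with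
    equal Gram matrices share is the norm of each finite combination; a limit shares it too once the
    same combinations converge in both spaces. Since [F] is merely integrable, the points are not
    taken on a grid but greedily, as in Maurey's lemma: each new increment has nonpositive scalar
    product with the error accumulated so far, summed over the two spaces.

    In the variance asymptotics only a neighbourhood of [a_j] survives. Away from it the other
    singularities leave [q] merely integrable, and the decay of [g] is what helps: it gives
    [r^alpha r^(-n)], which tends to 0 because [alpha_j < n]. Near [a_j] the dominating function is
    integrable because the existence of the Wiener integrals puts their integrands in L2. The
    constant [A_j] counts the sides from which the radius can approach [a_j].

    Tightness is not a separate step: the variances converge, hence are bounded, and Chebyshev's
    inequality controls what lies outside a large box. *)

Definition consT n (p : measurableTypeR R * n.-tuple R) : n.+1.-tuple R := cons_tuple p.1 p.2.

Lemma measurable_consT n : measurable_fun [set: measurableTypeR R * n.-tuple R] (@consT n).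
Proof.
have h := @measurable_cons _ _ _ R (fun p : measurableTypeR R * n.-tuple R => p.1 : R) n
  (fun p => p.2) measurable_fst measurable_snd.
exact: h.
Qed.

Definition uncons n (x : n.+1.-tuple R) : measurableTypeR R * n.-tuple R :=
  (thead x, [tuple of behead x]).

Lemma consTK n : cancel (@consT n) (@uncons n).
Proof. by case=> x t; rewrite /uncons /consT/= theadE; congr pair; exact/val_inj. Qed.

Lemma unconsK n : cancel (@uncons n) (@consT n).
Proof. by move=> x; rewrite /uncons /consT/= [RHS]tuple_eta. Qed.

Lemma measurable_uncons n : measurable_fun [set: n.+1.-tuple R] (@uncons n).
Proof.
apply/measurable_fun_pair => /=; last exact: measurable_behead.
exact: (@measurable_tnth _ R n.+1 ord0).
Qed.

Definition leb_cons n (m : {sigma_finite_measure set (n.-tuple R) -> \bar R}) :=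
  pushforward (lebesgue_measure \x m)%E (@consT n).

Section leb_cons.
Variables (n : nat) (m : {sigma_finite_measure set (n.-tuple R) -> \bar R}).

Let pf := measure_function_pushforward__canonical__measure_function_Measure
  (lebesgue_measure \x m)%E (@measurable_consT n).

HB.instance Definition _ := isMeasure.Build _ _ _ (leb_cons m)
  (@measure0 _ _ _ pf) (@measure_ge0 _ _ _ pf) (@measure_semi_sigma_additive _ _ _ pf).

Let sf : sigma_finite [set: n.+1.-tuple R] (leb_cons m).
Proof.
have /sigma_finiteP[F [TF ndF Foo]] := sigma_finiteT (@lebesgue_measure R).
have /sigma_finiteP[G [TG ndG Goo]] := sigma_finiteT m.
exists (fun k => @uncons n @^-1` (F k `*` G k)).
  rewrite -preimage_bigcup (_ : \bigcup_k _ = setT) ?preimage_setT//.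
  rewrite -subTset => -[x t] _.
  have [i _ Fi] : (\bigcup_i F i) x by rewrite -TF.
  have [k _ Gk] : (\bigcup_i G i) t by rewrite -TG.
  exists (maxn i k) => //; split => /=.
    by have /subsetPset := ndF _ _ (leq_maxl i k); apply.
  by have /subsetPset := ndG _ _ (leq_maxr i k); apply.
move=> k; have [mF ltF] := Foo k; have [mG ltG] := Goo k.
have mFG : measurable (F k `*` G k) by exact: measurableX.
split.
  by rewrite -[X in measurable X]setTI; exact: measurable_uncons.
rewrite /leb_cons /pushforward -comp_preimage (_ : _ \o _ = id) ?preimage_id//; last first.
  by apply/funext => x/=; rewrite consTK.
by rewrite product_measure1E// lte_mul_pinfty// ge0_fin_numE.
Qed.

HB.instance Definition _ := @Measure_isSigmaFinite.Build _ _ _ (leb_cons m) sf.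
End leb_cons.

(** Follows the recursion of [int_Rn], so that the two integrals can be compared one coordinate at a
    time. Sigma-finiteness is carried in the type because each step forms a product measure. *)
Fixpoint lebT (n : nat) : {sigma_finite_measure set (n.-tuple R) -> \bar R} :=
  match n return {sigma_finite_measure set (n.-tuple R) -> \bar R} with
  | 0 => \d_([tuple] : 0.-tuple R)
  | n'.+1 => leb_cons (lebT n')
  end.

Definition leb n : set (n.-tuple R) -> \bar R := lebT n.
HB.instance Definition _ n := SigmaFiniteMeasure.on (@leb n).

Local Open Scope ereal_scope.

Lemma integral_leb0 (f : 0.-tuple R -> \bar R) :
  measurable_fun [set: 0.-tuple R] f -> \int[@leb 0]_x f x = f [tuple].
Proof. by move=> mf; rewrite integral_dirac// diracT mul1e. Qed.

Lemma ge0_integral_lebS n (f : n.+1.-tuple R -> \bar R) :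
  measurable_fun [set: n.+1.-tuple R] f -> (forall x, 0 <= f x) ->
  \int[@leb n.+1]_x f x = \int[lebesgue_measure]_x \int[@leb n]_t f (consT (x, t)).
Proof.
move=> mf f0.
rewrite ge0_integral_pushforward//; last exact: measurable_consT.
rewrite preimage_setT fubini_tonelli1//.
by apply: measurableT_comp => //; exact: measurable_consT.
by move=> x /=; exact: f0.
Qed.

Lemma leb_integrableS n (f : n.+1.-tuple R -> \bar R) :
  (@leb n.+1).-integrable setT f ->
  (lebesgue_measure \x @leb n).-integrable setT (f \o @consT n).
Proof.
move=> /integrableP[mf foo]; apply/integrableP; split.
  by apply: measurableT_comp => //; exact: measurable_consT.
rewrite (@ge0_integral_pushforward _ _ _ _ _ _ (@measurable_consT n)) in foo => //.
exact: measurableT_comp.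
Qed.

Lemma integral_lebS n (f : n.+1.-tuple R -> \bar R) :
  (@leb n.+1).-integrable setT f ->
  \int[@leb n.+1]_x f x = \int[lebesgue_measure]_x \int[@leb n]_t f (consT (x, t)).
Proof.
move=> intf; have intg := leb_integrableS intf.
rewrite (@integral_pushforward _ _ _ _ _ _ (@measurable_consT n)) //.
  by rewrite preimage_setT -integral12_prod_meas1.
by have /integrableP[] := intf.
Qed.

Lemma measurable_sect d1 d2 (T1 : measurableType d1) (T2 : measurableType d2) d3
  (T3 : measurableType d3) (f : T1 * T2 -> T3) x :
  measurable_fun setT f -> measurable_fun setT (fun y => f (x, y)).
Proof. by move=> mf; apply: measurableT_comp => //; exact: measurable_pair1. Qed.

Lemma measurable_integral_param d1 d2 (T1 : measurableType d1) (T2 : measurableType d2)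
  (m : {sigma_finite_measure set T2 -> \bar R}) (f : T1 * T2 -> \bar R) :
  measurable_fun setT f -> measurable_fun setT (fun x => \int[m]_y f (x, y)).
Proof.
move=> mf; rewrite (_ : (fun x => _) = (fun x => \int[m]_y f^\+ (x, y)) \-
   (fun x => \int[m]_y f^\- (x, y))); last first.
  apply/funext => x; rewrite integralE; congr (_ - _);
  by apply: eq_integral => y _; rewrite ?funeposE ?funenegE.
apply: emeasurable_funB.
  by apply: measurable_fun_fubini_tonelli_F => //; exact: measurable_funepos.
by apply: measurable_fun_fubini_tonelli_F => //; exact: measurable_funeneg.
Qed.

(** The parameter space is generalised because the induction moves the head coordinate into it. The
    integrals need not be finite: positive and negative parts are measurable separately. *)
Lemma measurable_int_Rn d (Y : measurableType d) n (f : Y * n.-tuple R -> \bar R) :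
  measurable_fun setT f -> measurable_fun setT (fun y => int_Rn (fun x => f (y, x))).
Proof.
elim: n d Y f => [|n IH] d Y f mf /=.
  by apply: (@measurableT_comp _ _ _ _ _ _ f) => //; exact: measurable_pair2.
pose g (p : Y * measurableTypeR R) := int_Rn (fun t => f (p.1, cons_tuple p.2 t)).
apply: (@measurable_integral_param _ _ Y (measurableTypeR R) lebesgue_measure g).
pose h (p : Y * measurableTypeR R * n.-tuple R) := f (p.1.1, consT (p.1.2, p.2)).
apply: (IH _ _ h).
apply: (measurableT_comp mf); apply/measurable_fun_pair => /=.
  by apply: measurableT_comp.
apply: measurableT_comp; first exact: measurable_consT.
by apply/measurable_fun_pair => //=; apply: measurableT_comp.
Qed.

Lemma ge0_int_RnE n (f : n.-tuple R -> \bar R) :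
  measurable_fun [set: n.-tuple R] f -> (forall x, 0 <= f x) ->
  int_Rn f = \int[@leb n]_x f x.
Proof.
elim: n f => [|n IH] f mf f0; first by rewrite integral_leb0.
rewrite ge0_integral_lebS//=; apply: eq_integral => x _.
rewrite IH//; apply: (@measurable_sect _ _ (measurableTypeR R) _ _ _ (f \o @consT n) x).
by apply: measurableT_comp => //; exact: measurable_consT.
Qed.

(** Slices of an integrable function are integrable only almost everywhere, so the induction
    hypothesis is used under an a.e. equality; [measurable_int_Rn] takes care of the exceptional
    slices. *)
Lemma int_RnE n (f : n.-tuple R -> \bar R) :
  (@leb n).-integrable setT f -> int_Rn f = \int[@leb n]_x f x.
Proof.
elim: n f => [|n IH] f intf; first by rewrite integral_leb0//; have /integrableP[] := intf.
rewrite integral_lebS//=; have intg := leb_integrableS intf.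
apply: ae_eq_integral => //.
- apply: (@measurable_int_Rn _ (measurableTypeR R) n (f \o @consT n)).
  by have /integrableP[] := intg.
- exact: (measurable_fubini_F intg).
- have := ae_integrable1 intg; apply: filterS => x ix _.
  by rewrite (IH _ ix).
Qed.

End leb_tuple.

Import HBNNSimple.

(** * Changes of variables *)

Section wpush.
Local Open Scope ereal_scope.
Context d d' (X : measurableType d) (Y : measurableType d') (R : realType).

(** The image under [phi] of the measure with density [w], which plays the part of a Jacobian. *)
Definition wpush (mu : {measure set X -> \bar R}) (phi : X -> Y) (w : X -> R)
  (A : set Y) := \int[mu]_(x in phi @^-1` A) (w x)%:E.

Variables (mu : {measure set X -> \bar R}) (phi : X -> Y) (w : X -> R).
Hypotheses (mphi : measurable_fun setT phi) (mw : measurable_fun setT w)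
  (w0 : forall x, (0 <= w x)%R).

Let wpush0 : wpush mu phi w set0 = 0.
Proof. by rewrite /wpush preimage_set0 integral_set0. Qed.

Let wpush_ge0 A : 0 <= wpush mu phi w A.
Proof. by apply: integral_ge0 => x _; rewrite lee_fin. Qed.

Let mpre A : measurable A -> measurable (phi @^-1` A).
Proof. by move=> mA; rewrite -[X in measurable X]setTI; exact: mphi. Qed.

Let wpush_sigma_additive : semi_sigma_additive (wpush mu phi w).
Proof.
move=> F mF tF mUF; rewrite /wpush preimage_bigcup.
rewrite ge0_integral_bigcup//.
- apply: is_cvg_ereal_nneg_natsum_cond => n _ _; exact: wpush_ge0.
- by move=> k; exact: mpre.
- exact/measurable_EFinP/measurable_funTS.
- by move=> x _; rewrite lee_fin.
- apply/trivIsetP => i j _ _ ij; rewrite -preimage_setI.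
  by move/trivIsetP : tF => /(_ _ _ I I ij) ->; rewrite preimage_set0.
Qed.

HB.instance Definition _ := isMeasure.Build _ _ _
  (wpush mu phi w) wpush0 wpush_ge0 wpush_sigma_additive.

Definition wpush_measure : {measure set Y -> \bar R} := wpush mu phi w.

Lemma ge0_integral_wpush (f : Y -> \bar R) :
  measurable_fun setT f -> (forall y, 0 <= f y) ->
  \int[wpush_measure]_y f y = \int[mu]_x (f (phi x) * (w x)%:E).
Proof.
move=> mf f0; pose g := nnsfun_approx measurableT mf.
have cg y : EFin \o (fun n => g n y) @ \oo --> f y by apply: cvg_nnsfun_approx.
transitivity (limn (fun n => \int[wpush_measure]_y (g n y)%:E)).
  rewrite -monotone_convergence//.
  - by apply: eq_integral => y _; apply/esym/cvg_lim => //; exact: cg.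
  - by move=> n; exact/measurable_EFinP/measurable_funP.
  - by move=> n y _; rewrite lee_fin.
  - by move=> y _ a b ab; rewrite lee_fin; exact/lefP/nd_nnsfun_approx.
transitivity (limn (fun n => \int[mu]_x ((g n (phi x))%:E * (w x)%:E))); last first.
  rewrite -monotone_convergence//.
  - apply: eq_integral => x _; apply/cvg_lim => //.
    by apply: cvgeZr; [|exact: cg].
  - move=> n; apply/measurable_EFinP/measurable_funM => //.
    exact: measurableT_comp.
  - by move=> n x _; apply: mule_ge0; rewrite lee_fin.
  - move=> x _ a b ab; apply: lee_wpmul2r; first by rewrite lee_fin.
    by rewrite lee_fin; exact/lefP/nd_nnsfun_approx.
congr (limn _); apply/funext => n.
rewrite integralT_nnsfun sintegralE.
transitivity (\sum_(r \in range (g n)) \int[mu]_x (r%:E * (\1_(g n @^-1` [set r]) (phi x))%:E * (w x)%:E)).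
  apply: eq_fsbigr => r; rewrite inE => -[y _ <-{r}].
  rewrite /wpush_measure/= /wpush integral_mkcond -ge0_integralZl_EFin//.
  - apply: eq_integral => x _; rewrite patchE -muleA; congr *%E.
    rewrite indicE (_ : (x \in _) = (phi x \in g n @^-1` [set g n y])); last by apply/idP/idP => /set_mem h; exact: mem_set.
    by case: (phi x \in _); rewrite (mul1e, mul0e).
  - by move=> x _; rewrite patchE; case: ifP => // _; rewrite lee_fin.
  - apply/(measurable_restrictT _ (mpre _)) => //.
    exact/measurable_funTS/measurable_EFinP.
rewrite -ge0_integral_fsum//; last 2 first.
  - move=> r; apply/measurable_EFinP; apply: measurable_funM => //; apply: measurable_funM => //.
    by apply: (@measurableT_comp _ _ _ _ _ _ (\1_(g n @^-1` [set r]) : Y -> R)).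
  - by move=> r x _; apply: mule_ge0; rewrite ?lee_fin//; exact: nnfun_muleindic_ge0.
apply: eq_integral => x _; rewrite [in RHS]fimfunE -fsumEFin// ge0_mule_fsuml//.
by move=> r; rewrite ?EFinM; exact: nnfun_muleindic_ge0.
Qed.

End wpush.

Section transfer.
Local Open Scope ereal_scope.
Context {R : realType}.

(** Half-open intervals are differences of rays of finite measure, and they form a pi-system that
    generates the Borel sets. *)
Lemma eq_measure_ray (m1 m2 : {measure set (measurableTypeR R) -> \bar R}) :
  (forall b : R, m1 `]-oo, b]%classic = m2 `]-oo, b]%classic) ->
  (forall b : R, m1 `]-oo, b]%classic < +oo) ->
  forall A, measurable A -> m1 A = m2 A.
Proof.
move=> m12 m1oo A mA.
have oc (a b : R) : (a <= b)%R -> `]-oo, b]%classic `\` `]-oo, a]%classic = `]a, b]%classic :> set R.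
  move=> ab; apply/seteqP; split => x /=; rewrite !in_itv/=.
    by move=> [-> /negP]; rewrite -ltNge => ->.
  by move=> /andP[ax ->]; split => //; apply/negP; rewrite -ltNge.
have mray (b : R) : measurable (`]-oo, b]%classic : set (measurableTypeR R)).
  exact: measurable_itv.
have Eoc (m : {measure set (measurableTypeR R) -> \bar R}) (a b : R) : (a <= b)%R ->
    m `]-oo, b]%classic < +oo ->
    m `]a, b]%classic = m `]-oo, b]%classic - m `]-oo, a]%classic.
  move=> ab moo; rewrite -oc// measureD//; congr (_ - m _).
  by apply/setIidPr => x /=; rewrite !in_itv/= => /le_trans; apply.
apply: (@measure_unique _ R (measurableTypeR R) (@ocitv R) (fun k => `](- k%:R)%R, k%:R]%classic) _ _ _ _ m1 m2) => //.
- exact: ocitvI.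
- by move=> k; exact: is_ocitv.
- exact: bigcup_itvT.
- move=> B /ocitvP[->|[[a b]/= ab ->]]; first by rewrite !measure0.
  by rewrite !Eoc -?m12 ?ltW// ?m1oo.
- move=> k; apply: le_lt_trans (m1oo k%:R); apply: le_measure; rewrite ?inE.
  + exact: measurable_itv.
  + exact: measurable_itv.
  + by move=> x /=; rewrite !in_itv/= => /andP[].
Qed.

(** A change of variables without Jacobian: it suffices to compare two distribution functions. It
    yields the substitution [z = u ^ 2] and polar coordinates. *)
Lemma ge0_integral_transfer d1 d2 (X1 : measurableType d1) (X2 : measurableType d2)
  (m1 : {measure set X1 -> \bar R}) (m2 : {measure set X2 -> \bar R})
  (phi1 : X1 -> R) (phi2 : X2 -> R) (w1 : X1 -> R) (w2 : X2 -> R) :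
  measurable_fun setT phi1 -> measurable_fun setT phi2 ->
  measurable_fun setT w1 -> measurable_fun setT w2 ->
  (forall x, (0 <= w1 x)%R) -> (forall x, (0 <= w2 x)%R) ->
  (forall b : R, \int[m1]_(x in [set x | (phi1 x <= b)%R]) (w1 x)%:E =
                 \int[m2]_(x in [set x | (phi2 x <= b)%R]) (w2 x)%:E) ->
  (forall b : R, \int[m1]_(x in [set x | (phi1 x <= b)%R]) (w1 x)%:E < +oo) ->
  forall G : R -> \bar R, measurable_fun setT G -> (forall x, 0 <= G x) ->
  \int[m1]_x (G (phi1 x) * (w1 x)%:E) = \int[m2]_x (G (phi2 x) * (w2 x)%:E).
Proof.
move=> mp1 mp2 mw1 mw2 w10 w20 e12 oo G mG G0.
have ray T (phi : T -> R) b : phi @^-1` `]-oo, b]%classic = [set x | (phi x <= b)%R].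
  by apply/seteqP; split => x /=; rewrite in_itv.
rewrite -(@ge0_integral_wpush _ _ X1 (measurableTypeR R) R m1 phi1 w1)//.
rewrite -(@ge0_integral_wpush _ _ X2 (measurableTypeR R) R m2 phi2 w2)//.
apply: eq_measure_integral => A mA _.
apply: eq_measure_ray => // b; rewrite /wpush_measure/= /wpush !ray//.
Qed.

End transfer.

Section one_dim.
Local Open Scope ereal_scope.
Context {R : realType}.
Local Notation mu := (@lebesgue_measure R).

(** The image of [|c| mu] under the affine map gives every interval its length, so it is Lebesgue
    measure by uniqueness. *)
Lemma ge0_integral_affine (c b : R) (f : R -> \bar R) : c != 0%R ->
  measurable_fun setT f -> (forall x, 0 <= f x) ->
  `|c|%:E * \int[mu]_x f (c * x + b)%R = \int[mu]_x f x.
Proof.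
move=> c0 mf f0.
have mphi : measurable_fun [set: measurableTypeR R] (fun x : measurableTypeR R => (c * x + b)%R : measurableTypeR R).
  by apply: measurable_funD => //; exact: measurable_funM.
have mc : measurable_fun [set: measurableTypeR R] (fun=> `|c|%R) by [].
have c'0 : (0 < `|c|)%R by rewrite normr_gt0.
pose nu := wpush_measure mu mphi mc (fun=> ltW c'0).
transitivity (\int[nu]_x f x).
  rewrite ge0_integral_wpush// -ge0_integralZl//; last first.
    by apply: (measurableT_comp mf).
  by apply: eq_integral => x _; rewrite muleC.
apply: eq_measure_integral => A mA _; apply/esym.
apply: (@lebesgue_measure_unique R nu _ A mA) => X /ocitvP[->|[[s t]/= st ->]].
  by rewrite !measure0.
rewrite /nu/= /wpush integral_cst//; last first.
  by rewrite -[X in measurable X]setTI; apply: (mphi) => //; exact: measurable_itv.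
rewrite lebesgue_measure_itv/= lte_fin st -EFinB.
have [cp|cn] := ltP 0%R c.
  rewrite (_ : _ @^-1` _ = `]((s - b) / c)%R, ((t - b) / c)%R]%classic :> set R); last first.
    apply/seteqP; split => x /=; rewrite !in_itv/= ltr_pdivrMr// ler_pdivlMr//;
      by rewrite ltrBlDr lerBrDr [(x * c)%R]mulrC.
  rewrite lebesgue_measure_itv/= lte_fin ltr_pM2r ?invr_gt0// ltrD2r st gtr0_norm//.
  by rewrite -EFinB -EFinM; congr EFin; field.
(* For negative [c] the preimage of a left-open interval is right-open, with the same length. *)
have {}cn : (c < 0)%R by rewrite lt_neqAle c0.
rewrite (_ : _ @^-1` _ = `[((t - b) / c)%R, ((s - b) / c)%R[%classic :> set R); last first.
  apply/seteqP; split => x /=; rewrite !in_itv/= ltr_ndivlMr// ler_ndivrMr// andbC;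
    by rewrite ltrBlDr lerBrDr [(x * c)%R]mulrC.
rewrite lebesgue_measure_itv/= lte_fin ltr_nM2r ?invr_lt0// ltrD2r st ltr0_norm//.
by rewrite -EFinB -EFinM; congr EFin; field.
Qed.

Lemma integral_exprn (n : nat) (b : R) : (0 <= b)%R ->
  \int[mu]_(x in `[0%R, b]) (n.+1%:R * x ^+ n)%:E = (b ^+ n.+1)%:E.
Proof.
rewrite le_eqVlt => /predU1P[<-|b0].
  by rewrite set_itv1 integral_set1 expr0n.
rewrite (@continuous_FTC2 _ _ (fun x => x ^+ n.+1)%R)//.
- by rewrite expr0n/= sube0.
- apply: continuous_subspaceT => x.
  by apply: cvgM; [exact: cvg_cst|exact: exprn_continuous].
- split.
  + by move=> x _; exact: exprn_derivable.
  + by apply: cvg_at_right_filter; exact: exprn_continuous.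
  + by apply: cvg_at_left_filter; exact: exprn_continuous.
- by move=> x _; rewrite exp_derive1.
Qed.

End one_dim.

Section tuples.
Context {R : realType}.

Definition scaleT n (c : R) (x : n.-tuple R) : n.-tuple R := map_tuple ( *%R c) x.

Lemma scaleT_cons n (c x : R) (t : n.-tuple R) :
  scaleT c (consT (x, t)) = consT (c * x, scaleT c t).
Proof. exact/val_inj. Qed.

Lemma measurable_scaleT n (c : R) : measurable_fun [set: n.-tuple R] (@scaleT n c).
Proof.
apply/measurable_fun_tnthP => i.
rewrite (_ : _ \o _ = fun x => c * tnth x i); last first.
  by apply/funext => x /=; rewrite tnth_map.
by apply: measurable_funM => //; exact: measurable_tnth.
Qed.

Lemma measurable_inner d (X : measurableType d) n (f g : X -> n.-tuple R) :
  measurable_fun setT f -> measurable_fun setT g ->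
  measurable_fun setT (fun x => inner_Rn (f x) (g x)).
Proof.
move=> mf mg; apply: measurable_sum => i; apply: measurable_funM.
  by apply: (@measurableT_comp _ _ _ _ _ _ (fun x => tnth x i)) => //; exact: measurable_tnth.
by apply: (@measurableT_comp _ _ _ _ _ _ (fun x => tnth x i)) => //; exact: measurable_tnth.
Qed.

Lemma measurable_sqrt : measurable_fun [set: R] (@Num.sqrt R).
Proof. by apply: continuous_measurable_fun; exact: sqrt_continuous. Qed.

Lemma measurable_norm_Rn n : measurable_fun [set: n.-tuple R] (@norm_Rn R n).
Proof. by apply: (measurableT_comp measurable_sqrt); apply: measurable_inner. Qed.

Lemma inner_cons n (x y : R) (s t : n.-tuple R) :
  inner_Rn (consT (x, s)) (consT (y, t)) = x * y + inner_Rn s t.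
Proof.
rewrite /inner_Rn big_ord_recl; congr (_ + _).
by apply: eq_bigr => i _; rewrite !(tnth_nth 0).
Qed.

Lemma inner_ge0 n (x : n.-tuple R) : 0 <= inner_Rn x x.
Proof. by apply: sumr_ge0 => i _; rewrite -expr2 sqr_ge0. Qed.

Lemma norm_ge0 n (x : n.-tuple R) : 0 <= norm_Rn x.
Proof. exact: sqrtr_ge0. Qed.

Lemma norm_sqr n (x : n.-tuple R) : norm_Rn x ^+ 2 = inner_Rn x x.
Proof. by rewrite sqr_sqrtr// inner_ge0. Qed.

Lemma inner_scalel n c (x y : n.-tuple R) : inner_Rn (scaleT c x) y = c * inner_Rn x y.
Proof. by rewrite /inner_Rn mulr_sumr; apply: eq_bigr => i _; rewrite tnth_map mulrA. Qed.

Lemma innerC n (x y : n.-tuple R) : inner_Rn x y = inner_Rn y x.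
Proof. by apply: eq_bigr => i _; rewrite mulrC. Qed.

Lemma norm_scale n c (x : n.-tuple R) : norm_Rn (scaleT c x) = `|c| * norm_Rn x.
Proof.
rewrite {1}/norm_Rn inner_scalel innerC inner_scalel mulrA -expr2 sqrtrM ?sqr_ge0//.
by rewrite sqrtr_sqr.
Qed.

Local Open Scope ereal_scope.

Lemma ge0_integral_scaleT n (c : R) (f : n.-tuple R -> \bar R) : c != 0%R ->
  measurable_fun [set: n.-tuple R] f -> (forall x, 0 <= f x) ->
  (`|c| ^+ n)%:E * \int[@leb R n]_x f (scaleT c x) = \int[@leb R n]_x f x.
Proof.
move=> c0; elim: n f => [|n IH] f mf f0.
  rewrite expr0 mul1e !integral_leb0//; first by congr f; exact/val_inj.
  by apply: (measurableT_comp mf); exact: measurable_scaleT.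
have mfc : measurable_fun setT (f \o @consT R n).
  by apply: measurableT_comp => //; exact: measurable_consT.
rewrite !ge0_integral_lebS//; last first.
  by apply: (measurableT_comp mf); exact: measurable_scaleT.
have mI : measurable_fun [set: measurableTypeR R] (fun x : measurableTypeR R => \int[leb (n:=n)]_t f (consT (x, t))).
  exact: (@measurable_integral_param _ _ _ (measurableTypeR R) _ (@leb R n) (f \o @consT R n)).
rewrite -[RHS](@ge0_integral_affine R c 0)//; last by move=> x; exact: integral_ge0.
rewrite exprS EFinM -muleA; congr (_ * _).
rewrite -ge0_integralZl//.
- apply: eq_integral => x _; rewrite addr0.
  rewrite -(IH (fun t => f (consT ((c * x)%R, t))))//.
  + by congr (_ * _); apply: eq_integral => t _; rewrite scaleT_cons.
  + exact: (@measurable_sect _ _ (measurableTypeR R) _ _ _ (f \o @consT R n)).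
- apply: (@measurable_integral_param _ _ _ (measurableTypeR R) _ (@leb R n) (fun p => f (scaleT c (consT p)))).
  by apply: (measurableT_comp mf); apply: measurableT_comp; [exact: measurable_scaleT|exact: measurable_consT].
- by move=> x _; exact: integral_ge0.
Qed.

End tuples.

(** * Gaussian integrals *)

Section gauss_linear.
Local Open Scope ereal_scope.
Context {R : realType}.
Local Notation mu := (@lebesgue_measure R).

Lemma measurable_affine (c b : R) : measurable_fun [set: measurableTypeR R] (fun x : measurableTypeR R => (c * x + b)%R).
Proof. by apply: measurable_funD => //; exact: measurable_funM. Qed.

Lemma measurable_EFin_gauss : measurable_fun [set: R] (fun x => (gauss_fun x)%:E).
Proof. by apply/measurable_EFinP; exact: measurable_gauss_fun. Qed.

Lemma integral_gauss_affine (c b : R) : c != 0%R ->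
  \int[mu]_y (gauss_fun (c * y + b)%R)%:E = (Num.sqrt pi / `|c|)%:E.
Proof.
move=> c0; have := @ge0_integral_affine R c b (EFin \o gauss_fun) c0.
have cp : (0 < `|c|)%R by rewrite normr_gt0.
rewrite integralT_gauss => /(_ measurable_EFin_gauss) H.
have {}H := H (fun x => gauss_fun_ge0 x).
rewrite mulrC EFinM -H muleA -EFinM mulVf ?mul1e// gt_eqF//.
Qed.

Lemma gauss_plane_alg1 (p q w y : R) : p != 0%R ->
  (p^-1 * w + - (q * y) / p = (w - q * y) / p)%R.
Proof. by move=> p0; field. Qed.

Lemma gauss_plane_alg2 (p q w y : R) : p != 0%R -> (p * ((w - q * y) / p) + q * y = w)%R.
Proof. by move=> p0; field. Qed.

(** Completes the square in [y] after the substitution [w = p x + q y]; [N] is the length of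
    [(p, q)]. *)
Lemma gauss_plane_alg3 (p q w y N : R) : p != 0%R -> (0 < N)%R -> (N ^+ 2 = p ^+ 2 + q ^+ 2)%R ->
  (gauss_fun ((w - q * y) / p) * gauss_fun y =
   gauss_fun (w / N) * gauss_fun (N / `|p| * y + - (w * q / N / `|p|)))%R.
Proof.
move=> p0 N0 N2; have np0 : (0 < `|p|)%R by rewrite normr_gt0.
rewrite -!expRD; congr expR.
have -> : (((N / `|p|) * y - w * q / N / `|p|) ^+ 2 = (N * y - w * q / N) ^+ 2 / p ^+ 2)%R.
  by rewrite -(real_normK (num_real p)); field; rewrite !gt_eqF.
apply: (@mulfI _ (N ^+ 2 * p ^+ 2)%R); first by rewrite mulf_neq0 ?sqrf_eq0 ?(gt_eqF N0).
rewrite [LHS](_ : _ = - (N ^+ 2 * ((w - q * y) ^+ 2 + y ^+ 2 * p ^+ 2)))%R; last by field.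
rewrite [RHS](_ : _ = - ((w * p) ^+ 2 + (N ^+ 2 * y - w * q) ^+ 2))%R; last by field; rewrite p0 (gt_eqF N0).
by rewrite N2; ring.
Qed.

(** Rotation invariance of the Gaussian weight of the plane, from one-dimensional substitutions
    only: [w = p x + q y] replaces [x], the integrals are exchanged, and the inner one is a shifted
    Gaussian after completing the square. *)
Lemma gauss_plane (p q : R) (h : R -> \bar R) : (0 <= q)%R ->
  measurable_fun setT h -> (forall x, 0 <= h x) ->
  \int[mu]_x ((gauss_fun x)%:E * \int[mu]_y (h (p * x + q * y)%R * (gauss_fun y)%:E)) =
  (Num.sqrt pi)%:E * \int[mu]_y (h (Num.sqrt (p ^+ 2 + q ^+ 2) * y)%R * (gauss_fun y)%:E).
Proof.
move=> q0 mh h0.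
have hg0 (a b : R) : 0 <= h a * (gauss_fun b)%:E by rewrite mule_ge0// lee_fin gauss_fun_ge0.
have [->|p0] := eqVneq p 0%R.
  under eq_integral do under eq_integral do rewrite mul0r add0r.
  rewrite ge0_integralZr//; last 3 first.
  - exact: measurable_EFin_gauss.
  - by move=> x _; rewrite lee_fin gauss_fun_ge0.
  - exact: integral_ge0.
  by rewrite integralT_gauss expr0n/= add0r sqrtr_sqr ger0_norm.
set N := Num.sqrt (p ^+ 2 + q ^+ 2).
have N2 : (N ^+ 2 = p ^+ 2 + q ^+ 2)%R by rewrite sqr_sqrtr// addr_ge0 ?sqr_ge0.
have N0 : (0 < N)%R by rewrite sqrtr_gt0 ltr_wpDr ?sqr_ge0// exprn_even_gt0.
have np0 : (0 < `|p|)%R by rewrite normr_gt0.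
pose F (z : measurableTypeR R * measurableTypeR R) := h (p * z.1 + q * z.2)%R * (gauss_fun z.1 * gauss_fun z.2)%:E.
have mF : measurable_fun setT F.
  apply: emeasurable_funM.
    apply: (measurableT_comp mh); apply: measurable_funD; apply: measurable_funM => //.
  apply/measurable_EFinP/measurable_funM; apply: measurableT_comp => //; exact: measurable_gauss_fun.
have F0 z : 0 <= F z by rewrite mule_ge0// lee_fin mulr_ge0 ?gauss_fun_ge0.
transitivity (\int[mu]_x \int[mu]_y F (x, y)).
  apply: eq_integral => x _; rewrite -ge0_integralZl//.
  - by apply: eq_integral => y _; rewrite /F/= EFinM muleCA.
  - apply: emeasurable_funM; last exact: measurable_EFin_gauss.
    apply: (measurableT_comp mh); apply: measurable_funD => //; exact: measurable_funM.
  - by rewrite lee_fin gauss_fun_ge0.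
rewrite fubini_tonelli//.
(* The Gaussian weight of the plane in the variables [w] and [y]. *)
pose E (w y : measurableTypeR R) := (gauss_fun ((w - q * y) / p)%R * gauss_fun y)%R.
have mE : measurable_fun setT (fun z : measurableTypeR R * measurableTypeR R => E z.2 z.1).
  apply: measurable_funM; apply: measurableT_comp => //; try exact: measurable_gauss_fun.
  by apply: measurable_funM => //; apply: measurable_funB => //; exact: measurable_funM.
have E0 w y : (0 <= E w y)%R by rewrite mulr_ge0 ?gauss_fun_ge0.
have Fw y : \int[mu]_x F (x, y) = (`|p|^-1)%:E * \int[mu]_w (h w * (E w y)%:E).
  have mFy : measurable_fun [set: R] (fun x : R => F (x, y)).
    exact: (measurableT_comp mF (@measurable_pair2 _ _ (measurableTypeR R) (measurableTypeR R) y)).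
  have p'0 : (p^-1 != 0)%R by rewrite invr_neq0.
  have H := @ge0_integral_affine R p^-1 (- (q * y) / p)%R (fun x => F (x, y)) p'0 mFy (fun x => F0 (x, y)).
  apply: (etrans (esym H)); rewrite normfV; congr (_ * _); apply: eq_integral => w _.
  by rewrite /F/= /E gauss_plane_alg1// gauss_plane_alg2.
under eq_integral do rewrite Fw.
have mhE : measurable_fun setT (fun z : measurableTypeR R * measurableTypeR R => h z.2 * (E z.2 z.1)%:E).
  by apply: emeasurable_funM; [exact: (measurableT_comp mh)|exact/measurable_EFinP].
have hE0 w y : 0 <= h w * (E w y)%:E by rewrite mule_ge0// lee_fin.
rewrite ge0_integralZl//; last 2 first.
- have h1 := @measurable_integral_param R _ _ (measurableTypeR R) (measurableTypeR R) mu _ mhE.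
  exact h1.
- by move=> y _; exact: integral_ge0.
rewrite (@fubini_tonelli _ _ (measurableTypeR R) (measurableTypeR R) _ mu mu _ mhE)//.
have Ew w : \int[mu]_y (h w * (E w y)%:E) = h w * (gauss_fun (w / N)%R)%:E * (Num.sqrt pi * `|p| / N)%:E.
  rewrite ge0_integralZl//; last 2 first.
  - apply/measurable_EFinP.
    exact: (measurableT_comp mE (@measurable_pair2 _ _ (measurableTypeR R) (measurableTypeR R) w)).
  - by move=> y _; rewrite lee_fin.
  rewrite -muleA; congr (_ * _).
  transitivity (\int[mu]_y ((gauss_fun (w / N)%R)%:E * (gauss_fun (N / `|p| * y + - (w * q / N / `|p|))%R)%:E)).
    by apply: eq_integral => y _; rewrite /E -EFinM (gauss_plane_alg3 _ _ p0 N0 N2).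
  rewrite ge0_integralZl//.
  - rewrite integral_gauss_affine; last by rewrite mulf_neq0// ?invr_eq0 gt_eqF.
    congr (_ * _%:E); rewrite normrM normfV normr_id (ger0_norm (ltW N0)).
    by field; rewrite !gt_eqF.
  - by apply: (measurableT_comp measurable_EFin_gauss); exact: measurable_affine.
  - by move=> y _; rewrite lee_fin gauss_fun_ge0.
  - by rewrite lee_fin gauss_fun_ge0.
under eq_integral do rewrite /= Ew.
have mhN : measurable_fun [set: R] (fun w : R => h w * (gauss_fun (w / N)%R)%:E).
  apply: emeasurable_funM => //; apply: (measurableT_comp measurable_EFin_gauss).
  exact: measurable_funM.
rewrite ge0_integralZr//; last by rewrite lee_fin divr_ge0// ?ltW// mulr_ge0 ?sqrtr_ge0.
have N0' : (N != 0)%R by rewrite gt_eqF.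
have H := @ge0_integral_affine R N 0 _ N0' mhN (fun w => hg0 w _).
rewrite -H.
rewrite muleC -!muleA (muleC (\int[mu]_x _)) !muleA -!EFinM; congr (_%:E * _).
  rewrite gtr0_norm//; field; rewrite !gt_eqF//.
by apply: eq_integral => y _; rewrite addr0 mulrAC divff ?mul1r// gt_eqF.
Qed.

Definition gaussT n (x : n.-tuple R) : R := expR (- inner_Rn x x).

Lemma gaussT_ge0 n (x : n.-tuple R) : (0 <= gaussT x)%R.
Proof. exact: expR_ge0. Qed.

Lemma gaussT_norm n (x : n.-tuple R) : gaussT x = gauss_fun (norm_Rn x).
Proof. by rewrite /gaussT /gauss_fun norm_sqr. Qed.

Lemma measurable_gaussT n : measurable_fun [set: n.-tuple R] (@gaussT n).
Proof.
apply: measurableT_comp => //; apply: measurableT_comp => //.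
by apply: measurable_inner.
Qed.

Lemma gaussT_cons n x (t : n.-tuple R) : gaussT (consT (x, t)) = (gauss_fun x * gaussT t)%R.
Proof. by rewrite /gaussT inner_cons opprD expRD /gauss_fun expr2. Qed.

(** The projection of a Gaussian vector on [z] is Gaussian with scale [|z|]. In the induction
    [gauss_plane] merges the head coordinate with the variable that represents the tail. The powers
    of [sqrt pi] are the masses of the unnormalised weights. *)
Lemma gauss_linear n (z : n.-tuple R) (h : R -> \bar R) :
  measurable_fun setT h -> (forall x, 0 <= h x) ->
  (Num.sqrt pi)%:E * \int[@leb R n]_x (h (inner_Rn x z) * (gaussT x)%:E) =
  (Num.sqrt pi ^+ n)%:E * \int[mu]_y (h (norm_Rn z * y)%R * (gauss_fun y)%:E).
Proof.
elim: n z h => [|n IH] z h mh h0.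
  have i0 (u v : 0.-tuple R) : inner_Rn u v = 0%R by rewrite /inner_Rn big_ord0.
  rewrite integral_leb0; last first.
    apply: emeasurable_funM; last by apply/measurable_EFinP; exact: measurable_gaussT.
    by apply: (measurableT_comp mh); apply: measurable_inner.
  rewrite /gaussT /norm_Rn !i0 sqrtr0 oppr0 expR0 mule1 expr0 mul1e.
  under [RHS]eq_integral do rewrite mul0r.
  rewrite ge0_integralZl//; last 2 first.
  - exact: measurable_EFin_gauss.
  - by move=> y _; rewrite lee_fin gauss_fun_ge0.
  by rewrite integralT_gauss muleC.
have [z1 [z' ->]] : exists z1 z', z = consT (z1, z').
  by exists (uncons z).1, (uncons z).2; rewrite -[LHS]unconsK; case: (uncons z).
have mF : measurable_fun [set: n.+1.-tuple R] (fun x : n.+1.-tuple R => h (inner_Rn x (consT (z1, z'))) * (gaussT x)%:E).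
  apply: emeasurable_funM; last by apply/measurable_EFinP; exact: measurable_gaussT.
  by apply: (measurableT_comp mh); apply: measurable_inner.
have hg0 (m : nat) (a : R) (t : m.-tuple R) : 0 <= h a * (gaussT t)%:E.
  by rewrite mule_ge0// lee_fin gaussT_ge0.
rewrite ge0_integral_lebS//.
have mh' x : measurable_fun [set: R] (fun s : R => h (z1 * x + s)%R).
  by apply: (measurableT_comp mh); exact: measurable_funD.
have mG x : measurable_fun [set: n.-tuple R] (fun t : n.-tuple R => h (z1 * x + inner_Rn t z')%R * (gaussT t)%:E).
  apply: emeasurable_funM; last by apply/measurable_EFinP; exact: measurable_gaussT.
  by apply: (measurableT_comp (mh' x)); apply: measurable_inner.
have E1 x : (Num.sqrt pi)%:E * \int[leb (n:=n)]_t (h (inner_Rn (consT (x, t)) (consT (z1, z'))) * (gaussT (consT (x, t)))%:E)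
   = (Num.sqrt pi ^+ n)%:E * ((gauss_fun x)%:E * \int[mu]_y (h (z1 * x + norm_Rn z' * y)%R * (gauss_fun y)%:E)).
  rewrite muleCA -(IH z' (fun s => h (z1 * x + s)%R))//.
  rewrite muleCA; congr (_ * _).
  rewrite -ge0_integralZl//; last by rewrite lee_fin gauss_fun_ge0.
  apply: eq_integral => t _.
  by rewrite inner_cons gaussT_cons EFinM (mulrC x) muleCA.
have sp0 : 0 <= (Num.sqrt pi : R)%:E by rewrite lee_fin sqrtr_ge0.
have mI : measurable_fun [set: measurableTypeR R] (fun x : measurableTypeR R =>
    \int[leb (n:=n)]_t (h (inner_Rn (consT (x, t)) (consT (z1, z'))) * (gaussT (consT (x, t)))%:E)).
  have := @measurable_integral_param R _ _ (measurableTypeR R) _ (@leb R n) _ (measurableT_comp mF (@measurable_consT R n)).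
  by [].
rewrite -ge0_integralZl//; last by move=> x _; exact: integral_ge0.
under eq_integral do rewrite E1.
rewrite ge0_integralZl//; last 2 first.
- apply: emeasurable_funM; first exact: measurable_EFin_gauss.
  have mhp : measurable_fun setT (fun p : measurableTypeR R * measurableTypeR R =>
    h (z1 * p.1 + norm_Rn z' * p.2)%R * (gauss_fun p.2)%:E).
    apply: emeasurable_funM.
      by apply: (measurableT_comp mh); apply: measurable_funD; apply: measurable_funM.
    by apply/measurable_EFinP; apply: measurableT_comp => //; exact: measurable_gauss_fun.
  have := @measurable_integral_param R _ _ (measurableTypeR R) (measurableTypeR R) mu _ mhp.
  by [].
- move=> x _; apply: mule_ge0; first by rewrite lee_fin gauss_fun_ge0.
  by apply: integral_ge0 => y _; rewrite mule_ge0// lee_fin gauss_fun_ge0.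
rewrite gauss_plane//; last exact: norm_ge0.
rewrite norm_sqr muleA -EFinM -exprSr.
by rewrite /norm_Rn inner_cons -expr2.
Qed.

Lemma integral_gaussT n : \int[@leb R n]_x (gaussT x)%:E = (Num.sqrt pi ^+ n)%:E.
Proof.
have sp : (0 < Num.sqrt pi :> R)%R by rewrite sqrtr_gt0 pi_gt0.
have := @gauss_linear n (nseq_tuple n 0%R) (cst 1) (measurable_cst _) (fun=> lee01).
under eq_integral do rewrite mul1e.
under [X in _ = _ * X -> _]eq_integral do rewrite mul1e.
rewrite integralT_gauss muleC -!EFinM => /(congr1 (fun x => x * ((Num.sqrt pi)^-1)%:E)).
by rewrite -muleA -!EFinM mulfV ?gt_eqF// mulfK ?gt_eqF// mule1.
Qed.

End gauss_linear.

(** * Moments of the Gaussian weight on the half-line *)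

Section gauss_moments.
Local Open Scope ereal_scope.
Context {R : realType}.
Local Notation mu := (@lebesgue_measure R).

(** Half of the Gamma function at [(k + 1) / 2], see [GammaR_half]. With an integer exponent the
    functional equation becomes an integration by parts of smooth functions. *)
Definition gmom (k : nat) : \bar R :=
  \int[mu]_(u in `[0%R, +oo[) (u ^+ k * gauss_fun u)%:E.

Lemma gmom_fun_ge0 k (u : R) : (0 <= u)%R -> (0 <= u ^+ k * gauss_fun u)%R.
Proof. by move=> u0; rewrite mulr_ge0 ?exprn_ge0 ?gauss_fun_ge0. Qed.

Lemma continuous_gmom_fun k : continuous (fun u : R => u ^+ k * gauss_fun u)%R.
Proof. by move=> u; apply: cvgM; [exact: exprn_continuous|exact: continuous_gauss_fun]. Qed.

Lemma is_derive_gauss (x : R) : is_derive x 1%R (@gauss_fun R) (- 2 * x * gauss_fun x)%R.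
Proof.
rewrite /gauss_fun; apply: is_derive_eq.
by rewrite /GRing.scale/= ?mulr1; ring.
Qed.

Lemma cvgn_expn_gauss k : (n%:R ^+ k * gauss_fun n%:R : R)%R @[n --> \oo] --> 0%R.
Proof.
apply/cvgrPdist_le => e e0; near=> n.
have n0 : (0 < n%:R :> R)%R by rewrite ltr0n; near: n; exists 1%N.
rewrite sub0r normrN ger0_norm; last by rewrite gmom_fun_ge0// ltW.
have kn : ((k.+1)`!%:R <= e * n%:R)%R by rewrite mulrC -ler_pdivrMr//; near: n; exact: nbhs_infty_ger.
rewrite /gauss_fun expRN ler_pdivrMr ?expR_gt0//.
have n1 : (1 <= n%:R :> R)%R by rewrite ler1n -(ltr0n R).
have kf : (0 < (k.+1)`!%:R :> R)%R by rewrite ltr0n fact_gt0.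
(* One term of the exponential series, of degree [k + 1] in [n ^ 2], already outgrows [n ^ k]. *)
have : ((n%:R ^+ 2) ^+ k.+1 / k.+1`!%:R <= expR (n%:R ^+ 2) :> R)%R.
  by apply: le_trans (expR_ge1Dxn k (sqr_ge0 _)); rewrite lerDr.
rewrite ler_pdivrMr// => h.
rewrite -(ler_pM2r kf) -mulrA; apply: (@le_trans _ _ (e * (n%:R ^+ 2) ^+ k.+1)%R); last first.
  by rewrite ler_pM2l.
apply: (@le_trans _ _ (n%:R ^+ k * (e * n%:R))%R).
  by apply: ler_wpM2l => //; rewrite exprn_ge0// ltW.
rewrite mulrCA -exprSr; apply: ler_wpM2l; first exact: ltW.
by rewrite -exprM ler_weXn2l// leq_pmull.
Unshelve. all: by end_near. Qed.

Lemma cvg_gmom k : \int[mu]_(u in `[0%R, n%:R]) (u ^+ k * gauss_fun u)%:E @[n --> \oo] --> gmom k.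
Proof.
pose f (u : R) := (`|u| ^+ k * gauss_fun u)%R.
have mf : measurable_fun setT f.
  apply: measurable_funM; last exact: measurable_gauss_fun.
  by apply: measurable_funX; exact: normr_measurable.
have f0 u : (0 <= f u)%R by rewrite mulr_ge0 ?exprn_ge0 ?gauss_fun_ge0.
have := @ge0_cvgn_integral R mu f f0 mf.
rewrite /gmom.
have -> : \int[mu]_(x in `[0%R, +oo[) (f x)%:E = \int[mu]_(u in `[0%R, +oo[) (u ^+ k * gauss_fun u)%:E.
  by apply: eq_integral => u; rewrite inE/= in_itv/= andbT => u0; rewrite /f ger0_norm.
apply: cvg_trans; apply: near_eq_cvg; apply: nearW => n.
by apply: eq_integral => u; rewrite inE/= in_itv/= => /andP[u0 _]; rewrite /f ger0_norm.
Qed.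

(** Integration by parts on [[0, n]], then the limit. In product form among extended reals it also
    propagates finiteness, from the moments 0 and 1 to all others. *)
Lemma gmomS2 k : (k.+1%:R)%:E * gmom k = 2%:E * gmom k.+2.
Proof.
pose c n : R := (n%:R ^+ k.+1 * gauss_fun n%:R)%R.
have AB n : (0 < n)%N -> k.+1%:R%:E * \int[mu]_(u in `[0%R, n%:R]) (u ^+ k * gauss_fun u)%:E =
   (c n)%:E + 2%:E * \int[mu]_(u in `[0%R, n%:R]) (u ^+ k.+2 * gauss_fun u)%:E.
  move=> n0; have n0' : (0 < n%:R :> R)%R by rewrite ltr0n.
  have intk j : mu.-integrable `[0%R, n%:R] (fun u => (u ^+ j * gauss_fun u)%:E).
    apply: continuous_compact_integrable; first exact: segment_compact.
    by apply: continuous_subspaceT; exact: continuous_gmom_fun.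
  have fk j : \int[mu]_(u in `[0%R, n%:R]) (u ^+ j * gauss_fun u)%:E = (\int[mu]_(u in `[0%R, n%:R]) (u ^+ j * gauss_fun u)%R)%:E.
    by rewrite fineK//; apply: integrable_fin_num (intk j); exact: measurable_itv.
  rewrite !fk -!EFinM -EFinD; congr EFin.
  have := @Rintegration_by_parts R (fun u => u ^+ k.+1)%R (@gauss_fun R)
    (fun u => k.+1%:R * u ^+ k)%R (fun u => - 2 * u * gauss_fun u)%R 0%R n%:R n0'.
  rewrite (_ : (\int[mu]_(x in _) (_ * (- 2 * x * _)))%R =
     (- 2 * \int[mu]_(u in `[0%R, n%:R]) (u ^+ k.+2 * gauss_fun u))%R); last first.
    rewrite -(RintegralZl _ _ (intk k.+2)); last exact: measurable_itv.
    by congr fine; apply: eq_integral => u _; rewrite !exprS; congr EFin; ring.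
  rewrite (_ : (\int[mu]_(x in _) (_ * _ * gauss_fun x))%R =
     (k.+1%:R * \int[mu]_(u in `[0%R, n%:R]) (u ^+ k * gauss_fun u))%R); last first.
    rewrite -(RintegralZl _ _ (intk k)); last exact: measurable_itv.
    by congr fine; apply: eq_integral => u _; rewrite mulrA.
  rewrite expr0n/= mul0r subr0 => H.
  suff H2 : (- 2 * \int[mu]_(u in `[0, n%:R]) (u ^+ k.+2 * gauss_fun u) =
      n%:R ^+ k.+1 * gauss_fun n%:R - k.+1%:R * \int[mu]_(u in `[0, n%:R]) (u ^+ k * gauss_fun u))%R.
    by rewrite -[(2 * _)%R]opprK -mulNr H2 opprB addrC subrK.
  apply: H.
  - by apply: continuous_subspaceT => u; apply: cvgM; [exact: cvg_cst|exact: exprn_continuous].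
  - split.
    + by move=> x _; exact: exprn_derivable.
    + by apply: cvg_at_right_filter; exact: exprn_continuous.
    + by apply: cvg_at_left_filter; exact: exprn_continuous.
  - by move=> x _; rewrite exp_derive1.
  - apply: continuous_subspaceT => u; apply: cvgM; last exact: continuous_gauss_fun.
    by apply: cvgM; [exact: cvg_cst|exact: cvg_id].
  - split.
    + by move=> x _; have [] := is_derive_gauss x.
    + by apply: cvg_at_right_filter; exact: continuous_gauss_fun.
    + by apply: cvg_at_left_filter; exact: continuous_gauss_fun.
  - by move=> x _; have [_ <-] := is_derive_gauss x; rewrite derive1E.
have c0 : (c n)%:E @[n --> \oo] --> 0%:E by apply: cvg_EFin; [exact: nearW|exact: cvgn_expn_gauss].
have h1 : k.+1%:R%:E * \int[mu]_(u in `[0%R, n%:R]) (u ^+ k * gauss_fun u)%:E @[n --> \oo] --> k.+1%:R%:E * gmom k.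
  by apply: cvgeZl => //; exact: cvg_gmom.
have h2 : (c n)%:E + 2%:E * \int[mu]_(u in `[0%R, n%:R]) (u ^+ k.+2 * gauss_fun u)%:E @[n --> \oo] --> 0%:E + 2%:E * gmom k.+2.
  apply: cvgeD => //; last by apply: cvgeZl => //; exact: cvg_gmom.
rewrite add0e in h2.
apply: cvg_unique h1 _ => //.
apply: cvg_trans h2; apply: near_eq_cvg; near=> n; apply/esym/AB; near: n; exists 1%N => //.
Unshelve. all: by end_near. Qed.

Lemma gmom0 : gmom 0 = (Num.sqrt pi / 2)%:E.
Proof.
by rewrite -integral0y_gauss; apply: eq_integral => u _; rewrite expr0 mul1r.
Qed.

Lemma gmom1 : gmom 1 = (2^-1)%:E.
Proof.
rewrite /gmom (@ge0_continuous_FTC2y R _ (fun u => - 2^-1 * gauss_fun u)%R 0%R 0%R).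
- by rewrite /gauss_fun expr0n/= oppr0 expR0 -EFinB; congr EFin; ring.
- by move=> x x0; rewrite gmom_fun_ge0.
- by apply: continuous_subspaceT; exact: continuous_gmom_fun.
- rewrite -[X in _ --> X](mulr0 (- 2^-1)%R); apply: cvgM; first exact: cvg_cst.
  exact: cvg_gauss_fun.
- by move=> x _; apply: derivableM => //; have [] := is_derive_gauss x.
- by apply: cvg_at_right_filter; apply: cvgM; [exact: cvg_cst|exact: continuous_gauss_fun].
- move=> x _; have [dg vg] := is_derive_gauss x; rewrite derive1E deriveM// vg.
  by rewrite derive_cst scaler0 addr0 /GRing.scale/=; field.
Qed.

Lemma gmom_fin_gt0 k : gmom k \is a fin_num /\ (0 < fine (gmom k))%R.
Proof.
have step j : gmom j \is a fin_num /\ (0 < fine (gmom j))%R ->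
    gmom j.+2 \is a fin_num /\ (0 < fine (gmom j.+2))%R.
  move=> [fj gj]; have := gmomS2 j.
  rewrite -(fineK fj) -EFinM => /(congr1 (fun x => (2^-1)%:E * x)).
  rewrite muleA -!EFinM mulVf// mul1e => <-; split => //=.
  by rewrite mulr_gt0// mulr_gt0.
have : (gmom k \is a fin_num /\ (0 < fine (gmom k))%R) /\
    (gmom k.+1 \is a fin_num /\ (0 < fine (gmom k.+1))%R).
  elim: k => [|k [h1 h2]]; last by split => //; exact: step.
  rewrite gmom0 gmom1; split; split => //=.
  by rewrite divr_gt0// sqrtr_gt0 pi_gt0.
by case.
Qed.

End gauss_moments.

(** * The Gamma function at half-integers *)

Section gamma.
Local Open Scope ereal_scope.
Context {R : realType}.
Local Notation mu := (@lebesgue_measure R).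

Lemma itv0y_indic (f : R -> \bar R) :
  \int[mu]_(u in `[0%R, +oo[) f u = \int[mu]_u (f u * (\1_(`[0%R, +oo[%classic : set R) u)%:E).
Proof.
rewrite integral_mkcond; apply: eq_integral => u _.
by rewrite patchE indicE; case: ifP; rewrite (mule1, mule0).
Qed.

(** The distribution function that [ge0_integral_transfer] asks for; the indicator confines the
    density to the half-line. *)
Lemma integral_exprn_ray (p : nat) (c b : R) : (0 <= c)%R ->
  \int[mu]_(u in [set u | (u <= b)%R]) (c * (p.+1%:R * u ^+ p) * \1_(`[0%R, +oo[%classic : set R) u)%:E =
  (c * (if (0 <= b)%R then b ^+ p.+1 else 0%R))%:E.
Proof.
move=> c0.
transitivity (\int[mu]_(u in `[0%R, b]) (c * (p.+1%:R * u ^+ p))%:E).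
  rewrite integral_mkcond [RHS]integral_mkcond; apply: eq_integral => u _.
  rewrite !patchE indicE.
  have -> : (u \in [set u : R | (u <= b)%R]) = (u <= b)%R.
    by apply/idP/idP => [/set_mem//|h]; exact: mem_set.
  have -> : (u \in (`[0%R, +oo[%classic : set R)) = (0 <= u)%R.
    by apply/idP/idP => [/set_mem/=|h]; rewrite ?in_itv/= ?andbT//; apply: mem_set; rewrite /= in_itv/= andbT.
  have -> : (u \in (`[0%R, b]%classic : set R)) = (0 <= u <= b)%R.
    by apply/idP/idP => [/set_mem/=|h]; rewrite ?in_itv//; apply: mem_set; rewrite /= in_itv.
  by case: (leP 0%R u) => u0; case: (leP u b) => ub; rewrite /= ?mulr1 ?mulr0.
have mn : measurable_fun (`[0%R, b]%classic : set R) (fun u => (p.+1%:R * u ^+ p)%:E : \bar R).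
  apply/measurable_EFinP; apply: measurable_funM => //; apply: measurable_funX => //.
under eq_integral do rewrite EFinM.
rewrite ge0_integralZl//.
- case: leP => b0; first by rewrite integral_exprn.
  by rewrite set_itv_ge -?leNgt ?bnd_simp -?ltNge// integral_set0 mulr0 mule0.
- by move=> u /=; rewrite in_itv/= => /andP[u0 _]; rewrite lee_fin mulr_ge0 ?exprn_ge0.
Qed.

Lemma integral_sqr_subst (G : R -> \bar R) : measurable_fun setT G -> (forall x, 0 <= G x) ->
  \int[mu]_(z in `[0%R, +oo[) G z = \int[mu]_(u in `[0%R, +oo[) (G (u ^+ 2)%R * (2 * u)%:E).
Proof.
move=> mG G0; rewrite !itv0y_indic.
have mI : measurable_fun [set: measurableTypeR R] (\1_(`[0%R, +oo[%classic : set R) : R -> R).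
  by apply: measurable_indic; exact: measurable_itv.
pose w1 (u : measurableTypeR R) : R := \1_(`[0%R, +oo[%classic : set R) u.
pose w2 (u : measurableTypeR R) : R := (2 * u * \1_(`[0%R, +oo[%classic : set R) u)%R.
have mw2 : measurable_fun setT w2.
  by apply: measurable_funM => //; exact: measurable_funM.
have I0 (u : R) : (\1_(`[0%R, +oo[%classic : set R) u = if (0 <= u)%R then 1 else 0 :> R)%R.
  rewrite indicE (_ : (u \in _) = (0 <= u)%R); first by case: ifP.
  by apply/idP/idP => [/set_mem/=|h]; rewrite ?in_itv/= ?andbT//; apply: mem_set; rewrite /= in_itv/= andbT.
have w10 u : (0 <= w1 u)%R by rewrite /w1 I0; case: ifP.
have w20 u : (0 <= w2 u)%R by rewrite /w2 I0; case: ifP => u0; rewrite ?mulr1 ?mulr0 ?mulr_ge0.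
have E1 b : \int[mu]_(x in [set x : R | (x <= b)%R]) (w1 x)%:E = (if (0 <= b)%R then b else 0%R)%:E.
  have := @integral_exprn_ray 0 1 b ler01; rewrite mul1r expr1 => <-.
  by apply: eq_integral => u _; rewrite /w1 mul1r expr0 !mul1r.
have E2 b : \int[mu]_(x in [set x : R | (x ^+ 2 <= b)%R]) (w2 x)%:E = (if (0 <= b)%R then b else 0%R)%:E.
  have [b0|b0] := leP 0%R b; last first.
    rewrite (_ : [set x | _] = set0) ?integral_set0//.
    apply/seteqP; split => x//= xb; have := le_lt_trans xb b0.
    by rewrite ltNge sqr_ge0.
  have := @integral_exprn_ray 1 1 (Num.sqrt b) ler01.
  rewrite sqrtr_ge0 mul1r sqr_sqrtr// => <-.
  rewrite integral_mkcond [RHS]integral_mkcond; apply: eq_integral => u _.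
  rewrite !patchE /w2 I0 mul1r expr1.
  have -> : (u \in [set u : R | (u <= Num.sqrt b)%R]) = (u <= Num.sqrt b)%R.
    by apply/idP/idP => [/set_mem//|h]; exact: mem_set.
  have -> : (u \in [set u : R | (u ^+ 2 <= b)%R]) = (u ^+ 2 <= b)%R.
    by apply/idP/idP => [/set_mem//|h]; exact: mem_set.
  case: (leP 0%R u) => u0; last by rewrite mulr0; case: ifP; case: ifP.
  have -> : (u ^+ 2 <= b)%R = (u <= Num.sqrt b)%R; last by [].
  by rewrite -[u in RHS]ger0_norm// -sqrtr_sqr ler_sqrt.
transitivity (\int[mu]_x (G x * (w1 x)%:E)) => //.
transitivity (\int[mu]_x (G (x ^+ 2)%R * (w2 x)%:E)); last first.
  by apply: eq_integral => x _; rewrite -muleA -EFinM.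
apply: (@ge0_integral_transfer R _ _ (measurableTypeR R) (measurableTypeR R) mu mu idfun (fun x => x ^+ 2)%R w1 w2) => //.
- exact: measurable_id.
- by move=> b; rewrite E1 E2.
- by move=> b; rewrite E1 ltry.
Qed.

Lemma GammaR_half k : GammaR (k.+1%:R / 2) = (2 * fine (gmom (R:=R) k))%R.
Proof.
rewrite /GammaR /Rintegral.
have mG : measurable_fun [set: R] (fun z : R => (z `^ (k.+1%:R / 2 - 1) * expR (- z))%:E : \bar R).
  apply/measurable_EFinP; apply: measurable_funM; first exact: measurable_powR.
  by apply: measurableT_comp.
rewrite integral_sqr_subst//; last by move=> z; rewrite lee_fin mulr_ge0 ?powR_ge0 ?expR_ge0.
have -> : (2 * fine (gmom (R:=R) k))%R = fine (2%:E * gmom (R:=R) k).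
  by have [f _] := gmom_fin_gt0 (R := R) k; rewrite fineM.
congr fine.
have mg : measurable_fun [set: R] (fun u : R => (u ^+ k * gauss_fun u)%:E : \bar R).
  by apply/measurable_EFinP; apply: measurable_funM => //; exact: measurable_gauss_fun.
rewrite /gmom -ge0_integralZl//; last 2 first.
- exact: measurable_funTS.
- by move=> u /=; rewrite in_itv/= andbT => u0; rewrite lee_fin gmom_fun_ge0.
(* The endpoint 0 is dropped, since the powers of [u] simplify only for [u > 0]. *)
rewrite -[LHS]integral_itv_obnd_cbnd; last first.
  apply: measurable_funTS; apply: emeasurable_funM.
    by apply: (measurableT_comp mG); exact: measurable_funX.
  by apply/measurable_EFinP; exact: measurable_funM.
rewrite -[RHS]integral_itv_obnd_cbnd; last first.
  by apply: measurable_funTS; exact: measurable_funeM.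
apply: eq_integral => u; rewrite inE/= in_itv/= andbT => u0.
rewrite -!EFinM; congr EFin.
rewrite -powR_mulrn ?ltW// -powRrM.
have -> : (2%:R * (k.+1%:R / 2 - 1) = k%:R - 1 :> R)%R.
  by rewrite -natr1; field.
have -> : (u `^ (k%:R - 1) = u ^+ k / u)%R.
  rewrite powRD; last by apply/implyP => _; rewrite gt_eqF.
  by rewrite powR_mulrn ?ltW// powRN powRr1 ?ltW.
rewrite powR_mulrn ?ltW// /gauss_fun; field.
by rewrite gt_eqF.
Qed.

End gamma.

(** * Polar coordinates and Bessel functions *)

Section polar.
Local Open Scope ereal_scope.
Context {R : realType}.
Local Notation mu := (@lebesgue_measure R).

Lemma inner_sqr_le n (x z : n.-tuple R) : (inner_Rn x z ^+ 2 <= inner_Rn x x * inner_Rn z z)%R.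
Proof.
have H (a b : R) : (0 <= a ^+ 2 * inner_Rn x x - 2 * (a * b) * inner_Rn x z + b ^+ 2 * inner_Rn z z)%R.
  have -> : (a ^+ 2 * inner_Rn x x - 2 * (a * b) * inner_Rn x z + b ^+ 2 * inner_Rn z z =
      \sum_(i < n) (a * tnth x i - b * tnth z i) ^+ 2)%R.
    rewrite /inner_Rn !mulr_sumr -sumrB -big_split; apply: eq_bigr => i _ /=; ring.
  by apply: sumr_ge0 => i _; exact: sqr_ge0.
have := inner_ge0 z; rewrite le_eqVlt => /predU1P[z0|z0].
  rewrite -z0 mulr0; have [//|xz] := leP (inner_Rn x z ^+ 2)%R 0%R.
  have xz0 : inner_Rn x z != 0%R by rewrite -sqrf_eq0 gt_eqF.
  (* The second coefficient is chosen so that the nonnegative quadratic form would equal [-1]. *)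
  have := H 1%R ((inner_Rn x x + 1) / (2 * inner_Rn x z))%R.
  rewrite -z0 mulr0 addr0 expr1n mul1r.
  have -> : (2 * (1 * ((inner_Rn x x + 1) / (2 * inner_Rn x z))) * inner_Rn x z = inner_Rn x x + 1)%R.
    by field.
  by rewrite opprD addrA subrr add0r oppr_ge0 ler10.
have := H (inner_Rn z z) (inner_Rn x z).
rewrite (_ : (_ - _ + _)%R = inner_Rn z z * (inner_Rn x x * inner_Rn z z - inner_Rn x z ^+ 2))%R; last by ring.
by rewrite pmulr_rge0// subr_ge0.
Qed.

Lemma inner_norm_le n (x z : n.-tuple R) : (`|inner_Rn x z| <= norm_Rn x * norm_Rn z)%R.
Proof.
rewrite -ler_sqr ?nnegrE ?mulr_ge0 ?norm_ge0//.
by rewrite real_normK ?num_real// exprMn !norm_sqr inner_sqr_le.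
Qed.

Section polar_sect.
Variables (n : nat) (k : n.+1.-tuple R -> R) (kappa : R).
Hypotheses (mk : measurable_fun [set: n.+1.-tuple R] k) (k0 : forall x, (0 <= k x)%R)
  (hk : forall c x, (0 < c)%R -> k (scaleT c x) = k x)
  (ik : \int[@leb R n.+1]_(x in [set x | (norm_Rn x <= 1)%R]) (k x)%:E = kappa%:E).

Let mball (b : R) : measurable [set x : n.+1.-tuple R | (norm_Rn x <= b)%R].
Proof.
have := @measurable_norm_Rn R n.+1 measurableT `]-oo, b]%classic (measurable_itv _).
by rewrite setTI (_ : _ @^-1` _ = [set x : n.+1.-tuple R | (norm_Rn x <= b)%R])//; apply/seteqP; split => x /=; rewrite in_itv.
Qed.

(** Since [k] is constant along rays, scaling the unit ball by [b] multiplies the integral by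
    [b ^ (n + 1)]. *)
Lemma ball_kappa b : \int[@leb R n.+1]_(x in [set x | (norm_Rn x <= b)%R]) (k x)%:E =
  (kappa * (if (0 <= b)%R then b ^+ n.+1 else 0%R))%:E.
Proof.
have mI c : measurable_fun [set: n.+1.-tuple R] ((EFin \o k) \_ [set x | (norm_Rn x <= c)%R]).
  apply/(measurable_restrictT _ (mball c)); apply: measurable_funTS; exact/measurable_EFinP.
have I0 c x : 0 <= ((EFin \o k) \_ [set x | (norm_Rn x <= c)%R]) x.
  by rewrite patchE; case: ifP => // _; rewrite lee_fin.
have pos c : (0 < c)%R -> \int[@leb R n.+1]_(x in [set x | (norm_Rn x <= c)%R]) (k x)%:E =
    (kappa * c ^+ n.+1)%:E.
  move=> c0; rewrite integral_mkcond.
  have c0' : c != 0%R by rewrite gt_eqF.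
  have /esym H := @ge0_integral_scaleT R n.+1 c _ c0' (mI c) (I0 c).
  apply: (etrans H); rewrite gtr0_norm// [in RHS]mulrC EFinM; congr (_ * _).
  rewrite -ik [RHS]integral_mkcond; apply: eq_integral => x _.
  rewrite !patchE/= hk//.
  suff -> : (scaleT c x \in [set x0 | (norm_Rn x0 <= c)%R]) = (x \in [set x0 | (norm_Rn x0 <= 1)%R]) by [].
  by apply/idP/idP => /set_mem/= h; apply: mem_set; move: h; rewrite /= norm_scale gtr0_norm// -ler_pdivlMl// mulVf.
have [b0|b0] := leP 0%R b; last first.
  rewrite mulr0 (_ : [set x | _] = set0) ?integral_set0//.
  apply/seteqP; split => x//= xb; have := le_lt_trans xb b0.
  by rewrite ltNge norm_ge0.
move: b0; rewrite le_eqVlt => /predU1P[<-|/pos//].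
(* Radius zero is not an invertible scaling of the unit ball; its integral is squeezed by those of
   small radii [c]. *)
rewrite expr0n/= mulr0; apply/eqP; rewrite eq_le; apply/andP; split; last first.
  by apply: integral_ge0 => x _; rewrite lee_fin.
apply/lee_addgt0Pr => e e0; rewrite add0e.
have kappa0 : (0 <= kappa)%R.
  by rewrite -lee_fin -ik; apply: integral_ge0 => x _; rewrite lee_fin.
pose c := (Num.min 1 (e / (kappa + 1)))%R.
have c0 : (0 < c)%R by rewrite lt_min ltr01 divr_gt0// ltr_wpDl.
apply: (@le_trans _ _ (\int[@leb R n.+1]_(x in [set x | (norm_Rn x <= c)%R]) (k x)%:E)).
  apply: ge0_subset_integral => //.
  - exact/measurable_EFinP/measurable_funTS.
  - by move=> x _; rewrite lee_fin.
  - by move=> x /= /le_trans; apply; exact: ltW.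
rewrite pos// lee_fin; apply: (@le_trans _ _ (kappa * c)%R).
  apply: ler_wpM2l => //; rewrite exprS; apply: ler_piMr; first exact: ltW.
  by apply: exprn_ile1; [exact: ltW|rewrite ge_min lexx].
apply: (@le_trans _ _ (kappa * (e / (kappa + 1)))%R).
  by apply: ler_wpM2l => //; rewrite ge_min lexx orbT.
have k1 : (0 < kappa + 1)%R by rewrite ltr_wpDl.
by rewrite mulrCA ler_piMr ?(ltW e0)// ler_pdivrMr// mul1r lerDl.
Qed.

(** The angular weight [k] enters only through its integral [kappa] over the unit ball, so no
    surface measure has to be built: both sides have the distribution function of [ball_kappa]. *)
Lemma polar (G : R -> \bar R) : measurable_fun setT G -> (forall u, 0 <= G u) ->
  \int[@leb R n.+1]_x (G (norm_Rn x) * (k x)%:E) =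
  \int[mu]_(u in `[0%R, +oo[) (G u * (kappa * (n.+1%:R * u ^+ n))%:E).
Proof.
move=> mG G0.
have kappa0 : (0 <= kappa)%R.
  by rewrite -lee_fin -ik; apply: integral_ge0 => x _; rewrite lee_fin.
have mI : measurable_fun [set: measurableTypeR R] (\1_(`[0%R, +oo[%classic : set R) : R -> R).
  by apply: measurable_indic; exact: measurable_itv.
pose w2 (u : measurableTypeR R) : R := (kappa * (n.+1%:R * u ^+ n) * \1_(`[0%R, +oo[%classic : set R) u)%R.
have mw2 : measurable_fun setT w2.
  apply: measurable_funM => //; apply: measurable_funM => //.
  by apply: measurable_funM => //; exact: measurable_funX.
have I0 (u : R) : (\1_(`[0%R, +oo[%classic : set R) u = if (0 <= u)%R then 1 else 0 :> R)%R.
  rewrite indicE (_ : (u \in _) = (0 <= u)%R); first by case: ifP.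
  by apply/idP/idP => [/set_mem/=|h]; rewrite ?in_itv/= ?andbT//; apply: mem_set; rewrite /= in_itv/= andbT.
have w20 u : (0 <= w2 u)%R.
  by rewrite /w2 I0; case: ifP => u0; rewrite ?mulr1 ?mulr0// !mulr_ge0// exprn_ge0.
rewrite itv0y_indic.
transitivity (\int[mu]_x (G x * (w2 x)%:E)); last first.
  by apply: eq_integral => x _; rewrite -muleA -EFinM.
apply: (@ge0_integral_transfer R _ _ (n.+1.-tuple R) (measurableTypeR R) (@leb R n.+1) mu (@norm_Rn R n.+1) idfun k w2) => //.
- exact: measurable_norm_Rn.
- exact: measurable_id.
- move=> b; rewrite ball_kappa//; apply/esym; exact: integral_exprn_ray.
- by move=> b; rewrite ball_kappa ltry.
Qed.
End polar_sect.
End polar.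

Section Rdct.
Context d (T : measurableType d) (R : realType).
Variables (mu : {measure set T -> \bar R}) (D : set T) (f_ : nat -> T -> R) (f g : T -> R).

Lemma Rintegral_dominated_cvg : measurable D ->
  (forall n, measurable_fun D (f_ n)) -> measurable_fun D f ->
  (forall x, D x -> f_ n x @[n --> \oo] --> f x) ->
  mu.-integrable D (EFin \o g) ->
  (forall n x, D x -> `|f_ n x| <= g x) ->
  \int[mu]_(x in D) f_ n x @[n --> \oo] --> \int[mu]_(x in D) f x.
Proof.
move=> mD mf_ mf f_f ig fg.
have [] := @dominated_convergence _ _ _ mu D mD (fun n x => (f_ n x)%:E) (EFin \o f) (EFin \o g).
- by move=> n; exact/measurable_EFinP.
- exact/measurable_EFinP.
- apply: aeW => x Dx; apply: cvg_EFin; [exact: nearW|exact: f_f].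
- exact: ig.
- by apply: aeW => x n Dx /=; rewrite lee_fin fg.
move=> intf _ cI; apply: fine_cvg.
rewrite /= fineK//; exact: integrable_fin_num.
Qed.

End Rdct.

(** * Spherical means of plane waves *)

Section sphere.
Local Open Scope ereal_scope.
Context {R : realType}.
Local Notation mu := (@lebesgue_measure R).

Definition gm k : R := fine (@gmom R k).

Lemma gmE k : gmom k = (gm k)%:E.
Proof. by rewrite fineK//; have [] := gmom_fin_gt0 (R := R) k. Qed.

Lemma gm_gt0 k : (0 < gm k)%R.
Proof. by have [] := gmom_fin_gt0 (R := R) k. Qed.

Lemma gmS2 k : (gm k.+2 = k.+1%:R / 2 * gm k)%R.
Proof.
have := gmomS2 (R := R) k; rewrite !gmE -!EFinM => -[H].
by rewrite mulrAC H; field.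
Qed.

(** Exchanges the factorials [(2 m)!] of the cosine series for the [m!] of the Bessel series. *)
Lemma gm_even m : (gm (2 * m) = Num.sqrt pi / 2 * ((2 * m)`!%:R / (4 ^+ m * m`!%:R)))%R.
Proof.
elim: m => [|m IH]; first by rewrite muln0 /gm gmom0/= fact0 expr0 mul1r divr1 mulr1.
rewrite mulnS add2n gmS2 IH !factS !natrM exprS.
have h1 : (m`!%:R != 0 :> R)%R by rewrite pnatr_eq0 -lt0n fact_gt0.
have h2 : (4 ^+ m != 0 :> R)%R by rewrite expf_neq0// pnatr_eq0.
have -> : ((2 * m).+2%:R = 2 * m.+1%:R :> R)%R by rewrite -natrM mulnS add2n.
have h3 : (m.+1%:R != 0 :> R)%R by rewrite pnatr_eq0.
move: (m.+1%:R : R) h3 => q h3; move: (4 ^+ m : R)%R h2 => p h2.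
move: (m`!%:R : R) h1 => r h1.
by field; rewrite h1 h2 h3.
Qed.

Section dir.
Variables (n : nat) (z : n.+1.-tuple R).

(** The scalar product of [z] with the unit vector of [x]. For Gaussian [x] that vector is uniform
    on the sphere, so integrating functions of [dir] against [gaussT] produces spherical means. *)
Definition dir (x : n.+1.-tuple R) : R := (inner_Rn x z / norm_Rn x)%R.

Lemma measurable_dir : measurable_fun [set: n.+1.-tuple R] dir.
Proof.
apply: measurable_funM; first by apply: measurable_inner.
rewrite (_ : (fun x => _) = (fun x => norm_Rn x `^ (-1))%R); last first.
  by apply/funext => x; rewrite powR_inv1// norm_ge0.
by apply: (measurableT_comp (measurable_powR _)); exact: measurable_norm_Rn.
Qed.

Lemma dir_scale c x : (0 < c)%R -> dir (scaleT c x) = dir x.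
Proof.
move=> c0; rewrite /dir inner_scalel norm_scale gtr0_norm// invfM mulrACA divff ?mul1r//.
by rewrite gt_eqF.
Qed.

Lemma dir_le x : (`|dir x| <= norm_Rn z)%R.
Proof.
rewrite /dir normrM normfV (ger0_norm (norm_ge0 _)).
have [->|x0] := eqVneq (norm_Rn x) 0%R; first by rewrite invr0 mulr0 norm_ge0.
by rewrite ler_pdivrMr ?lt_neqAle ?norm_ge0 ?andbT 1?eq_sym// mulrC inner_norm_le.
Qed.

Lemma dir_norm x : (dir x * norm_Rn x = inner_Rn x z)%R.
Proof.
rewrite /dir; have [x0|x0] := eqVneq (norm_Rn x) 0%R; last by rewrite divfK.
have := inner_norm_le x z; rewrite x0 mul0r normr_le0 => /eqP ->.
by rewrite mulr0.
Qed.

Lemma measurable_dirX m : measurable_fun [set: n.+1.-tuple R] (fun x => dir x ^+ (2 * m))%R.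
Proof. by apply: measurable_funX; exact: measurable_dir. Qed.

Lemma dirX_ge0 m x : (0 <= dir x ^+ (2 * m))%R.
Proof. by rewrite exprM exprn_ge0// sqr_ge0. Qed.

Lemma dirX_le m x : (dir x ^+ (2 * m) <= norm_Rn z ^+ (2 * m))%R.
Proof.
rewrite -[leLHS]ger0_norm ?dirX_ge0// normrX.
by apply: lerXn2r; rewrite ?nnegrE ?norm_ge0 ?dir_le.
Qed.

Definition sphmom m : R := fine (\int[@leb R n.+1]_x ((dir x ^+ (2 * m))%R * gaussT x)%:E).

Lemma sphmomE m : \int[@leb R n.+1]_x ((dir x ^+ (2 * m))%R * gaussT x)%:E = (sphmom m)%:E.
Proof.
rewrite fineK// ge0_fin_numE; last first.
  by apply: integral_ge0 => x _; rewrite lee_fin mulr_ge0 ?dirX_ge0 ?gaussT_ge0.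
apply: (@le_lt_trans _ _ (\int[@leb R n.+1]_x ((norm_Rn z ^+ (2 * m))%:E * (gaussT x)%:E))).
  apply: ge0_le_integral => //.
  - by move=> x _; rewrite lee_fin mulr_ge0 ?dirX_ge0 ?gaussT_ge0.
  - apply/measurable_EFinP; apply: measurable_funM; first exact: measurable_dirX.
    exact: measurable_gaussT.
  - by apply: measurable_funeM; apply/measurable_EFinP; exact: measurable_gaussT.
  - by move=> x _; rewrite -EFinM lee_fin; apply: ler_wpM2r; [exact: gaussT_ge0|exact: dirX_le].
rewrite ge0_integralZl//.
- by rewrite integral_gaussT -EFinM ltry.
- by apply/measurable_EFinP; exact: measurable_gaussT.
- by move=> x _; rewrite lee_fin gaussT_ge0.
- by rewrite lee_fin exprn_ge0// norm_ge0.
Qed.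

(** The Gaussian moment of [inner_Rn x z ^ (2 m)] computed twice: in polar coordinates, where radius
    and direction separate, and by projection on [z] with [gauss_linear]. *)
Lemma sphmom_moment m :
  (sphmom m * gm (n + 2 * m) = Num.sqrt pi ^+ n * norm_Rn z ^+ (2 * m) * (2 * gm (2 * m)) * gm n)%R.
Proof.
pose k x := (dir x ^+ (2 * m))%R.
have mk : measurable_fun [set: n.+1.-tuple R] k := measurable_dirX m.
have k0 x : (0 <= k x)%R := dirX_ge0 m x.
have hk c x : (0 < c)%R -> k (scaleT c x) = k x by move=> c0; rewrite /k dir_scale.
pose kap := fine (\int[@leb R n.+1]_(x in [set x | (norm_Rn x <= 1)%R]) (k x)%:E).
have mball : measurable [set x : n.+1.-tuple R | (norm_Rn x <= 1)%R].
  have := @measurable_norm_Rn R n.+1 measurableT `]-oo, 1%R]%classic (measurable_itv _).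
  by rewrite setTI (_ : _ @^-1` _ = [set x : n.+1.-tuple R | (norm_Rn x <= 1)%R])//; apply/seteqP; split => x /=; rewrite in_itv.
have ik : \int[@leb R n.+1]_(x in [set x | (norm_Rn x <= 1)%R]) (k x)%:E = kap%:E.
  rewrite fineK// ge0_fin_numE; last by apply: integral_ge0 => x _; rewrite lee_fin.
  (* Finite because [expR 1 * gaussT] is at least 1 on the unit ball. *)
  apply: (@le_lt_trans _ _ ((expR 1)%:E * (sphmom m)%:E)); last by rewrite -EFinM ltry.
  rewrite -sphmomE -ge0_integralZl//; last 2 first.
  - apply/measurable_EFinP; apply: measurable_funM; first exact: measurable_dirX.
    exact: measurable_gaussT.
  - by move=> x _; rewrite lee_fin mulr_ge0 ?dirX_ge0 ?gaussT_ge0.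
  rewrite [leLHS]integral_mkcond; apply: ge0_le_integral => //.
  - by move=> x _; rewrite patchE; case: ifP => // _; rewrite lee_fin.
  - by apply/(measurable_restrictT _ mball); apply: measurable_funTS; exact/measurable_EFinP.
  - apply: measurable_funeM; apply/measurable_EFinP; apply: measurable_funM; first exact: measurable_dirX.
    exact: measurable_gaussT.
  - move=> x _; rewrite patchE; case: ifP => [/set_mem/= x1|_]; last first.
      by rewrite -EFinM lee_fin mulr_ge0 ?expR_ge0// mulr_ge0 ?dirX_ge0 ?gaussT_ge0.
    rewrite -EFinM lee_fin mulrCA ler_peMr// gaussT_norm -expRD.
    by rewrite -[leLHS]expR0 ler_expR subr_ge0 expr_le1// norm_ge0.
have mG j : measurable_fun [set: R] (fun u : R => (`|u| ^+ j * gauss_fun u)%:E : \bar R).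
  apply/measurable_EFinP; apply: measurable_funM; last exact: measurable_gauss_fun.
  by apply: measurable_funX; exact: normr_measurable.
have G0 j u : 0 <= (`|u| ^+ j * gauss_fun u)%:E :> \bar R.
  by rewrite lee_fin mulr_ge0 ?exprn_ge0 ?gauss_fun_ge0.
have kap0 : (0 <= kap)%R.
  by rewrite fine_ge0//; apply: integral_ge0 => x _; rewrite lee_fin.
have P j : \int[@leb R n.+1]_x ((`|norm_Rn x| ^+ j * gauss_fun (norm_Rn x))%:E * (k x)%:E) =
    (kap * n.+1%:R * gm (n + j))%:E.
  have H := @polar R n k kap mk k0 hk ik _ (mG j) (G0 j).
  apply: (etrans H); rewrite EFinM -gmE /gmom -ge0_integralZl//.
  - apply: eq_integral => u; rewrite inE/= in_itv/= andbT => u0.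
    by rewrite -!EFinM ger0_norm// exprD; congr EFin; ring.
  - apply: measurable_funTS; apply/measurable_EFinP; apply: measurable_funM; last exact: measurable_gauss_fun.
    by apply: measurable_funX.
  - by move=> u /=; rewrite in_itv/= andbT => u0; rewrite lee_fin gmom_fun_ge0.
  - by rewrite lee_fin mulr_ge0.
have P0 : (sphmom m = kap * n.+1%:R * gm n)%R.
  apply: EFin_inj; rewrite -sphmomE -[n in gm n]addn0 -P; apply: eq_integral => x _.
  by rewrite expr0 mul1r -EFinM mulrC gaussT_norm.
have Pm : \int[@leb R n.+1]_x ((inner_Rn x z ^+ (2 * m))%:E * (gaussT x)%:E) = (kap * n.+1%:R * gm (n + 2 * m))%:E.
  rewrite -P; apply: eq_integral => x _; rewrite -!EFinM ger0_norm ?norm_ge0//.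
  by rewrite /k mulrAC -exprMn [(norm_Rn x * _)%R]mulrC dir_norm gaussT_norm.
have mh : measurable_fun [set: R] (fun y : R => (y ^+ (2 * m))%:E : \bar R).
  by apply/measurable_EFinP; exact: measurable_funX.
have h0 y : 0 <= (y ^+ (2 * m))%:E :> \bar R by rewrite lee_fin exprM exprn_ge0// sqr_ge0.
have := @gauss_linear R n.+1 z _ mh h0.
rewrite Pm => H.
have E : \int[mu]_y ((((norm_Rn z) * y) ^+ (2 * m))%:E * (gauss_fun y)%:E) = (norm_Rn z ^+ (2 * m) * (2 * gm (2 * m)))%:E.
  rewrite (EFinM (_ ^+ _)) [in RHS]EFinM -gmE.
  under eq_integral do rewrite -EFinM exprMn -mulrA EFinM.
  rewrite ge0_integralZl//; last 2 first.
  - apply/measurable_EFinP; apply: measurable_funM; last exact: measurable_gauss_fun.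
    exact: measurable_funX.
  - by move=> u _; rewrite lee_fin mulr_ge0 ?gauss_fun_ge0// -lee_fin h0.
  congr (_ * _); rewrite ge0_symfun_integralT.
  - by rewrite /gmom (_ : [set x | _] = `[0%R, +oo[%classic)//; apply/seteqP; split => x/=; rewrite in_itv/= andbT.
  - by move=> u; rewrite mulr_ge0 ?gauss_fun_ge0// -lee_fin h0.
  - exact: continuous_gmom_fun.
  - by move=> u; rewrite /comp/= !exprM sqrrN /gauss_fun sqrrN.
rewrite E -!EFinM in H; case: H => H.
have sp : (Num.sqrt pi != 0 :> R)%R by rewrite gt_eqF// sqrtr_gt0 pi_gt0.
apply: (mulfI sp); rewrite P0 mulrAC mulrA [(_ * (kap * _ * _))%R]H.
by rewrite exprS; ring.
Qed.

Lemma integrable_gaussT_bounded (f : n.+1.-tuple R -> R) (M : R) :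
  measurable_fun [set: n.+1.-tuple R] f -> (forall x, `|f x| <= M)%R ->
  (@leb R n.+1).-integrable setT (fun x => (f x * gaussT x)%:E).
Proof.
move=> mf fM.
have ig : (@leb R n.+1).-integrable setT (fun x => (M * gaussT x)%:E).
  apply: (eq_integrable _ (fun x => M%:E * (gaussT x)%:E)) => //.
  apply: integrableZl => //; apply/integrableP; split.
    by apply/measurable_EFinP; exact: measurable_gaussT.
  under eq_integral do rewrite gee0_abs ?lee_fin ?gaussT_ge0//.
  by rewrite integral_gaussT ltry.
apply: le_integrable ig => //.
  apply/measurable_EFinP; apply: measurable_funM => //; exact: measurable_gaussT.
move=> x _; rewrite /= lee_fin !normrM [`|gaussT x|%R]ger0_norm ?gaussT_ge0//.
apply: ler_wpM2r; first exact: gaussT_ge0.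
by rewrite (le_trans (fM x))// ler_norm.
Qed.

(** Bounds all partial sums at once, which is the domination needed to average the cosine series
    over the sphere. *)
Lemma cos_series_le (y : R) N : (`|series (cos_coeff' y) N| <= expR `|y|)%R.
Proof.
rewrite /series/=; apply: (le_trans (ler_norm_sum _ _ _)).
apply: (@le_trans _ _ (series (exp_coeff `|y|) N.*2)%R); last first.
  apply: nondecreasing_cvgn_le; last exact: is_cvg_series_exp_coeff.
  by apply: nondecreasing_series => i _ _; exact: exp_coeff_ge0.
rewrite /series/=; elim: N => [|N IH]; first by rewrite !big_nil.
rewrite doubleS !big_nat_recr//= -addrA lerD//.
apply: (@le_trans _ _ (exp_coeff `|y| N.*2)%R); last by rewrite lerDl exp_coeff_ge0.
rewrite /exp_coeff/= /cos_coeff' normrM normrM normfV normr_nat normrX.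
by rewrite normrX normrN1 expr1n mul1r.
Qed.

Let nu : R := ((n.+1%:R - 2) / 2)%R.

(** Term by term, the even spherical moments turn the Taylor coefficients of the cosine into those
    of [J_nu(z) / z^nu]. *)
Lemma integral_cos_series (u : R) N :
  (\int[@leb R n.+1]_x (series (cos_coeff' (u * dir x)) N * gaussT x))%R =
  (Num.sqrt pi ^+ n.+1 * (2 `^ nu * GammaR (n.+1%:R / 2) *
    \sum_(0 <= m < N) ((-1) ^+ m * ((norm_Rn z * u) / 2) ^+ (2 * m) /
       (2 `^ nu * (m`!)%:R * GammaR (m%:R + nu + 1)))))%R.
Proof.
have mser M : measurable_fun [set: n.+1.-tuple R] (fun x => series (cos_coeff' (u * dir x)%R) M).
  rewrite /series/=; apply: measurable_sum => i; apply: measurable_funM => //.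
  apply: measurable_funM => //; apply: measurable_funX; apply: measurable_funM => //.
  exact: measurable_dir.
have bser M x : (`|series (cos_coeff' (u * dir x)%R) M| <= expR (`|u| * norm_Rn z))%R.
  apply: (le_trans (cos_series_le _ _)); rewrite ler_expR normrM.
  by apply: ler_wpM2l => //; exact: dir_le.
elim: N => [|N IH].
  rewrite big_nil !mulr0; under eq_Rintegral do rewrite /series/= big_nil mul0r.
  by rewrite Rintegral_cst// mul0r.
have mc M : measurable_fun [set: n.+1.-tuple R] (fun x => cos_coeff' (u * dir x)%R M).
  apply: measurable_funM => //; apply: measurable_funM => //.
  apply: measurable_funX; apply: measurable_funM => //; exact: measurable_dir.
have cE x : cos_coeff' (u * dir x)%R N = ((-1) ^+ N * u ^+ (2 * N) / (2 * N)`!%:R * dir x ^+ (2 * N))%R.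
  by rewrite /cos_coeff' -mul2n exprMn -exprnP; ring.
have sE x : series (cos_coeff' (u * dir x)%R) N.+1 =
   (series (cos_coeff' (u * dir x)) N + cos_coeff' (u * dir x) N)%R.
  by rewrite /series/= big_nat_recr.
have idX : (@leb R n.+1).-integrable setT (fun x => (dir x ^+ (2 * N) * gaussT x)%:E).
  apply: (@integrable_gaussT_bounded _ (norm_Rn z ^+ (2 * N))%R) => //; first exact: measurable_dirX.
  by move=> x; rewrite ger0_norm ?dirX_ge0 ?dirX_le.
transitivity (\int[@leb R n.+1]_x (series (cos_coeff' (u * dir x)) N * gaussT x +
   (-1) ^+ N * u ^+ (2 * N) / (2 * N)`!%:R * (dir x ^+ (2 * N) * gaussT x)))%R.
  by apply: eq_Rintegral => x _; rewrite sE mulrDl cE; congr (_ + _)%R; rewrite !mulrA.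
rewrite RintegralD//; last 2 first.
- exact: (integrable_gaussT_bounded (mser N) (bser N)).
- apply: (eq_integrable _ (fun x => ((-1) ^+ N * u ^+ (2 * N) / (2 * N)`!%:R)%:E * (dir x ^+ (2 * N) * gaussT x)%:E)) => //.
  exact: integrableZl.
rewrite RintegralZl// IH big_nat_recr//= !mulrDr; congr (_ + _)%R.
have -> : (\int[@leb R n.+1]_x (dir x ^+ (2 * N) * gaussT x))%R = sphmom N by [].
rewrite GammaR_half (_ : (N%:R + nu + 1)%R = ((n + 2 * N).+1%:R / 2)%R); last first.
  by rewrite /nu -(natr1 (_ + _)) -(natr1 n) natrD natrM; field.
rewrite GammaR_half -!/(gm _).
have g0 : (gm (n + 2 * N) != 0)%R by rewrite gt_eqF// gm_gt0.
have -> : (sphmom N = Num.sqrt pi ^+ n * norm_Rn z ^+ (2 * N) * (2 * gm (2 * N)) * gm n / gm (n + 2 * N))%R.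
  by rewrite -sphmom_moment mulfK.
rewrite gm_even.
have h1 : (N`!%:R != 0 :> R)%R by rewrite pnatr_eq0 -lt0n fact_gt0.
have h2 : (4 ^+ N != 0 :> R)%R by rewrite expf_neq0// pnatr_eq0.
have h4 : ((2 * N)`!%:R != 0 :> R)%R by rewrite pnatr_eq0 -lt0n fact_gt0.
have h5 : (2 `^ nu != 0)%R by rewrite gt_eqF// powR_gt0.
rewrite exprMn exprVn exprMn.
have -> : (2 ^+ (2 * N) = 4 ^+ N :> R)%R by rewrite exprM -natrX.
rewrite exprS.
move: (gm _) g0 => g1 g0; move: (2 `^ nu)%R h5 => p h5; move: (N`!%:R : R)%R h1 => f1 h1.
move: ((2 * N)`!%:R : R)%R h4 => f2 h4; move: (4 ^+ N : R)%R h2 => q h2.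
by field; rewrite g0 h1 h2 h4 h5.
Qed.

Lemma measurable_cos_dir (u : R) : measurable_fun [set: n.+1.-tuple R] (fun x => cos (u * dir x)).
Proof.
apply: (measurableT_comp (continuous_measurable_fun (@continuous_cos R))).
apply: measurable_funM => //; exact: measurable_dir.
Qed.

Lemma measurable_sin_dir (u : R) : measurable_fun [set: n.+1.-tuple R] (fun x => sin (u * dir x)).
Proof.
apply: (measurableT_comp (continuous_measurable_fun (@continuous_sin R))).
apply: measurable_funM => //; exact: measurable_dir.
Qed.

(** Poisson's formula: the spherical mean of a plane wave is a Bessel function. Dominated
    convergence applied to the partial sums also shows that the series in [besselJ_div]
    converges. *)
Lemma integral_cos_dir (u : R) :
  (\int[@leb R n.+1]_x (cos (u * dir x) * gaussT x))%R =
  (Num.sqrt pi ^+ n.+1 * (2 `^ nu * GammaR (n.+1%:R / 2) * besselJ_div nu (norm_Rn z * u)))%R.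
Proof.
have sp : (Num.sqrt pi ^+ n.+1 != 0 :> R)%R by rewrite expf_neq0// gt_eqF// sqrtr_gt0 pi_gt0.
have gG : (2 `^ nu * GammaR (n.+1%:R / 2) != 0)%R.
  by rewrite mulf_neq0// ?gt_eqF ?powR_gt0// GammaR_half mulr_gt0// gm_gt0.
have mser M : measurable_fun [set: n.+1.-tuple R] (fun x => series (cos_coeff' (u * dir x)%R) M).
  rewrite /series/=; apply: measurable_sum => i; apply: measurable_funM => //.
  apply: measurable_funM => //; apply: measurable_funX; apply: measurable_funM => //.
  exact: measurable_dir.
have bser M x : (`|series (cos_coeff' (u * dir x)%R) M| <= expR (`|u| * norm_Rn z))%R.
  apply: (le_trans (cos_series_le _ _)); rewrite ler_expR normrM.
  by apply: ler_wpM2l => //; exact: dir_le.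
have iB : (@leb R n.+1).-integrable setT (fun x => (expR (`|u| * norm_Rn z) * gaussT x)%:E).
  by apply: (@integrable_gaussT_bounded (fun=> _) (expR (`|u| * norm_Rn z))) => // x; rewrite ger0_norm// expR_ge0.
have cI : (\int[@leb R n.+1]_x (series (cos_coeff' (u * dir x)) N * gaussT x))%R @[N --> \oo] -->
    (\int[@leb R n.+1]_x (cos (u * dir x) * gaussT x))%R.
  apply: (Rintegral_dominated_cvg _ _ _ _ iB) => //.
  - by move=> N; apply: measurable_funM => //; exact: measurable_gaussT.
  - by apply: measurable_funM; [exact: measurable_cos_dir|exact: measurable_gaussT].
  - by move=> x _; apply: cvgMl; exact: cvg_cos_coeff'.
  - move=> N x _; rewrite normrM [`|gaussT x|%R]ger0_norm ?gaussT_ge0//.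
    by apply: ler_wpM2r; [exact: gaussT_ge0|exact: bser].
rewrite mulrA; set A := (Num.sqrt pi ^+ n.+1 * _)%R.
have A0 : (A != 0)%R by rewrite mulf_neq0.
have : (A^-1 * (\int[@leb R n.+1]_x (series (cos_coeff' (u * dir x)) N * gaussT x)))%R @[N --> \oo] -->
   (A^-1 * (\int[@leb R n.+1]_x (cos (u * dir x) * gaussT x)))%R.
  by apply: cvgMr; exact: cI.
under eq_fun do rewrite integral_cos_series [X in (A^-1 * X)%R]mulrA mulKf//.
by move/cvg_lim => H; rewrite /besselJ_div H// mulVKf.
Qed.

Lemma integral_sin_dir (u : R) : (\int[@leb R n.+1]_x (sin (u * dir x) * gaussT x))%R = 0%R.
Proof.
have sinb (x : n.+1.-tuple R) : (`|sin (u * dir x)| <= 1)%R.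
  by rewrite ler_norml sin_geN1 sin_le1.
have isin := integrable_gaussT_bounded (measurable_sin_dir u) sinb.
have i1 : (@leb R n.+1).-integrable setT (fun x => (gaussT x)%:E).
  have := @integrable_gaussT_bounded (fun=> 1%R) 1%R (measurable_cst _) (fun=> _).
  by under eq_fun do rewrite mul1r; apply => x; rewrite normr1.
(* The reflection [x -> - x] is available for nonnegative integrands, hence the shift by 1. *)
pose h x := ((1 + sin (u * dir x)) * gaussT x)%:E.
have mh : measurable_fun [set: n.+1.-tuple R] h.
  apply/measurable_EFinP; apply: measurable_funM; last exact: measurable_gaussT.
  by apply: measurable_funD => //; exact: measurable_sin_dir.
have h0 x : 0 <= h x.
  by rewrite lee_fin mulr_ge0 ?gaussT_ge0// -lerBlDl sub0r; have := sinb x; rewrite ler_norml => /andP[].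
have n10 : (- 1 != 0 :> R)%R by rewrite oppr_eq0 oner_eq0.
have := @ge0_integral_scaleT R n.+1 (- 1)%R h n10 mh h0.
rewrite normrN1 expr1n mul1e => H.
have dirN x : dir (scaleT (- 1) x) = (- dir x)%R.
  by rewrite /dir inner_scalel norm_scale normrN1 mul1r mulN1r mulNr.
have gN x : gaussT (scaleT (- 1)%R x) = gaussT x.
  by rewrite !gaussT_norm norm_scale normrN1 mul1r.
have E1 : (\int[@leb R n.+1]_x (gaussT x - sin (u * dir x) * gaussT x) =
           \int[@leb R n.+1]_x (gaussT x + sin (u * dir x) * gaussT x))%R.
  transitivity (fine (\int[@leb R n.+1]_x h (scaleT (- 1)%R x))).
    by congr fine; apply: eq_integral => x _; rewrite /h dirN gN mulrN sinN mulrDl mul1r mulNr.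
  by rewrite H; congr fine; apply: eq_integral => x _; rewrite /h mulrDl mul1r.
move: E1; rewrite RintegralB// RintegralD// => /addrI /eqP.
by rewrite eq_sym -subr_eq0 opprK -mulr2n mulrn_eq0/= => /eqP.
Qed.

End dir.
End sphere.

(** * Square-integrable functions and superpositions *)

Section L2.
Context d (T : measurableType d) (R : realType) (m : {measure set T -> \bar R}).
Implicit Types f g : T -> R.

Definition L2 f := measurable_fun setT f /\ m.-integrable setT (fun x => (f x ^+ 2)%:E).

Definition ip f g : R := \int[m]_x (f x * g x).

Lemma L2_meas f : L2 f -> measurable_fun setT f. Proof. by case. Qed.

Lemma L2_lty f : measurable_fun setT f -> (\int[m]_x (f x ^+ 2)%:E < +oo)%E -> L2 f.
Proof.
move=> mf foo; split => //; apply/integrableP; split.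
  by apply/measurable_EFinP; exact: measurable_funX.
by under eq_integral do rewrite gee0_abs ?lee_fin ?sqr_ge0//.
Qed.

Lemma L2_mul f g : L2 f -> L2 g -> m.-integrable setT (fun x => (f x * g x)%:E).
Proof.
move=> [mf f2] [mg g2].
have i2 : m.-integrable setT (fun x => (f x ^+ 2 + g x ^+ 2)%:E) by exact: (integrableD _ f2 g2).
apply: le_integrable i2 => //.
  by apply/measurable_EFinP; exact: measurable_funM.
move=> x _ /=; rewrite lee_fin [leRHS]ger0_norm ?addr_ge0 ?sqr_ge0//.
rewrite ler_norml; apply/andP; split.
  by have := sqr_ge0 (f x + g x); have := sqr_ge0 (f x); have := sqr_ge0 (g x); nra.
by have := sqr_ge0 (f x - g x); have := sqr_ge0 (f x); have := sqr_ge0 (g x); nra.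
Qed.

Lemma L2_comb a b f g : L2 f -> L2 g -> L2 (fun x => a * f x + b * g x).
Proof.
move=> Lf Lg; have [mf f2] := Lf; have [mg g2] := Lg; split.
  by apply: measurable_funD; exact: measurable_funM.
have i1 : m.-integrable setT (fun x => (a ^+ 2)%:E * (f x ^+ 2)%:E)%E by exact: integrableZl.
have i2 : m.-integrable setT (fun x => (b ^+ 2)%:E * (g x ^+ 2)%:E)%E by exact: integrableZl.
have i3 : m.-integrable setT (fun x => (2 * a * b)%:E * (f x * g x)%:E)%E.
  by apply: integrableZl => //; exact: L2_mul.
have i := integrableD measurableT (integrableD measurableT i1 i2) i3.
apply: eq_integrable i => // x _ /=.
by rewrite -!EFinM -!EFinD; congr EFin; ring.
Qed.

Lemma L2_0 : L2 (fun=> 0).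
Proof.
split => //; apply: (eq_integrable _ (cst 0%E)) => //; last exact: integrable0.
by move=> x _; rewrite expr0n.
Qed.

Lemma eq_L2 f g : f =1 g -> L2 f -> L2 g.
Proof. by move=> /funext ->. Qed.

Lemma L2Z a f : L2 f -> L2 (fun x => a * f x).
Proof. by move=> Lf; apply: eq_L2 (L2_comb a 0 Lf L2_0) => x; rewrite mulr0 addr0. Qed.

Lemma L2D f g : L2 f -> L2 g -> L2 (fun x => f x + g x).
Proof. by move=> Lf Lg; apply: eq_L2 (L2_comb 1 1 Lf Lg) => x; rewrite !mul1r. Qed.

Lemma L2B f g : L2 f -> L2 g -> L2 (fun x => f x - g x).
Proof. by move=> Lf Lg; apply: eq_L2 (L2_comb 1 (-1) Lf Lg) => x; rewrite mul1r mulN1r. Qed.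

Lemma L2_sum I (s : seq I) (h : I -> T -> R) : (forall i, List.In i s -> L2 (h i)) ->
  L2 (fun x => \sum_(i <- s) h i x).
Proof.
elim: s => [|i s IH] H.
  by apply: eq_L2 L2_0 => x; rewrite big_nil.
apply: (@eq_L2 (fun x => h i x + \sum_(i <- s) h i x)).
  by move=> x; rewrite big_cons.
apply: L2D; first by apply: H; left.
by apply: IH => k ks; apply: H; right.
Qed.

Lemma ipC f g : ip f g = ip g f.
Proof. by apply: eq_Rintegral => x _; rewrite mulrC. Qed.

Lemma ip_ge0 f : 0 <= ip f f.
Proof. by apply: Rintegral_ge0 => x _; rewrite -expr2 sqr_ge0. Qed.

Lemma ip_combl a b f g h : L2 f -> L2 g -> L2 h ->
  ip (fun x => a * f x + b * g x) h = a * ip f h + b * ip g h.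
Proof.
move=> Lf Lg Lh; have ifh := L2_mul Lf Lh; have igh := L2_mul Lg Lh.
rewrite /ip -!RintegralZl// -RintegralD//.
- by apply: eq_Rintegral => x _; ring.
- by apply: (eq_integrable _ (fun x => a%:E * (f x * h x)%:E)%E) => //; exact: integrableZl.
- by apply: (eq_integrable _ (fun x => b%:E * (g x * h x)%:E)%E) => //; exact: integrableZl.
Qed.

Lemma eq_ip f f' g g' : f =1 f' -> g =1 g' -> ip f g = ip f' g'.
Proof. by move=> /funext -> /funext ->. Qed.

Lemma ipZl a f h : L2 f -> L2 h -> ip (fun x => a * f x) h = a * ip f h.
Proof.
move=> Lf Lh; have := ip_combl a 0 Lf L2_0 Lh; rewrite (mul0r (ip _ _)) addr0 => <-.
by apply: eq_ip => // x; rewrite mulr0 addr0.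
Qed.

Lemma ipDl f g h : L2 f -> L2 g -> L2 h -> ip (fun x => f x + g x) h = ip f h + ip g h.
Proof.
move=> Lf Lg Lh; have := ip_combl 1 1 Lf Lg Lh; rewrite !mul1r => <-.
by apply: eq_ip => // x; rewrite !mul1r.
Qed.

Lemma ipBl f g h : L2 f -> L2 g -> L2 h -> ip (fun x => f x - g x) h = ip f h - ip g h.
Proof.
move=> Lf Lg Lh; have := ip_combl 1 (-1) Lf Lg Lh; rewrite mul1r mulN1r => <-.
by apply: eq_ip => // x; rewrite mul1r mulN1r.
Qed.

Lemma ipZr a f h : L2 f -> L2 h -> ip h (fun x => a * f x) = a * ip h f.
Proof. by move=> *; rewrite !(ipC h) ipZl. Qed.

Lemma ip_suml I (s : seq I) (u : I -> T -> R) h : (forall i, List.In i s -> L2 (u i)) -> L2 h ->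
  ip (fun x => \sum_(i <- s) u i x) h = \sum_(i <- s) ip (u i) h.
Proof.
elim: s => [|i s IH] H Lh.
  rewrite big_nil /ip; under eq_Rintegral do rewrite big_nil mul0r.
  by rewrite /Rintegral integral0.
rewrite big_cons -IH//; last by move=> k ks; apply: H; right.
rewrite -ipDl//; first by apply: eq_ip => // x; rewrite big_cons.
  by apply: H; left.
by apply: L2_sum => k ks; apply: H; right.
Qed.

Lemma ip_cross a b f g : L2 f -> L2 g ->
  ip (fun x => a * f x + b * g x) (fun x => a * f x + b * g x) =
  a ^+ 2 * ip f f + 2 * a * b * ip f g + b ^+ 2 * ip g g.
Proof.
move=> Lf Lg; rewrite ip_combl//; last exact: L2_comb.
by rewrite !(ipC _ (fun x => _ + _)) !ip_combl// (ipC g f); ring.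
Qed.

Lemma ip_le2 f g (e : R) : 0 < e -> L2 f -> L2 g ->
  2 * `|ip f g| <= e * ip f f + e^-1 * ip g g.
Proof.
move=> e0 Lf Lg; have e1 : 0 < e^-1 by rewrite invr_gt0.
have H b : 0 <= e * ip f f + 2 * b * ip f g + b ^+ 2 * e^-1 * ip g g.
  have := ip_ge0 (fun x => e * f x + b * g x); rewrite ip_cross// => h.
  rewrite -(pmulr_rge0 _ e0).
  rewrite (_ : e * (_ + _ + _) = e ^+ 2 * ip f f + 2 * e * b * ip f g + b ^+ 2 * ip g g)//.
  by field; rewrite gt_eqF.
have := H 1; have := H (-1); rewrite sqrrN expr1n.
by case: (lerP 0 (ip f g)) => h; rewrite ?(ger0_norm h) ?(ltr0_norm h) => h1 h2; lra.
Qed.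

Lemma ip_cvg (f_ : nat -> T -> R) f : (forall n, L2 (f_ n)) -> L2 f ->
  ip (fun x => f_ n x - f x) (fun x => f_ n x - f x) @[n --> \oo] --> 0 ->
  ip (f_ n) (f_ n) @[n --> \oo] --> ip f f.
Proof.
move=> Lf_ Lf cf; apply/cvgrPdist_le => e e0.
(* The cross term is split by Young's inequality with weight [c], chosen so that the part with
   [ip f f] is at most [e / 2]; the [+ 1] keeps [A] positive when [f] is null. *)
pose A := ip f f + 1.
have A0 : 0 < A by rewrite ltr_wpDl// ip_ge0.
pose c := e / (2 * A).
have c0 : 0 < c by rewrite divr_gt0// mulr_gt0.
have q0 : 0 < e / 2 / (1 + c^-1).
  by rewrite divr_gt0// ?divr_gt0// addr_gt0// invr_gt0.
move/cvgrPdist_le : cf => /(_ _ q0); apply: filterS => n.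
rewrite sub0r normrN ger0_norm ?ip_ge0// => qn.
pose g x := f_ n x - f x.
have Lg : L2 g by exact: L2B.
have E : ip (f_ n) (f_ n) = ip f f + 2 * ip f g + ip g g.
  rewrite -[2 * _]mul1r -[ip f f]mul1r -[X in _ + X]mul1r.
  have := ip_cross 1 1 Lf Lg; rewrite !expr1n !mulr1 !mul1r => <-.
  by apply: eq_ip => x; rewrite /g !mul1r addrC subrK.
rewrite E -addrA opprD addrA subrr add0r normrN.
apply: (le_trans (ler_normD _ _)); rewrite [`|ip g g|]ger0_norm ?ip_ge0// normrM ger0_norm//.
have h := ip_le2 c0 Lf Lg.
have h1 : c * ip f f <= e / 2.
  rewrite /c invfM mulrA -mulrA ler_piMr ?divr_ge0 ?(ltW e0)//.
  by rewrite mulrC ler_pdivrMr// mul1r /A lerDl.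
have h2 : (1 + c^-1) * ip g g <= e / 2.
  by move: qn; rewrite ler_pdivlMr ?addr_gt0 ?invr_gt0// mulrC.
rewrite mulrDl mul1r in h2; lra.
Qed.

Lemma ip_CS f g : L2 f -> L2 g -> ip f g ^+ 2 <= ip f f * ip g g.
Proof.
move=> Lf Lg.
have H a b : 0 <= a ^+ 2 * ip f f + 2 * a * b * ip f g + b ^+ 2 * ip g g.
  by rewrite -ip_cross// ip_ge0.
have := ip_ge0 g; rewrite le_eqVlt => /predU1P[g0|g0].
  rewrite -g0 mulr0; have [//|fg] := leP (ip f g ^+ 2) 0.
  have fg0 : ip f g != 0 by rewrite -sqrf_eq0 gt_eqF.
  have := H 1 (- (ip f f + 1) / (2 * ip f g)).
  rewrite -g0 mulr0 addr0 expr1n mul1r.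
  have -> : 2 * 1 * (- (ip f f + 1) / (2 * ip f g)) * ip f g = - (ip f f + 1) by field.
  by rewrite opprD addrA subrr add0r oppr_ge0 ler10.
have := H (ip g g) (- ip f g).
rewrite (_ : _ + _ + _ = ip g g * (ip f f * ip g g - ip f g ^+ 2)); last by ring.
by rewrite pmulr_rge0// subr_ge0.
Qed.

End L2.

(** * Integrals of L2-valued families *)

Section superposition.
Context dX (X : measurableType dX) d (T : measurableType d) (R : realType).
Variables (mu : {sigma_finite_measure set X -> \bar R}) (m : {sigma_finite_measure set T -> \bar R}).
Variables (e : X -> T -> R) (F : X -> R) (K : R).
Hypotheses (me : measurable_fun setT (fun p : X * T => e p.1 p.2))
  (iF : mu.-integrable setT (EFin \o F))
  (Le : forall x, L2 m (e x)) (eK : forall x, ip m (e x) (e x) <= K).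

Definition superp (t : T) : R := \int[mu]_x (F x * e x t).

Let mF : measurable_fun setT F.
Proof. by have /integrableP[/measurable_EFinP] := iF. Qed.

Let mFe : measurable_fun setT (fun p : X * T => F p.1 * e p.1 p.2).
Proof. by apply: measurable_funM => //; exact: measurableT_comp. Qed.

Lemma superp_integrable (D : T -> R) : L2 m D ->
  (mu \x m)%E.-integrable setT (fun p => (F p.1 * e p.1 p.2 * D p.2)%:E).
Proof.
move=> LD; apply/integrable12ltyP.
  apply/measurable_EFinP; apply: measurable_funM => //.
  by apply: measurableT_comp => //; exact: L2_meas LD.
(* By Young's inequality this bounds the integral of [|e x * D|] uniformly in [x]. *)
pose c := 2^-1 * (K + ip m D D).
apply: (@le_lt_trans _ _ (\int[mu]_x (c%:E * `|F x|%:E))%E); last first.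
  rewrite integralZl//; last exact: integrable_norm.
  rewrite ltey_eq fin_numM//; apply: integrable_fin_num => //.
  exact: integrable_norm.
have mm : measurable_fun setT (fun p : X * T => `|(F p.1 * e p.1 p.2 * D p.2)%:E|%E).
  apply: measurableT_comp => //; apply/measurable_EFinP; apply: measurable_funM => //.
  by apply: measurableT_comp => //; exact: L2_meas LD.
apply: ge0_le_integral => //.
- by move=> x _; exact: integral_ge0.
- have h := @measurable_integral_param R _ _ X T m _ mm.
  exact h.
- apply: measurable_funeM; apply/measurable_EFinP; exact: measurableT_comp.
move=> x _ /=.
have i1 := L2_mul (Le x) LD.
have -> : (\int[m]_t `|F x * e x t * D t|%:E = `|F x|%:E * \int[m]_t `|e x t * D t|%:E)%E.
  rewrite -integralZl//; last exact: integrable_norm.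
  by apply: eq_integral => t _; rewrite -EFinM -normrM mulrA.
rewrite muleC; apply: lee_wpmul2r; first by rewrite lee_fin.
have i2 : m.-integrable setT (fun t => (2^-1 * (e x t ^+ 2 + D t ^+ 2))%:E).
  apply: (eq_integrable _ (fun t => (2^-1)%:E * ((e x t ^+ 2)%:E + (D t ^+ 2)%:E))%E) => //.
  by apply: integrableZl => //; apply: integrableD => //; [have [] := Le x|have [] := LD].
apply: (@le_trans _ _ (\int[m]_t (2^-1 * (e x t ^+ 2 + D t ^+ 2))%:E)%E).
  apply: ge0_le_integral => //.
  - by apply/measurable_EFinP; apply: measurableT_comp => //; have /integrableP[/measurable_EFinP] := i1.
  - by have /integrableP[] := i2.
  move=> t _; rewrite lee_fin ler_norml; apply/andP; split.
    by have := sqr_ge0 (e x t + D t); nra.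
  by have := sqr_ge0 (e x t - D t); nra.
rewrite (_ : (\int[m]_t _ = (2^-1 * (ip m (e x) (e x) + ip m D D))%:E)%E).
  by rewrite lee_fin /c ler_pM2l ?invr_gt0// lerD2r.
have i3 : m.-integrable setT (fun t => (e x t ^+ 2)%:E) by have [] := Le x.
have i4 : m.-integrable setT (fun t => (D t ^+ 2)%:E) by have [] := LD.
rewrite EFinM EFinD /ip /Rintegral.
rewrite !fineK; [|exact: integrable_fin_num i4|exact: integrable_fin_num i3].
rewrite -integralD// -integralZl//; last exact: integrableD.
Qed.

Lemma measurable_superp : measurable_fun setT superp.
Proof.
apply: (@measurableT_comp _ _ _ _ _ _ (@fine R)); first exact: fine_measurable.
have mFe' : measurable_fun setT (fun p : T * X => (F p.2 * e p.2 p.1)%:E).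
  apply/measurable_EFinP; apply: (measurableT_comp mFe (@measurable_swap _ _ T X)).
have h := @measurable_integral_param R _ _ T X mu _ mFe'.
exact h.
Qed.

(** By Fubini the pointwise integral [superp] is the Pettis integral of the family [F x * e x] in
    L2. *)
Lemma ip_superp (D : T -> R) : L2 m D ->
  mu.-integrable setT (fun x => (F x * ip m (e x) D)%:E) /\
  \int[mu]_x (F x * ip m (e x) D) = ip m superp D.
Proof.
move=> LD; have ii := superp_integrable LD.
have inner x : (\int[m]_t (F x * e x t * D t)%:E = (F x * ip m (e x) D)%:E)%E.
  have i1 := L2_mul (Le x) LD.
  rewrite EFinM /ip /Rintegral fineK; last exact: integrable_fin_num.
  by rewrite -integralZl//; apply: eq_integral => t _; rewrite -EFinM mulrA.
have fF := integrable_fubini_F ii.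
split.
  by apply: eq_integrable fF => // x _; rewrite /fubini_F/= inner.
congr fine.
transitivity (\int[mu]_x (fubini_F m (fun p => (F p.1 * e p.1 p.2 * D p.2)%:E) x))%E.
  by apply: eq_integral => x _; rewrite /fubini_F/= inner.
rewrite (integral12_prod_meas1 ii) -(integral21_prod_meas1 ii).
apply: ae_eq_integral => //.
- have h := measurable_fubini_G ii; exact h.
- apply/measurable_EFinP; apply: measurable_funM; last exact: L2_meas LD.
  exact: measurable_superp.
- have := ae_integrable2 ii; apply: filterS => t it _.
  rewrite /fubini_G/= /superp.
  (* Integrability of [F x * e x t] in [x] is known only after multiplication by [D t]; where
     [D t = 0] both sides vanish. *)
  have [D0|D0] := eqVneq (D t) 0.
    by rewrite D0 mulr0; under eq_integral do rewrite mulr0; rewrite integral0.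
  have iFe : mu.-integrable setT (fun x => (F x * e x t)%:E).
    apply: (eq_integrable _ (fun x => ((D t)^-1)%:E * (F x * e x t * D t)%:E)%E) => //.
      by move=> x _; rewrite -EFinM mulrC mulfK.
    exact: integrableZl.
  rewrite EFinM /Rintegral fineK; last exact: integrable_fin_num.
  by rewrite -integralZr//; apply: eq_integral => x _; rewrite EFinM.
Qed.
(** Cauchy-Schwarz for the measure [|F| mu]. The [+ 1] keeps the first factor positive, so that the
    bound is trivial where the second one is infinite. *)
Lemma superp_sqr_le (t : T) :
  ((superp t ^+ 2)%:E <= (\int[mu]_x `|F x| + 1)%:E * \int[mu]_x (`|F x| * e x t ^+ 2)%:E)%E.
Proof.
have met : measurable_fun setT (fun x => e x t).
  exact: (measurableT_comp me (@measurable_pair2 _ _ X T t)).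
have mnF : measurable_fun setT (fun x => `|F x|) by exact: measurableT_comp.
pose f x := Num.sqrt `|F x|; pose g x := Num.sqrt `|F x| * `|e x t|.
have mf : measurable_fun setT f by exact: (measurableT_comp measurable_sqrt).
have mg : measurable_fun setT g by apply: measurable_funM => //; exact: measurableT_comp.
have f2 x : f x ^+ 2 = `|F x| by rewrite sqr_sqrtr.
have g2 x : g x ^+ 2 = `|F x| * e x t ^+ 2 by rewrite exprMn f2 real_normK// num_real.
have N0 : 0 <= \int[mu]_x `|F x| by exact: Rintegral_ge0.
have Lf : L2 mu f.
  split => //; have i := integrable_norm iF.
  by apply: eq_integrable i => // x _; rewrite /= f2.
have [Aoo|] := ltP (\int[mu]_x (`|F x| * e x t ^+ 2)%:E)%E +oo%E; last first.
  by rewrite leye_eq => /eqP ->; rewrite gt0_muley ?leey// lte_fin ltr_wpDl.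
have Lg : L2 mu g.
  by apply: L2_lty => //; under eq_integral do rewrite g2.
have ff : ip mu f f = \int[mu]_x `|F x| by apply: eq_Rintegral => x _; rewrite -expr2 f2.
have gg : (ip mu g g)%:E = (\int[mu]_x (`|F x| * e x t ^+ 2)%:E)%E.
  rewrite /ip /Rintegral fineK; first by apply: eq_integral => x _; rewrite -expr2 g2.
  by apply: integrable_fin_num => //; exact: L2_mul.
have fg x : f x * g x = `|F x * e x t| by rewrite /f /g mulrA -expr2 sqr_sqrtr// normrM.
have iFe : mu.-integrable setT (fun x => (F x * e x t)%:E).
  apply: le_integrable (L2_mul Lf Lg) => //.
    by apply/measurable_EFinP; exact: measurable_funM.
  by move=> x _; rewrite /= fg normr_id.
rewrite -gg -EFinM lee_fin.
have h1 : superp t ^+ 2 <= ip mu f g ^+ 2.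
  rewrite -[leLHS]real_normK ?num_real//; apply: lerXn2r; rewrite ?nnegrE//.
    by apply: Rintegral_ge0 => x _; rewrite fg.
  apply: (le_trans (le_normr_Rintegral _ iFe)) => //.
  by rewrite (_ : ip mu f g = \int[mu]_x `|F x * e x t|)//; apply: eq_Rintegral => x _; rewrite fg.
apply: (le_trans h1); apply: (le_trans (ip_CS Lf Lg)); rewrite ff mulrDl mul1r lerDl.
exact: ip_ge0.
Qed.

Lemma L2_superp : L2 m superp.
Proof.
apply: L2_lty; first exact: measurable_superp.
have mA : measurable_fun setT (fun p : T * X => (`|F p.2| * e p.2 p.1 ^+ 2)%:E).
  apply/measurable_EFinP; apply: measurable_funM.
    by apply: measurableT_comp => //; exact: measurableT_comp.
  by apply: measurable_funX; exact: (measurableT_comp me (@measurable_swap _ _ T X)).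
have A0 (p : T * X) : (0%R <= (`|F p.2| * e p.2 p.1 ^+ 2)%:E)%E.
  by rewrite lee_fin mulr_ge0// sqr_ge0.
have mI := @measurable_integral_param R _ _ T X mu _ mA.
have N0 : 0 <= \int[mu]_x `|F x| by exact: Rintegral_ge0.
apply: (@le_lt_trans _ _ (\int[m]_t ((\int[mu]_x `|F x| + 1)%R%:E * \int[mu]_x (`|F x| * e x t ^+ 2)%:E))%E).
  apply: ge0_le_integral => //.
  - by move=> t _; rewrite lee_fin sqr_ge0.
  - apply/measurable_EFinP; apply: measurable_funX; exact: measurable_superp.
  - by apply: measurable_funeM; exact mI.
  - by move=> t _; exact: superp_sqr_le.
rewrite ge0_integralZl//; last 2 first.
- by move=> t _; apply: integral_ge0 => x _; exact: (A0 (t, x)).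
- by rewrite lee_fin addr_ge0.
rewrite lte_mul_pinfty ?lee_fin ?addr_ge0//.
have := @fubini_tonelli _ _ T X R m mu _ mA A0; rewrite /= => ->.
apply: (@le_lt_trans _ _ (\int[mu]_x (K%:E * `|F x|%:E))%E); last first.
  rewrite integralZl//; last exact: integrable_norm.
  rewrite ltey_eq fin_numM//; apply: integrable_fin_num => //.
  exact: integrable_norm.
have mA' : measurable_fun setT (fun p : X * T => (`|F p.1| * e p.1 p.2 ^+ 2)%:E).
  exact: (measurableT_comp mA (@measurable_swap _ _ X T)).
have mI' := @measurable_integral_param R _ _ X T m _ mA'.
apply: ge0_le_integral => //.
- by move=> x _; apply: integral_ge0 => t _; exact: (A0 (t, x)).
- by apply: measurable_funeM; apply/measurable_EFinP; exact: measurableT_comp.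
move=> x _; have [_ i2] := Le x.
under eq_integral do rewrite EFinM.
rewrite integralZl// muleC; apply: lee_wpmul2r; first by rewrite lee_fin.
rewrite -(fineK (integrable_fin_num measurableT i2)) lee_fin.
rewrite (_ : fine _ = ip m (e x) (e x)) ?eK//; congr fine.
Qed.

End superposition.

(** * Simultaneous greedy approximation in two L2 spaces *)

Section greedy.
Context dX (X : measurableType dX) d1 (T1 : measurableType d1) d2 (T2 : measurableType d2) (R : realType).
Variables (mu : {sigma_finite_measure set X -> \bar R})
  (m1 : {sigma_finite_measure set T1 -> \bar R}) (m2 : {sigma_finite_measure set T2 -> \bar R}).
Variables (e1 : X -> T1 -> R) (e2 : X -> T2 -> R) (F : X -> R) (K : R) (x0 : X).
Hypotheses (me1 : measurable_fun setT (fun p : X * T1 => e1 p.1 p.2))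
  (me2 : measurable_fun setT (fun p : X * T2 => e2 p.1 p.2))
  (iF : mu.-integrable setT (EFin \o F))
  (Le1 : forall x, L2 m1 (e1 x)) (eK1 : forall x, ip m1 (e1 x) (e1 x) <= K)
  (Le2 : forall x, L2 m2 (e2 x)) (eK2 : forall x, ip m2 (e2 x) (e2 x) <= K).

Let W1 := superp mu e1 F.
Let W2 := superp mu e2 F.
Let LW1 : L2 m1 W1 := L2_superp me1 iF Le1 eK1.
Let LW2 : L2 m2 W2 := L2_superp me2 iF Le2 eK2.

Let N := \int[mu]_x `|F x|.
Let N0 : 0 <= N. Proof. exact: Rintegral_ge0. Qed.

(* Otherwise the strict inequality could be integrated against [|F|]. *)
Lemma greedy_point (D1 : T1 -> R) (D2 : T2 -> R) : L2 m1 D1 -> L2 m2 D2 ->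
  exists x c, `|c| <= N /\
    c * (ip m1 (e1 x) D1 + ip m2 (e2 x) D2) <= ip m1 W1 D1 + ip m2 W2 D2.
Proof.
move=> LD1 LD2.
have [i1 E1] := ip_superp me1 iF Le1 eK1 LD1.
have [i2 E2] := ip_superp me2 iF Le2 eK2 LD2.
pose phi x := ip m1 (e1 x) D1 + ip m2 (e2 x) D2.
have iphi : mu.-integrable setT (fun x => (F x * phi x)%:E).
  have i := integrableD measurableT i1 i2.
  by apply: eq_integrable i => // x _; rewrite /= -EFinD -mulrDr.
have Ephi : \int[mu]_x (F x * phi x) = ip m1 W1 D1 + ip m2 W2 D2.
  by rewrite -E1 -E2 -RintegralD//; apply: eq_Rintegral => x _; rewrite mulrDr.
have [//|no] := pselect (exists x c, `|c| <= N /\ c * phi x <= ip m1 W1 D1 + ip m2 W2 D2).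
exfalso; rewrite -Ephi in no; set I := \int[mu]_x _ in no.
have I0 : I < 0.
  rewrite ltNge; apply/negP => I0; apply: no; exists x0, 0.
  by rewrite normr0 mul0r.
(* The coefficients [N * sg (F x)] have the largest allowed modulus, and their average with weight
   [|F| / N] restores [F]. *)
have lt x : I < N * Num.sg (F x) * phi x.
  rewrite ltNge; apply/negP => h; apply: no; exists x, (N * Num.sg (F x)); split => //.
  by rewrite normrM normr_sg ger0_norm// ler_piMr//; case: (F x != 0).
have iN : mu.-integrable setT (fun x => `|F x|%:E) by exact: integrable_norm iF.
have h x : `|F x| * I <= N * (F x * phi x).
  have -> : N * (F x * phi x) = `|F x| * (N * Num.sg (F x) * phi x).
    by rewrite {1}[F x]numEsg; ring.
  by apply: ler_wpM2l => //; exact: ltW.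
have iNI : mu.-integrable setT (fun x => (`|F x| * I)%:E).
  by apply: (eq_integrable _ (fun x => `|F x|%:E * I%:E)%E) => //; exact: integrableZr.
have iNphi : mu.-integrable setT (fun x => (N * (F x * phi x))%:E).
  by apply: (eq_integrable _ (fun x => N%:E * (F x * phi x)%:E)%E) => //; exact: integrableZl.
(* A nonnegative function of integral 0, hence null a.e. Where [F] does not vanish this contradicts
   the strict inequality [lt], so [F = 0] a.e. and [I = 0], against [I0]. *)
pose q x := N * (F x * phi x) - `|F x| * I.
have iq : mu.-integrable setT (fun x => (q x)%:E).
  by have i := integrableB measurableT iNphi iNI; apply: eq_integrable i.
have q0 : (\int[mu]_x (q x)%:E = 0)%E.
  have : \int[mu]_x q x = 0.
    rewrite /q RintegralB// RintegralZl// RintegralZr// -/I -/N mulrC subrr//.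
  rewrite /Rintegral => /eqP; rewrite fine_eq0; first by move/eqP.
  exact: integrable_fin_num.
have /ae_eq_integral_abs : (\int[mu]_x `|(q x)%:E| = 0)%E.
  rewrite -q0; apply: eq_integral => x _; rewrite gee0_abs// lee_fin subr_ge0; exact: h.
have mq : measurable_fun setT (fun x => (q x)%:E) by have /integrableP[] := iq.
move=> /(_ measurableT mq) aq.
have : (I%:E = \int[mu]_x (cst 0 x))%E.
  rewrite /I /Rintegral fineK; last exact: integrable_fin_num.
  apply: ae_eq_integral => //; first by have /integrableP[] := iphi.
  apply: filterS aq => x qx _; have {qx} : q x = 0 by apply: EFin_inj; exact: (qx Logic.I).
  have [-> _|Fx0] := eqVneq (F x) 0; first by rewrite mul0r.
  move/eqP; rewrite subr_eq0 => /eqP qx; exfalso.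
  have := lt x; rewrite -(ltr_pM2l (x := `|F x|)) ?normr_gt0// -qx.
  by rewrite {1}[F x]numEsg; rewrite (_ : `|F x| * (N * Num.sg (F x) * phi x) = N * (Num.sg (F x) * `|F x| * phi x)) ?ltxx//; ring.
by rewrite integral0 => -[] II; rewrite II ltxx in I0.
Qed.

(** By [greedy_point] the increment [c e x - W] has nonpositive total scalar product with the
    current error, so each step adds at most its own squared norm, below [2 (N^2 K + |W|^2)] in each
    space: the squared error grows linearly in [n]. One point and one coefficient serve both spaces
    because only the sum of the two scalar products is controlled. *)
Lemma greedy (n : nat) : exists s : seq (R * X),
  ip m1 (fun t => \sum_(p <- s) p.1 * e1 p.2 t - n%:R * W1 t) (fun t => \sum_(p <- s) p.1 * e1 p.2 t - n%:R * W1 t) +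
  ip m2 (fun t => \sum_(p <- s) p.1 * e2 p.2 t - n%:R * W2 t) (fun t => \sum_(p <- s) p.1 * e2 p.2 t - n%:R * W2 t)
  <= n%:R * (2 * (N ^+ 2 * K + ip m1 W1 W1) + 2 * (N ^+ 2 * K + ip m2 W2 W2)).
Proof.
have LS d' (T' : measurableType d') (m' : {measure set T' -> \bar R}) (e' : X -> T' -> R) (s : seq (R * X)) :
    (forall x, L2 m' (e' x)) -> L2 m' (fun t => \sum_(p <- s) p.1 * e' p.2 t).
  by move=> H; apply: L2_sum => p _; exact: L2Z.
elim: n => [|n [s IH]].
  exists [::]; rewrite !mul0r /ip /Rintegral !integral0_eq ?addr0// => x _;
    by rewrite big_nil mul0r subr0 mulr0.
pose D1 t := \sum_(p <- s) p.1 * e1 p.2 t - n%:R * W1 t.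
pose D2 t := \sum_(p <- s) p.1 * e2 p.2 t - n%:R * W2 t.
have LD1 : L2 m1 D1 by apply: L2B; [exact: LS|exact: L2Z].
have LD2 : L2 m2 D2 by apply: L2B; [exact: LS|exact: L2Z].
have [x [c [cN hc]]] := greedy_point LD1 LD2.
exists ((c, x) :: s).
have step d' (T' : measurableType d') (m' : {measure set T' -> \bar R}) (e' : X -> T' -> R) W D :
    L2 m' (e' x) -> L2 m' W -> L2 m' D -> ip m' (e' x) (e' x) <= K ->
    ip m' (fun t => 1 * D t + 1 * (c * e' x t - W t)) (fun t => 1 * D t + 1 * (c * e' x t - W t)) <=
    ip m' D D + 2 * (c * ip m' (e' x) D - ip m' W D) + 2 * (N ^+ 2 * K + ip m' W W).
  move=> Le LW LD eK; have Lc := L2Z c Le; have Lg := L2B Lc LW.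
  rewrite ip_cross// expr1n !mulr1 !mul1r -addrA -addrA lerD2l; apply: lerD.
    by rewrite (ipC m' D) ipBl// ipZl.
  have := ip_cross 1 (-1) Lc LW.
  rewrite (eq_ip m' (f' := fun t => c * e' x t - W t) (g' := fun t => c * e' x t - W t)); last 2 first.
  - by move=> t; rewrite mul1r mulN1r.
  - by move=> t; rewrite mul1r mulN1r.
  move=> ->; have h := ip_le2 (@ltr01 R) Lc LW; rewrite invr1 !mul1r in h.
  have h2 : ip m' (fun t => c * e' x t) (fun t => c * e' x t) <= N ^+ 2 * K.
    rewrite ipZl// ipZr// mulrA -expr2; apply: ler_pM => //; [exact: sqr_ge0|exact: ip_ge0|].
    by rewrite -[leLHS]real_normK ?num_real//; apply: lerXn2r; rewrite ?nnegrE.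
  have := ler_norm (- ip m' (fun t => c * e' x t) W); rewrite normrN => h3.
  rewrite sqrrN expr1n mul1r mulr1 mul1r mulrN1 mulNr; lra.
have e1E : ip m1 (fun t => \sum_(p <- (c, x) :: s) p.1 * e1 p.2 t - n.+1%:R * W1 t) (fun t => \sum_(p <- (c, x) :: s) p.1 * e1 p.2 t - n.+1%:R * W1 t) =
  ip m1 (fun t => 1 * D1 t + 1 * (c * e1 x t - W1 t)) (fun t => 1 * D1 t + 1 * (c * e1 x t - W1 t)).
  by apply: eq_ip => t; rewrite big_cons/= /D1 -natr1; ring.
have e2E : ip m2 (fun t => \sum_(p <- (c, x) :: s) p.1 * e2 p.2 t - n.+1%:R * W2 t) (fun t => \sum_(p <- (c, x) :: s) p.1 * e2 p.2 t - n.+1%:R * W2 t) =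
  ip m2 (fun t => 1 * D2 t + 1 * (c * e2 x t - W2 t)) (fun t => 1 * D2 t + 1 * (c * e2 x t - W2 t)).
  by apply: eq_ip => t; rewrite big_cons/= /D2 -natr1; ring.
rewrite e1E e2E.
have h1 := step _ _ _ e1 W1 D1 (Le1 x) LW1 LD1 (eK1 x).
have h2 := step _ _ _ e2 W2 D2 (Le2 x) LW2 LD2 (eK2 x).
have {}IH : ip m1 D1 D1 + ip m2 D2 D2 <= n%:R * (2 * (N ^+ 2 * K + ip m1 W1 W1) + 2 * (N ^+ 2 * K + ip m2 W2 W2)) by exact: IH.
rewrite -natr1 mulrDl mul1r.
rewrite mulrDr in hc; lra.
Qed.

(* Averaging [n] greedily chosen points divides the squared distance by [n]. *)
Lemma greedy_cvg : exists s : nat -> seq (R * X),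
  ip m1 (fun t => \sum_(p <- s n) p.1 * e1 p.2 t - W1 t) (fun t => \sum_(p <- s n) p.1 * e1 p.2 t - W1 t) @[n --> \oo] --> 0 /\
  ip m2 (fun t => \sum_(p <- s n) p.1 * e2 p.2 t - W2 t) (fun t => \sum_(p <- s n) p.1 * e2 p.2 t - W2 t) @[n --> \oo] --> 0.
Proof.
have [s hs] := choice greedy.
pose C := 2 * (N ^+ 2 * K + ip m1 W1 W1) + 2 * (N ^+ 2 * K + ip m2 W2 W2).
pose s' n := [seq (n.+1%:R^-1 * p.1, p.2) | p <- s n.+1].
have LS d' (T' : measurableType d') (m' : {measure set T' -> \bar R}) (e' : X -> T' -> R) (r : seq (R * X)) :
    (forall x, L2 m' (e' x)) -> L2 m' (fun t => \sum_(p <- r) p.1 * e' p.2 t).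
  by move=> H; apply: L2_sum => p _; exact: L2Z.
have scale d' (T' : measurableType d') (m' : {measure set T' -> \bar R}) (e' : X -> T' -> R) W n :
    (forall x, L2 m' (e' x)) -> L2 m' W ->
    ip m' (fun t => \sum_(p <- s' n) p.1 * e' p.2 t - W t) (fun t => \sum_(p <- s' n) p.1 * e' p.2 t - W t) =
    n.+1%:R^-1 ^+ 2 * ip m' (fun t => \sum_(p <- s n.+1) p.1 * e' p.2 t - n.+1%:R * W t) (fun t => \sum_(p <- s n.+1) p.1 * e' p.2 t - n.+1%:R * W t).
  move=> Le LW; have LD := L2B (LS _ _ m' e' (s n.+1) Le) (L2Z n.+1%:R LW).
  rewrite expr2 -mulrA -ipZr// -ipZl//; last exact: L2Z.
  have E t : \sum_(p <- s' n) p.1 * e' p.2 t - W t = n.+1%:R^-1 * (\sum_(p <- s n.+1) p.1 * e' p.2 t - n.+1%:R * W t).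
    rewrite big_map mulrBr mulrA mulVf ?pnatr_eq0// mul1r mulr_sumr; congr (_ - _).
    by apply: eq_bigr => p _; rewrite mulrA.
  by apply: eq_ip.
have bound n : ip m1 (fun t => \sum_(p <- s' n) p.1 * e1 p.2 t - W1 t) (fun t => \sum_(p <- s' n) p.1 * e1 p.2 t - W1 t) +
  ip m2 (fun t => \sum_(p <- s' n) p.1 * e2 p.2 t - W2 t) (fun t => \sum_(p <- s' n) p.1 * e2 p.2 t - W2 t) <= n.+1%:R^-1 * C.
  rewrite !scale// -mulrDr expr2 -mulrA ler_pM2l ?invr_gt0//.
  by rewrite ler_pdivrMl//; exact: hs.
have c0 : n.+1%:R^-1 * C @[n --> \oo] --> 0.
  by rewrite -[X in _ --> X](mul0r C); apply: cvgMl; exact: cvg_harmonic.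
exists s'; split.
  apply: (squeeze_cvgr _ (cvg_cst 0) c0); near=> n.
  by rewrite ip_ge0/=; apply: le_trans (bound n); rewrite lerDl ip_ge0.
apply: (squeeze_cvgr _ (cvg_cst 0) c0); near=> n.
by rewrite ip_ge0/=; apply: le_trans (bound n); rewrite lerDr ip_ge0.
Unshelve. all: by end_near. Qed.

End greedy.

(** * Expectations of cosines of Gaussian variables *)

Section gauss_law.
Context d (T : measurableType d) (R : realType) (P : probability T R).
Local Notation mu := (@lebesgue_measure R).

Lemma cos_lip (a b : R) : `|cos a - cos b| <= `|a - b|.
Proof.
wlog ab : a b / b < a.
  move=> H; have [ab|ab|->] := ltgtP a b; last by rewrite !subrr.
    by rewrite distrC [leRHS]distrC; exact: H.
  exact: H.
have cc : {within `[b, a], continuous (@cos R)} by apply: continuous_subspaceT; exact: continuous_cos.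
have [x _ ->] := @MVT R cos (fun x => - sin x) b a ab (fun x _ => is_derive_cos x) cc.
by rewrite normrM normrN ler_piMl// ler_norml sin_geN1 sin_le1.
Qed.

Local Open Scope ereal_scope.

(** The scale is [sqrt (2 v)] because the weight [exp (- x^2)] has variance [1/2]. The formula
    includes the point mass [v = 0], so later arguments need no case distinction. *)
Lemma normal_law_integral (W : T -> R) (a v : R) (h : R -> \bar R) :
  normal_law P W a v -> measurable_fun setT h -> (forall x, 0 <= h x) ->
  \int[P]_w h (W w) =
  ((Num.sqrt pi)^-1)%:E * \int[mu]_x (h (Num.sqrt (2 * v) * x + a)%R * (gauss_fun x)%:E).
Proof.
move=> [mW [v0 law]] mh h0.
have sp : (0 < Num.sqrt pi :> R)%R by rewrite sqrtr_gt0 pi_gt0.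
have [ve|vn] := eqVneq v 0%R.
  rewrite ve eqxx mulr0 sqrtr0 in law *.
  under [X in _ = _ * X]eq_integral do rewrite mul0r add0r.
  rewrite ge0_integralZl//; last 2 first.
  - exact: measurable_EFin_gauss.
  - by move=> y _; rewrite lee_fin gauss_fun_ge0.
  rewrite integralT_gauss muleCA -EFinM mulVf ?gt_eqF// mule1.
  have mset : measurable (W @^-1` [set a]).
    by rewrite -[X in measurable X]setTI; apply: mW => //; exact: measurable_set1.
  transitivity (\int[P]_w (cst (h a)) w); last first.
    by rewrite (_ : \int[P]_w _ = h a * P setT) ?integral_cst// probability_setT mule1.
  apply: ae_eq_integral => //; first by exact: (measurableT_comp mh).
  exists (~` (W @^-1` [set a])); split; first exact: measurableC.
    by apply: (etrans (probability_setC P mset)); rewrite law subee.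
  by move=> w /= nh Wa; apply: nh => _; rewrite Wa.
rewrite (negbTE vn) in law.
have vp : (0 < v)%R by rewrite lt_neqAle eq_sym vn.
have sv : (Num.sqrt v != 0)%R by rewrite gt_eqF// sqrtr_gt0.
pose pdf := normal_pdf a (Num.sqrt v).
have mpdf : measurable_fun [set: measurableTypeR R] (pdf : measurableTypeR R -> R) by exact: measurable_normal_pdf.
have pdf0 (x : R) : (0 <= pdf x)%R by exact: normal_pdf_ge0.
pose s := Num.sqrt (2 * v).
have s0 : (0 < s)%R by rewrite sqrtr_gt0 mulr_gt0.
have sn0 : s != 0%R by rewrite gt_eqF.
transitivity (\int[pushforward P (W : T -> measurableTypeR R)]_y h y).
  by rewrite ge0_integral_pushforward.
transitivity (\int[wpush_measure mu (@measurable_id _ (measurableTypeR R) setT) mpdf pdf0]_y h y).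
  apply: eq_measure_integral => A mA _.
  have mA' : measurable (A : set R) by exact mA.
  exact (law A mA').
rewrite ge0_integral_wpush//.
have mhp : measurable_fun [set: R] (fun y : R => h y * (pdf y)%:E).
  by apply: emeasurable_funM => //; exact/measurable_EFinP.
have hp0 (y : R) : 0 <= h y * (pdf y)%:E by rewrite mule_ge0// lee_fin.
have H := @ge0_integral_affine R s a _ sn0 mhp hp0.
apply: (etrans (esym H)).
have -> : (Num.sqrt pi)^-1%:E = `|s|%:E * (normal_peak (Num.sqrt v))%:E.
  rewrite -EFinM ger0_norm ?ltW// /normal_peak /s sqr_sqrtr ?ltW//; congr EFin.
  have -> : (v * pi *+ 2 = 2 * v * pi)%R by rewrite -mulr_natl mulrA.
  rewrite (@sqrtrM _ (2 * v)%R) ?mulr_ge0 ?ltW//.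
  have s2 : (0 < Num.sqrt (2 * v))%R by rewrite sqrtr_gt0 mulr_gt0.
  by field; rewrite !gt_eqF.
rewrite -muleA; congr (_ * _).
rewrite -ge0_integralZl; last 4 first.
- exact: measurableT.
- apply: emeasurable_funM; last exact: measurable_EFin_gauss.
  by apply: (measurableT_comp mh); exact: measurable_affine.
- by move=> x _; rewrite mule_ge0// lee_fin gauss_fun_ge0.
- by rewrite lee_fin normal_peak_ge0.
apply: eq_integral => x _; rewrite muleCA; congr (_ * _).
rewrite /pdf normal_pdfE// EFinM; congr (_ * _%:E).
rewrite /normal_fun /gauss_fun addrK sqr_sqrtr ?ltW//; congr expR.
rewrite exprMn sqr_sqrtr ?mulr_ge0 ?ltW// -mulr_natl; field.
by rewrite vn.
Qed.


Lemma integrable_gauss_pow k : mu.-integrable setT (fun x : R => (x ^+ k * gauss_fun x)%:E).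
Proof.
have mg : measurable_fun [set: R] (fun x : R => (x ^+ k * gauss_fun x)%:E : \bar R).
  by apply/measurable_EFinP; apply: measurable_funM => //; exact: measurable_gauss_fun.
have cabs : continuous (fun x : R => `|x| ^+ k * gauss_fun x)%R.
  move=> x; apply: cvgM; last exact: continuous_gauss_fun.
  apply: (@cvg_comp _ _ _ (fun x : R => `|x|%R) (fun y : R => y ^+ k)%R); last exact: exprn_continuous.
  exact: (@norm_continuous R R^o).
apply/integrableP; split => //.
have -> : \int[mu]_x `|(x ^+ k * gauss_fun x)%:E| = \int[mu]_x (`|x| ^+ k * gauss_fun x)%:E.
  by apply: eq_integral => x _; rewrite /= normrM normrX (ger0_norm (gauss_fun_ge0 x)).
rewrite ge0_symfun_integralT.
- rewrite (_ : [set x | _] = `[0%R, +oo[%classic); last by apply/seteqP; split => x/=; rewrite in_itv/= andbT.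
  rewrite (_ : \int[mu]_(x in _) _ = gmom k); first by rewrite gmE -EFinM ltry.
  by apply: eq_integral => x; rewrite inE/= in_itv/= andbT => x0; rewrite ger0_norm.
- by move=> x; rewrite mulr_ge0 ?gauss_fun_ge0// exprn_ge0.
- exact cabs.
- by move=> x; rewrite /comp/= normrN /gauss_fun sqrrN.
Qed.

Lemma integral_gauss_sqr : (\int[mu]_x (x ^+ 2 * gauss_fun x) = Num.sqrt pi / 2)%R.
Proof.
rewrite /Rintegral ge0_symfun_integralT.
- rewrite (_ : [set x | _] = `[0%R, +oo[%classic); last by apply/seteqP; split => x/=; rewrite in_itv/= andbT.
  by rewrite -/(gmom 2) gmE -EFinM/= (gm_even 1) (_ : (2 * 1)`! = 2%N)// (_ : 1`! = 1%N)// expr1; field.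
- by move=> x; rewrite mulr_ge0 ?gauss_fun_ge0// sqr_ge0.
- exact: continuous_gmom_fun.
- by move=> x; rewrite /comp/= sqrrN /gauss_fun sqrrN.
Qed.

Lemma L2_1 : L2 P (fun=> 1%R).
Proof.
split => //; have i := finite_measure_integrable_cst P 1%R measurableT.
by apply: eq_integrable i => // w _; rewrite expr1n.
Qed.

Lemma integral_prob_cst (r : R) : \int[P]_w r%:E = r%:E.
Proof.
by rewrite (_ : \int[P]_w _ = r%:E * P setT) ?integral_cst// probability_setT mule1.
Qed.

Lemma Rintegral_prob_cst (r : R) : (\int[P]_w r = r)%R.
Proof. by rewrite /Rintegral integral_prob_cst. Qed.

Lemma normal_law_center (W : T -> R) (a v : R) :
  normal_law P W a v -> L2 P W -> (\int[P]_w W w = 0)%R -> a = 0%R /\ v = ip P W W.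
Proof.
move=> nW LW W0.
have iW : P.-integrable setT (fun w => (W w)%:E).
  have L1 := L2_1.
  by have i := L2_mul LW L1; apply: eq_integrable i => // x _; rewrite mulr1.
have sp : (0 < Num.sqrt pi :> R)%R by rewrite sqrtr_gt0 pi_gt0.
have v0 : (0 <= v)%R by case: nW => _ [].
pose s := Num.sqrt (2 * v).
have mW : measurable_fun setT W := LW.1.
(* The law is symmetric about [a]: positive and negative parts of [W - a] have equal expectations,
   so [a] is the mean. *)
have a0 : a = 0%R.
  pose hp (x : R) : \bar R := (Num.max (x - a) 0)%:E.
  pose hm (x : R) : \bar R := (Num.max (- (x - a)) 0)%:E.
  have mhp : measurable_fun setT hp.
    by apply/measurable_EFinP; apply: measurable_maxr => //; exact: measurable_funB.
  have mhm : measurable_fun setT hm.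
    by apply/measurable_EFinP; apply: measurable_maxr => //; apply: measurableT_comp => //; exact: measurable_funB.
  have hp0 x : 0 <= hp x by rewrite lee_fin le_max lexx orbT.
  have hm0 x : 0 <= hm x by rewrite lee_fin le_max lexx orbT.
  have Ep := normal_law_integral nW mhp hp0.
  have Em := normal_law_integral nW mhm hm0.
  have E : \int[P]_w hp (W w) = \int[P]_w hm (W w).
    rewrite Ep Em; congr (_ * _).
    pose f (x : R) := hm (Num.sqrt (2 * v) * x + a)%R * (gauss_fun x)%:E.
    have mf : measurable_fun setT f.
      apply: emeasurable_funM; last exact: measurable_EFin_gauss.
      by apply: (measurableT_comp mhm); exact: measurable_affine.
    have f0 x : 0 <= f x by rewrite mule_ge0// lee_fin gauss_fun_ge0.
    have n10 : (- 1 != 0 :> R)%R by rewrite oppr_eq0 oner_eq0.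
    have := @ge0_integral_affine R (- 1)%R 0%R f n10 mf f0.
    rewrite normrN1 mul1e => <-; apply: eq_integral => x _.
    rewrite /f /hp /hm addr0 mulN1r !addrK mulrN opprK; congr (_ * _).
    by rewrite /gauss_fun sqrrN.
  have ia : P.-integrable setT (fun w => (W w - a)%:E).
    have ic : P.-integrable setT (fun=> a%:E) by exact: finite_measure_integrable_cst.
    have i := integrableB measurableT iW ic.
    by apply: eq_integrable i.
  have Ea : (\int[P]_w (W w - a) = - a)%R.
    rewrite RintegralB//; last exact: finite_measure_integrable_cst.
    by rewrite W0 sub0r Rintegral_prob_cst.
  have Z : \int[P]_w (W w - a)%:E = 0.
    rewrite integralE.
    have -> : \int[P]_w (fun w => (W w - a)%:E)^\+ w = \int[P]_w hp (W w).
      by apply: eq_integral => w _; rewrite funeposE /hp EFin_max.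
    have -> : \int[P]_w (fun w => (W w - a)%:E)^\- w = \int[P]_w hm (W w).
      by apply: eq_integral => w _; rewrite funenegE /hm EFin_max.
    rewrite E subee//.
    have -> : \int[P]_w hm (W w) = \int[P]_w (fun w => (W w - a)%:E)^\- w.
      by apply: eq_integral => w _; rewrite funenegE /hm EFin_max.
    by apply: integrable_fin_num => //; exact: integrable_funeneg.
  by move: Ea; rewrite /Rintegral Z/= => /esym/eqP; rewrite oppr_eq0 => /eqP.
split => //; rewrite a0 in nW.
have mh : measurable_fun [set: R] (fun x : R => (x ^+ 2)%:E : \bar R).
  by apply/measurable_EFinP; exact: measurable_funX.
have h0 (x : R) : 0 <= (x ^+ 2)%:E :> \bar R by rewrite lee_fin sqr_ge0.
have := normal_law_integral nW mh h0.
have -> : \int[mu]_x (((Num.sqrt (2 * v) * x + 0) ^+ 2)%:E * (gauss_fun x)%:E) =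
    \int[mu]_x ((2 * v)%:E * (x ^+ 2 * gauss_fun x)%:E).
  apply: eq_integral => x _; rewrite addr0 -!EFinM exprMn sqr_sqrtr; last exact: mulr_ge0.
  by congr EFin; ring.
rewrite integralZl//; last exact: integrable_gauss_pow.
have -> : \int[mu]_x (x ^+ 2 * gauss_fun x)%:E = (Num.sqrt pi / 2)%:E.
  rewrite -integral_gauss_sqr /Rintegral fineK//; apply: integrable_fin_num => //.
  exact: integrable_gauss_pow.
rewrite -!EFinM => E; rewrite /ip /Rintegral.
under eq_integral do rewrite -expr2.
by rewrite E/=; field; rewrite gt_eqF.
Qed.

(** The expectation of [cos (W + c)] for a centred Gaussian [W] of variance [s]. The phase [c] lets
    cosines alone carry the characteristic function. *)
Definition gauss_cos (s c : R) : R :=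
  ((Num.sqrt pi)^-1 * \int[mu]_x (cos (Num.sqrt (2 * s) * x + c) * gauss_fun x))%R.

Lemma measurable_cos_affine (a c : R) : measurable_fun [set: R] (fun x : R => cos (a * x + c)).
Proof.
apply: (measurableT_comp (continuous_measurable_fun (@continuous_cos R))).
by apply: measurable_funD => //; exact: measurable_funM.
Qed.

Lemma integrable_cos_gauss (a c : R) : mu.-integrable setT (fun x => (cos (a * x + c) * gauss_fun x)%:E).
Proof.
apply: le_integrable (@integrableT_gauss R) => //.
  by apply/measurable_EFinP; apply: measurable_funM; [exact: measurable_cos_affine|exact: measurable_gauss_fun].
move=> x _; rewrite /= lee_fin normrM ler_piMl// ler_norml.
by rewrite cos_geN1 cos_le1.
Qed.

Lemma gauss_cos_cvg (s_ : nat -> R) (s c : R) :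
  s_ n @[n --> \oo] --> s -> gauss_cos (s_ n) c @[n --> \oo] --> gauss_cos s c.
Proof.
move=> cs; apply: cvgMr.
apply: (@Rintegral_dominated_cvg _ _ R mu setT (fun n x => cos (Num.sqrt (2 * s_ n) * x + c) * gauss_fun x)%R _ (@gauss_fun R)) => //.
- by move=> n; apply: measurable_funM; [exact: measurable_cos_affine|exact: measurable_gauss_fun].
- by apply: measurable_funM; [exact: measurable_cos_affine|exact: measurable_gauss_fun].
- move=> x _; apply: cvgMl; apply: (continuous_cvg _ (@continuous_cos R _)).
  apply: cvgD; last exact: cvg_cst; apply: cvgMl.
  apply: (continuous_cvg _ (@sqrt_continuous R _)).
  by apply: cvgMr.
- exact: integrableT_gauss.
- move=> n x _; rewrite normrM [`|gauss_fun x|%R]ger0_norm ?gauss_fun_ge0//.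
  by rewrite ler_piMl ?gauss_fun_ge0// ler_norml cos_geN1 cos_le1.
Qed.

(** Centred Gaussianity expressed by cosines, with the variance read off as a squared norm. In this
    form it passes to L2 limits, degenerate ones included. *)
Definition gauss_like (W : T -> R) :=
  L2 P W /\ forall c, (\int[P]_w cos (W w + c) = gauss_cos (ip P W W) c)%R.

Lemma integrable_bounded (f : T -> R) (M : R) : measurable_fun setT f ->
  (forall w, `|f w| <= M)%R -> P.-integrable setT (EFin \o f).
Proof.
move=> mf fM; apply: le_integrable (finite_measure_integrable_cst P M measurableT) => //.
  exact/measurable_EFinP.
by move=> w _; rewrite /= lee_fin (le_trans (fM w))// ler_norm.
Qed.

Lemma measurable_cos_comp (W : T -> R) (c : R) : measurable_fun setT W -> measurable_fun setT (fun w => cos (W w + c)).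
Proof.
move=> mW; apply: (measurableT_comp (continuous_measurable_fun (@continuous_cos R))).
by apply: measurable_funD.
Qed.

Lemma integrable_cos_comp (W : T -> R) (c : R) : measurable_fun setT W ->
  P.-integrable setT (fun w => (cos (W w + c))%:E).
Proof.
move=> mW; apply: (@integrable_bounded _ 1%R); first exact: measurable_cos_comp.
by move=> w; rewrite ler_norml cos_geN1 cos_le1.
Qed.

Lemma normal_gauss_like (W : T -> R) (a v : R) :
  normal_law P W a v -> L2 P W -> (\int[P]_w W w = 0)%R -> gauss_like W.
Proof.
move=> nW LW W0; split => // c.
have [a0 ve] := normal_law_center nW LW W0; rewrite -ve.
have mW := LW.1.
(* Adding 1 gives a nonnegative test function, to which [normal_law_integral] applies. *)
have mh : measurable_fun [set: R] (fun x : R => (1 + cos (x + c))%:E : \bar R).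
  apply/measurable_EFinP; apply: measurable_funD => //.
  by have := measurable_cos_affine 1 c; under eq_fun do rewrite mul1r.
have h0 (x : R) : 0 <= (1 + cos (x + c))%:E :> \bar R.
  by rewrite lee_fin -lerBlDl sub0r cos_geN1.
have sp : (0 < Num.sqrt pi :> R)%R by rewrite sqrtr_gt0 pi_gt0.
have := normal_law_integral nW mh h0.
have -> : \int[mu]_x ((1 + cos (Num.sqrt (2 * v) * x + a + c))%:E * (gauss_fun x)%:E) =
    \int[mu]_x ((gauss_fun x)%:E + (cos (Num.sqrt (2 * v) * x + c) * gauss_fun x)%:E).
  by apply: eq_integral => x _; rewrite a0 addr0 -EFinM -EFinD mulrDl mul1r.
rewrite integralD//; [|exact: integrableT_gauss|exact: integrable_cos_gauss].
rewrite integralT_gauss.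
have -> : \int[P]_w (1 + cos (W w + c))%:E = \int[P]_w ((cst 1 w) + (cos (W w + c))%:E) by [].
rewrite integralD//; [|exact: finite_measure_integrable_cst|exact: integrable_cos_comp].
rewrite integral_prob_cst.
have f1 := integrable_fin_num measurableT (integrable_cos_comp c mW).
have f2 := integrable_fin_num measurableT (integrable_cos_gauss (Num.sqrt (2 * v)) c).
rewrite -(fineK f1) -(fineK f2) -!EFinD -EFinM => -[].
rewrite mulrDr mulVf ?gt_eqF// => /addrI H.
by rewrite /gauss_cos /Rintegral H.
Qed.

(** The cosine is 1-Lipschitz, so the expectations differ by at most the L1 distance, which
    Cauchy-Schwarz bounds by the L2 distance. *)
Lemma gauss_like_lim (S : nat -> T -> R) (W : T -> R) : (forall n, gauss_like (S n)) -> L2 P W ->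
  ip P (fun w => S n w - W w)%R (fun w => S n w - W w)%R @[n --> \oo] --> 0%R -> gauss_like W.
Proof.
move=> GS LW cS; split => // c.
have LS n : L2 P (S n) by case: (GS n).
have c1 : gauss_cos (ip P (S n) (S n)) c @[n --> \oo] --> gauss_cos (ip P W W) c.
  by apply: gauss_cos_cvg; exact: ip_cvg.
suff c2 : gauss_cos (ip P (S n) (S n)) c @[n --> \oo] --> (\int[P]_w cos (W w + c))%R.
  exact: cvg_unique c2 c1.
apply/cvgrPdist_le => e e0; move/cvgrPdist_le : cS => /(_ _ (exprn_gt0 2 e0)); apply: filterS => n.
rewrite sub0r normrN ger0_norm ?ip_ge0// => h.
have [_ <-] := GS n.
pose D w := (S n w - W w)%R.
have LD : L2 P D by exact: L2B.
have L1 := L2_1.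
have mnD : measurable_fun setT (fun w => `|D w|%R) by apply: measurableT_comp => //; exact: LD.1.
have LnD : L2 P (fun w => `|D w|)%R.
  split => //; have i := LD.2; apply: eq_integrable i => // w _.
  by rewrite real_normK// num_real.
have iD : P.-integrable setT (fun w => (`|D w|%R)%:E).
  by have i := L2_mul LnD L1; apply: eq_integrable i => // w _; rewrite mulr1.
rewrite -RintegralB//; [|exact: integrable_cos_comp LW.1|exact: integrable_cos_comp (LS n).1].
apply: (le_trans (le_normr_Rintegral _ _)) => //.
  have i := integrableB measurableT (integrable_cos_comp c LW.1) (integrable_cos_comp c (LS n).1).
  by apply: eq_integrable i.
apply: (@le_trans _ _ (ip P (fun w => `|D w|)%R (fun=> 1%R))).
  rewrite /ip; apply: le_Rintegral => //.
  - apply: (@integrable_bounded _ 2%R).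
      apply: measurableT_comp => //; apply: measurable_funB; apply: measurable_cos_comp; [exact: LW.1|exact: (LS n).1].
    move=> w; rewrite normr_id; apply: (le_trans (ler_normB _ _)).
    by rewrite (_ : 2 = 1 + 1)%R// lerD// ler_norml cos_geN1 cos_le1.
  - by have i := iD; apply: eq_integrable i => // w _; rewrite /= mulr1.
  move=> w _; rewrite mulr1; apply: (le_trans (cos_lip _ _)).
  by rewrite opprD addrACA subrr addr0 distrC.
rewrite -ler_sqr ?nnegrE ?(ltW e0)//; last by apply: Rintegral_ge0 => w _; rewrite mulr1.
apply: (le_trans (ip_CS LnD L1)).
have -> : ip P (fun=> 1%R) (fun=> 1%R) = 1%R.
  by rewrite /ip; under eq_Rintegral do rewrite mulr1; rewrite Rintegral_prob_cst.
rewrite mulr1; apply: le_trans h; rewrite le_eqVlt; apply/orP; left; apply/eqP.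
by apply: eq_Rintegral => w _; rewrite -!expr2 real_normK// num_real.
Qed.

End gauss_law.

(** * Volume of balls and area of spheres *)

Section ball.
Local Open Scope ereal_scope.
Context {R : realType}.
Variable n : nat.

Lemma measurable_normball (b : R) : measurable [set x : n.-tuple R | (norm_Rn x <= b)%R].
Proof.
have := @measurable_norm_Rn R n measurableT `]-oo, b]%classic (measurable_itv _).
by rewrite setTI (_ : _ @^-1` _ = [set x : n.-tuple R | (norm_Rn x <= b)%R])//; apply/seteqP; split => x /=; rewrite in_itv.
Qed.

Lemma unit_ball_fin : exists kappa : R,
  \int[@leb R n]_(x in [set x | (norm_Rn x <= 1)%R]) (cst 1%R x)%:E = kappa%:E.
Proof.
exists (fine (\int[@leb R n]_(x in [set x | (norm_Rn x <= 1)%R]) (cst 1%R x)%:E)).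
rewrite fineK// ge0_fin_numE; last by apply: integral_ge0 => x _; rewrite lee_fin.
apply: (@le_lt_trans _ _ (\int[@leb R n]_x ((expR 1)%:E * (gaussT x)%:E))); last first.
  rewrite ge0_integralZl//.
  - by rewrite integral_gaussT -EFinM ltry.
  - by apply/measurable_EFinP; exact: measurable_gaussT.
  - by move=> x _; rewrite lee_fin gaussT_ge0.
rewrite [leLHS]integral_mkcond; apply: ge0_le_integral => //.
- by move=> x _; rewrite patchE; case: ifP => // _; rewrite lee_fin.
- by apply/(measurable_restrictT _ (measurable_normball 1)); exact: (@measurable_cst _ _ _ _ _ 1%:E).
- by apply: measurable_funeM; apply/measurable_EFinP; exact: measurable_gaussT.
move=> x _; rewrite patchE; case: ifP => [/set_mem/= x1|_]; last first.
  by rewrite -EFinM lee_fin mulr_ge0 ?expR_ge0 ?gaussT_ge0.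
rewrite -EFinM lee_fin /= gaussT_norm -expRD.
by rewrite -[leLHS]expR0 ler_expR subr_ge0 expr_le1// norm_ge0.
Qed.
End ball.

Section radial_integral.
Local Open Scope ereal_scope.
Context {R : realType}.
Local Notation mu := (@lebesgue_measure R).
Variable n : nat.

(** The area of the unit sphere in dimension [n + 1]; it is also the constant in front of the
    spectral measure in [spectral_cov n.+1]. *)
Definition sphere_area : R := (2 * pi `^ (n.+1%:R / 2) / GammaR (n.+1%:R / 2))%R.

Lemma sqrt_pi_pow k : (Num.sqrt pi ^+ k = pi `^ (k%:R / 2) :> R)%R.
Proof.
rewrite -powR12_sqrt ?pi_ge0// -powR_mulrn ?powR_ge0// -powRrM; congr (_ `^ _)%R.
by rewrite mulrC.
Qed.

Lemma sphere_area_gm : (sphere_area = Num.sqrt pi ^+ n.+1 / gm n)%R.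
Proof.
rewrite /sphere_area GammaR_half -sqrt_pi_pow -/(gm n).
have g0 : (gm n != 0 :> R)%R by rewrite gt_eqF// gm_gt0.
by field.
Qed.

Lemma radial_integral (G : R -> \bar R) : measurable_fun setT G -> (forall u, 0 <= G u) ->
  \int[@leb R n.+1]_x G (norm_Rn x) =
  \int[mu]_(u in `[0%R, +oo[) (G u * (sphere_area * u ^+ n)%:E).
Proof.
move=> mG G0; have [kappa ik] := @unit_ball_fin R n.+1.
have P := @polar R n (cst 1%R) kappa (measurable_cst _) (fun=> ler01) (fun _ _ _ => erefl) ik.
(* The constant is identified by testing the formula on the Gaussian weight, whose two integrals are
   known. *)
have kE : (kappa * n.+1%:R)%R = sphere_area.
  have mg : measurable_fun [set: R] (fun u : R => (gauss_fun u)%:E) by exact: measurable_EFin_gauss.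
  have g0 (u : R) : 0 <= (gauss_fun u)%:E by rewrite lee_fin gauss_fun_ge0.
  have := P _ mg g0.
  have -> : \int[@leb R n.+1]_x ((gauss_fun (norm_Rn x))%:E * (cst 1%R x)%:E) = (Num.sqrt pi ^+ n.+1)%:E.
    rewrite -integral_gaussT; apply: eq_integral => x _.
    by rewrite mule1 gaussT_norm.
  have -> : \int[mu]_(u in `[0%R, +oo[) ((gauss_fun u)%:E * (kappa * (n.+1%:R * u ^+ n))%:E) =
     (kappa * n.+1%:R)%:E * gmom n.
    rewrite /gmom -integralZl//.
    - by apply: eq_integral => u _; rewrite -!EFinM; congr EFin; ring.
    - apply/integrableP; split.
        apply: measurable_funTS; apply/measurable_EFinP; apply: measurable_funM; last exact: measurable_gauss_fun.
        exact: measurable_funX.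
      suff -> : \int[mu]_(x in `[0%R, +oo[) `|(x ^+ n * gauss_fun x)%:E| = gmom n by rewrite gmE ltry.
      apply: eq_integral => u; rewrite inE/= in_itv/= andbT => u0.
      by rewrite ger0_norm// gmom_fun_ge0.
  rewrite gmE -EFinM => -[E]; rewrite sphere_area_gm E mulfK//.
  by rewrite gt_eqF// gm_gt0.
have := P _ mG G0; under eq_integral do rewrite mule1.
by move=> ->; apply: eq_integral => u _; rewrite mulrA kE.
Qed.

Lemma norm0_null : (@leb R n.+1).-negligible [set x : n.+1.-tuple R | norm_Rn x = 0%R].
Proof.
have [kappa ik] := @unit_ball_fin R n.+1.
have := @ball_kappa R n (cst 1%R) kappa (measurable_cst _) (fun=> ler01) (fun _ _ _ => erefl) ik 0%R.
rewrite lexx expr0n/= mulr0 => H.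
exists [set x : n.+1.-tuple R | (norm_Rn x <= 0)%R]; split.
- exact: measurable_normball.
- rewrite -[LHS]mul1e -integral_cst//; exact: measurable_normball.
- by move=> x /= ->.
Qed.

End radial_integral.

(** * The spectral variance formula *)

Section cas.
Local Open Scope ereal_scope.
Context {R : realType}.
Variable n : nat.
Local Notation mu := (@lebesgue_measure R).
Local Notation m2 := (mu \x @leb R n.+1).

Definition axpyT k (c : R) (x y : k.-tuple R) : k.-tuple R := [tuple (tnth x i + c * tnth y i)%R | i < k].

Lemma inner_axpyr k c (x y z : k.-tuple R) : inner_Rn z (axpyT c x y) = (inner_Rn z x + c * inner_Rn z y)%R.
Proof.
rewrite /inner_Rn mulr_sumr -big_split/=; apply: eq_bigr => i _.
by rewrite tnth_mktuple; ring.
Qed.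

Lemma norm_axpy k (x y : k.-tuple R) : norm_Rn (axpyT (-1) x y) = dist_Rn x y.
Proof.
by congr Num.sqrt; apply: eq_bigr => i _; rewrite tnth_mktuple mulN1r expr2.
Qed.

Lemma dir_axpy c (x y v : n.+1.-tuple R) : dir (axpyT c x y) v = (dir x v + c * dir y v)%R.
Proof. by rewrite /dir inner_axpyr mulrDl mulrA. Qed.

(** Fubini for a radial factor [A] and a Gaussian vector that carries the direction; a bounded [k]
    is dominated by the finite mass of [gaussT]. *)
Lemma prod_gaussT (A : R -> R) (k : measurableTypeR R * n.+1.-tuple R -> R) (M : R) :
  mu.-integrable setT (EFin \o A) -> measurable_fun setT k -> (forall p, `|k p| <= M)%R ->
  m2.-integrable setT (fun p => (A p.1 * (k p * gaussT p.2))%:E) /\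
  (\int[m2]_p (A p.1 * (k p * gaussT p.2)) =
   \int[mu]_u (A u * \int[@leb R n.+1]_y (k (u, y) * gaussT y)))%R.
Proof.
move=> iA mk kM.
have mA : measurable_fun [set: measurableTypeR R] A by have /integrableP[/measurable_EFinP] := iA.
have mf : measurable_fun [set: measurableTypeR R * n.+1.-tuple R] (fun p => (A p.1 * (k p * gaussT p.2))%R).
  apply: measurable_funM; first exact: (measurableT_comp mA measurable_fst).
  apply: measurable_funM => //; exact: (measurableT_comp (@measurable_gaussT R _) measurable_snd).
have M0 : (0 <= M)%R by apply: le_trans (kM (0%R, [tuple of nseq _ 0%R])).
have mku u : measurable_fun [set: n.+1.-tuple R] (fun y => k (u, y)).
  exact: (@measurable_sect _ _ (measurableTypeR R) _ _ _ k u).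
have igk u : (@leb R n.+1).-integrable setT (fun y => (k (u, y) * gaussT y)%:E).
  exact: integrable_gaussT_bounded (mku u) (fun y => kM (u, y)).
have ii : m2.-integrable setT (fun p => (A p.1 * (k p * gaussT p.2))%:E).
  apply/integrable12ltyP; first exact/measurable_EFinP.
  apply: (@le_lt_trans _ _ (\int[mu]_u ((M * Num.sqrt pi ^+ n.+1)%:E * `|A u|%:E))); last first.
    rewrite integralZl//; last exact: integrable_norm.
    rewrite ltey_eq fin_numM//; apply: integrable_fin_num => //.
    exact: integrable_norm.
  apply: ge0_le_integral => //.
  - by move=> u _; exact: integral_ge0.
  - have h := @measurable_integral_param R _ _ (measurableTypeR R) _ (@leb R n.+1) (fun p => `|(A p.1 * (k p * gaussT p.2))%:E|).
    apply: h; apply: measurableT_comp => //; exact/measurable_EFinP.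
  - apply: measurable_funeM; apply/measurable_EFinP; exact: measurableT_comp.
  move=> u _ /=.
  apply: (@le_trans _ _ (\int[@leb R n.+1]_y ((`|A u| * M)%:E * (gaussT y)%:E))).
    apply: ge0_le_integral => //.
    - apply/measurable_EFinP; apply: measurableT_comp => //; apply: measurable_funM => //; by have /integrableP[/measurable_EFinP] := igk u.
    - by apply: measurable_funeM; apply/measurable_EFinP; exact: measurable_gaussT.
    move=> y _; rewrite -EFinM lee_fin !normrM (ger0_norm (gaussT_ge0 _)) -mulrA.
    by apply: ler_wpM2l => //; apply: ler_wpM2r; [exact: gaussT_ge0|].
  rewrite ge0_integralZl//.
  - by rewrite integral_gaussT -!EFinM lee_fin le_eqVlt; apply/orP; left; apply/eqP; ring.
  - by apply/measurable_EFinP; exact: measurable_gaussT.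
  - by move=> y _; rewrite lee_fin gaussT_ge0.
  - by rewrite lee_fin mulr_ge0.
split => //.
rewrite /Rintegral -integral12_prod_meas1//; congr fine; apply: eq_integral => u _.
rewrite /fubini_F/= EFinM fineK; last exact: integrable_fin_num (igk u).
by rewrite -integralZl//; apply: eq_integral => y _; rewrite -EFinM.
Qed.

End cas.

Section lebX.
Context {R : realType}.
Variable n : nat.
Local Notation pm := (@lebesgue_measure R \x @leb R n)%E.

(* The canonical sigma-finite structure on products of sigma-finite measures is
   shadowed in the library by the one on products of subprobabilities. *)
Definition lebX : set (measurableTypeR R * n.-tuple R) -> \bar R := pm.
HB.instance Definition _ := Measure.on lebX.

Let sf : sigma_finite [set: measurableTypeR R * n.-tuple R] lebX.
Proof.
have /sigma_finiteP[F [TF ndF Foo]] := sigma_finiteT (@lebesgue_measure R).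
have /sigma_finiteP[G [TG ndG Goo]] := sigma_finiteT (@leb R n).
exists (fun k => F k `*` G k).
  apply/esym; rewrite -subTset => -[x t] _.
  have [i _ Fi] : (\bigcup_i F i) x by rewrite -TF.
  have [k _ Gk] : (\bigcup_i G i) t by rewrite -TG.
  exists (maxn i k) => //; split => /=.
    by have /subsetPset := ndF _ _ (leq_maxl i k); apply.
  by have /subsetPset := ndG _ _ (leq_maxr i k); apply.
move=> k; have [mF ltF] := Foo k; have [mG ltG] := Goo k.
split; first exact: measurableX.
have E := @product_measure1E _ _ _ _ R (@lebesgue_measure R) (@leb R n) _ _ mF mG.
by rewrite /lebX E lte_mul_pinfty// ge0_fin_numE.
Qed.

HB.instance Definition _ := @Measure_isSigmaFinite.Build _ _ _ lebX sf.
End lebX.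
Arguments lebX {R} n.

(** * A model of the covariance *)

Section hartley.
Context {R : realType}.
Variables (n : nat) (phi : R -> R).
Local Notation mu := (@lebesgue_measure R).
Local Notation m2 := (lebX n.+1).
Hypothesis iphi : mu.-integrable `[0, +oo[%classic (fun u => (u ^+ n * phi u)%:E).
Hypothesis phi0 : forall u, 0 <= u -> 0 <= phi u.

(** The density of the spectral measure in the radius, divided by the mass of [gaussT] so that the
    Gaussian direction counts as a probability. It vanishes for negative radii, which allows
    integration over the whole line. *)
Definition radial_density (u : R) : R :=
  sphere_area n * (Num.sqrt pi ^+ n.+1)^-1 * (if 0 <= u then u ^+ n * phi u else 0).

Lemma sphere_area_gt0 : 0 < sphere_area n :> R.
Proof. by rewrite sphere_area_gm divr_gt0 ?gm_gt0// exprn_gt0// sqrtr_gt0 pi_gt0. Qed.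

Lemma radial_density_ge0 u : 0 <= radial_density u.
Proof.
rewrite mulr_ge0//; last by case: ifP => // u0; rewrite mulr_ge0 ?exprn_ge0 ?phi0.
by rewrite mulr_ge0 ?(ltW sphere_area_gt0)// invr_ge0 exprn_ge0 ?sqrtr_ge0.
Qed.

Let restrE : (fun u => (u ^+ n * phi u)%:E) \_ `[0, +oo[%classic =
  (fun u : R => (if 0 <= u then u ^+ n * phi u else 0)%:E).
Proof.
apply/funext => u; rewrite patchE mem_setE in_itv/= andbT.
by case: ifP.
Qed.

Lemma integrable_radial_density : mu.-integrable setT (EFin \o radial_density).
Proof.
have mI : measurable (`[0, +oo[%classic : set (measurableTypeR R)) by exact: measurable_itv.
have := (integrable_mkcond _ mI).1 iphi; rewrite restrE => i.
apply: eq_integrable (integrableZl measurableT (sphere_area n * (Num.sqrt pi ^+ n.+1)^-1) i) => //.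
Qed.

Lemma Rintegral_radial_density (k : R -> R) :
  \int[mu]_u (radial_density u * k u) =
  \int[mu]_(u in `[0, +oo[%classic) (sphere_area n * (Num.sqrt pi ^+ n.+1)^-1 * (u ^+ n * phi u) * k u).
Proof.
rewrite [RHS]Rintegral_mkcond; apply: eq_Rintegral => u _.
rewrite patchE mem_setE in_itv/= andbT /radial_density.
by case: ifP => //; rewrite mulr0 mul0r.
Qed.

(* In polar form [(u, y / |y|)] with [y] Gaussian. The kernel [cos + sin] is a real substitute for
   [expi]: the product of two of its values is a cosine of the difference plus an odd function,
   and the latter integrates to [0]. *)
Definition hartley (x : n.+1.-tuple R) (p : measurableTypeR R * n.+1.-tuple R) : R :=
  Num.sqrt (radial_density p.1) * Num.sqrt (gaussT p.2) * (cos (p.1 * dir x p.2) + sin (p.1 * dir x p.2)).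

Let mdens : measurable_fun [set: measurableTypeR R] radial_density.
Proof. by have /integrableP[/measurable_EFinP] := integrable_radial_density. Qed.

Lemma measurable_dir2 d (X : measurableType d) (c v : X -> n.+1.-tuple R) :
  measurable_fun setT c -> measurable_fun setT v -> measurable_fun setT (fun p => dir (c p) (v p)).
Proof.
move=> mc mv; apply: measurable_funM; first by apply: measurable_inner.
rewrite (_ : (fun x => _) = (fun x => norm_Rn (v x) `^ (-1))); last first.
  by apply/funext => x; rewrite powR_inv1// norm_ge0.
by apply: (measurableT_comp (measurable_powR _)); exact: (measurableT_comp (@measurable_norm_Rn _ _)).
Qed.

Lemma measurable_cas d (X : measurableType d) (c : X -> R) :
  measurable_fun setT c -> measurable_fun setT (fun p => cos (c p) + sin (c p)).
Proof.
move=> mc; apply: measurable_funD.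
  exact: (measurableT_comp (continuous_measurable_fun (@continuous_cos R))).
exact: (measurableT_comp (continuous_measurable_fun (@continuous_sin R))).
Qed.

Lemma measurable_hartley : measurable_fun setT (fun q : n.+1.-tuple R * (measurableTypeR R * n.+1.-tuple R) => hartley q.1 q.2).
Proof.
have m1 : measurable_fun setT (fun q : n.+1.-tuple R * (measurableTypeR R * n.+1.-tuple R) => q.2.1).
  exact: (measurableT_comp measurable_fst measurable_snd).
have mm2 : measurable_fun setT (fun q : n.+1.-tuple R * (measurableTypeR R * n.+1.-tuple R) => q.2.2).
  exact: (measurableT_comp measurable_snd measurable_snd).
apply: measurable_funM.
  apply: measurable_funM; apply: (measurableT_comp measurable_sqrt).
    exact: (measurableT_comp mdens).
  exact: (measurableT_comp (@measurable_gaussT R _)).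
apply: measurable_cas; apply: measurable_funM; first exact: m1.
by apply: measurable_dir2.
Qed.

Lemma cas_le (a : R) : `|cos a + sin a| <= 2.
Proof.
have : `|cos a| <= 1 by rewrite ler_norml cos_geN1 cos_le1.
have : `|sin a| <= 1 by rewrite ler_norml sin_geN1 sin_le1.
have := ler_normD (cos a) (sin a); lra.
Qed.

Lemma casM (a b : R) : (cos a + sin a) * (cos b + sin b) = cos (a - b) + sin (a + b).
Proof. by rewrite cosB sinD; ring. Qed.

Lemma hartleyM x y p : hartley x p * hartley y p =
  radial_density p.1 * ((cos (p.1 * dir (axpyT (-1) x y) p.2) + sin (p.1 * dir (axpyT 1 x y) p.2)) * gaussT p.2).
Proof.
rewrite !dir_axpy mul1r mulN1r mulrBr mulrDr -casM /hartley.
rewrite -[in RHS](sqr_sqrtr (radial_density_ge0 p.1)) -[in RHS](sqr_sqrtr (gaussT_ge0 p.2)).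
ring.
Qed.

Let mcs x y : measurable_fun [set: measurableTypeR R * n.+1.-tuple R]
  (fun p => cos (p.1 * dir x p.2) + sin (p.1 * dir y p.2)).
Proof.
have md v : measurable_fun [set: measurableTypeR R * n.+1.-tuple R] (fun p => p.1 * dir v p.2).
  by apply: measurable_funM; [exact: measurable_fst|exact: (measurableT_comp (measurable_dir v) measurable_snd)].
apply: measurable_funD.
  exact: (measurableT_comp (continuous_measurable_fun (@continuous_cos R)) (md x)).
exact: (measurableT_comp (continuous_measurable_fun (@continuous_sin R)) (md y)).
Qed.

Let bcs x y (p : measurableTypeR R * n.+1.-tuple R) : `|cos (p.1 * dir x p.2) + sin (p.1 * dir y p.2)| <= 2.
Proof.
have : `|cos (p.1 * dir x p.2)| <= 1 by rewrite ler_norml cos_geN1 cos_le1.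
have : `|sin (p.1 * dir y p.2)| <= 1 by rewrite ler_norml sin_geN1 sin_le1.
have := ler_normD (cos (p.1 * dir x p.2)) (sin (p.1 * dir y p.2)); lra.
Qed.

Lemma L2_hartley x : L2 m2 (hartley x).
Proof.
split.
  exact: (@measurable_sect _ _ _ _ _ _ (fun q => hartley q.1 q.2) x measurable_hartley).
have [i _] := prod_gaussT integrable_radial_density (mcs (axpyT (-1) x x) (axpyT 1 x x)) (bcs _ _).
by apply: eq_integrable i => // p _; rewrite expr2 hartleyM.
Qed.

(** By [hartleyM] the integral over directions is that of a plane wave in [x - y] plus a sine; the
    first gives the Bessel function, the second 0. *)
Lemma ip_hartley x y : ip m2 (hartley x) (hartley y) = spectral_cov n.+1 phi (dist_Rn x y).
Proof.
pose k (p : measurableTypeR R * n.+1.-tuple R) := cos (p.1 * dir (axpyT (-1) x y) p.2) + sin (p.1 * dir (axpyT 1 x y) p.2).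
have mk : measurable_fun setT k := mcs _ _.
have [_ E] := prod_gaussT integrable_radial_density mk (bcs _ _).
rewrite /ip; under eq_Rintegral do rewrite hartleyM.
rewrite {}E Rintegral_radial_density /spectral_cov.
pose K (u : R) := \int[@leb R n.+1]_v (k (u, v) * gaussT v).
pose c : R := Num.sqrt pi ^+ n.+1 * (2 `^ ((n.+1%:R - 2) / 2) * GammaR (n.+1%:R / 2)).
have sp : Num.sqrt pi ^+ n.+1 != 0 :> R by rewrite expf_neq0// gt_eqF// sqrtr_gt0 pi_gt0.
have c0 : c != 0.
  by rewrite mulf_neq0// mulf_neq0// ?gt_eqF ?powR_gt0// GammaR_half mulr_gt0// gm_gt0.
have mku u : measurable_fun [set: n.+1.-tuple R] (fun v => k (u, v)).
  exact: (@measurable_sect _ _ (measurableTypeR R) _ _ _ k u).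
have ik u : (@leb R n.+1).-integrable setT (fun v => (k (u, v) * gaussT v)%:E).
  exact: integrable_gaussT_bounded (mku u) (fun v => bcs _ _ (u, v)).
have KE u : K u = c * besselJ_div ((n.+1%:R - 2) / 2) (dist_Rn x y * u).
  rewrite /K (_ : \int[_]_v _ =
    \int[@leb R n.+1]_v (cos (u * dir (axpyT (-1) x y) v) * gaussT v) + \int[@leb R n.+1]_v (sin (u * dir (axpyT 1 x y) v) * gaussT v)).
    by rewrite integral_cos_dir integral_sin_dir addr0 norm_axpy /c !mulrA.
  rewrite -RintegralD//.
  - by apply: eq_Rintegral => v _; rewrite mulrDl.
  - apply: (@integrable_gaussT_bounded _ _ _ 1); first exact: measurable_cos_dir.
    by move=> v; rewrite ler_norml cos_geN1 cos_le1.
  - apply: (@integrable_gaussT_bounded _ _ _ 1); first exact: measurable_sin_dir.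
    by move=> v; rewrite ler_norml sin_geN1 sin_le1.
have mK : measurable_fun [set: measurableTypeR R] K.
  apply: (@measurableT_comp _ _ _ _ _ _ (@fine R)); first exact: fine_measurable.
  have mk' : measurable_fun setT (fun p : measurableTypeR R * n.+1.-tuple R => (k p * gaussT p.2)%:E).
    apply/measurable_EFinP; apply: measurable_funM => //.
    exact: (measurableT_comp (@measurable_gaussT R _) measurable_snd).
  have h := @measurable_integral_param R _ _ (measurableTypeR R) _ (@leb R n.+1) _ mk'.
  exact h.
(* A bound uniform in [u], so that the radial integral of [K] converges with the spectral measure
   and constants can be pulled out of it. *)
have KM u : `|K u| <= 2 * Num.sqrt pi ^+ n.+1.
  apply: le_trans (le_normr_Rintegral measurableT (ik u)) _.
  have -> : 2 * Num.sqrt pi ^+ n.+1 = \int[@leb R n.+1]_v (2 * gaussT v).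
    rewrite RintegralZl//; first by rewrite /Rintegral integral_gaussT.
    have i := @integrable_gaussT_bounded R n (cst 1) 1 (measurable_cst _).
    by apply: eq_integrable (i _) => // [v _|v]; rewrite /= ?mul1r ?normr1.
  apply: le_Rintegral => //.
  - exact: integrable_norm (ik u).
  - apply: (@integrable_gaussT_bounded R n (cst 2) 2 (measurable_cst _)) => v.
    by rewrite /= ger0_norm.
  move=> v _; rewrite normrM (ger0_norm (gaussT_ge0 _)).
  by apply: ler_wpM2r; [exact: gaussT_ge0|exact: bcs].
rewrite -RintegralZl//; last first.
  have i : mu.-integrable `[0, +oo[%classic (fun u => (u ^+ n * phi u * K u)%:E).
    have mI : measurable (`[0, +oo[%classic : set (measurableTypeR R)) by exact: measurable_itv.
    have i2 := integrableZr mI (2 * Num.sqrt pi ^+ n.+1) iphi.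
    apply: le_integrable i2 => //.
      apply/measurable_EFinP; apply: measurable_funM; last exact: measurable_funTS.
      by have /integrableP[/measurable_EFinP] := iphi.
    move=> u _; rewrite /= lee_fin !normrM; apply: ler_wpM2l => //.
    by rewrite -normrM (le_trans (KM u))// ler_norm.
  apply: eq_integrable (integrableZr _ (sphere_area n * c^-1) i) => // u _.
  rewrite -EFinM KE; congr EFin; rewrite -/(sphere_area n).
  move: (besselJ_div _ _) (u ^+ n) (phi u) (sphere_area n) => ? ? ? ?.
  by field.
apply: eq_Rintegral => u _.
rewrite -/(K u) KE /c -/(sphere_area n).
move: (besselJ_div _ _) (2 `^ _) (GammaR _) (u ^+ n) (phi u) (sphere_area n) (Num.sqrt pi ^+ n.+1) sp => *.
by field.
Qed.

End hartley.

(** * From the model to the field *)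

Section field.
Context {R : realType} d (T : measurableType d) (P : probability T R).
Variables (n : nat) (phi : R -> R) (xi : n.+1.-tuple R -> T -> R).
Local Notation mu := (@lebesgue_measure R).
Local Notation m2 := (lebX n.+1).
Hypothesis field : iso_gaussian_field P xi phi.
Hypothesis phi0 : forall u, 0 <= u -> 0 <= phi u.

Lemma field_density : mu.-integrable `[0, +oo[%classic (fun u => (u ^+ n * phi u)%:E).
Proof. by case: field => _ [_ [_ [_ []]]]. Qed.

Lemma measurable_field : measurable_fun setT (fun p : n.+1.-tuple R * T => xi p.1 p.2).
Proof. by case: field. Qed.

Lemma measurable_field_pt x : measurable_fun setT (xi x).
Proof. exact: (@measurable_sect _ _ _ _ _ _ (fun q => xi q.1 q.2) x measurable_field). Qed.

Lemma field_cov x y : (\int[P]_w (xi x w * xi y w)%:E = (spectral_cov n.+1 phi (dist_Rn x y))%:E)%E.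
Proof. by case: field => _ [_ [_ [_ [_ /(_ x y)]]]]; rewrite unlock. Qed.

Lemma L2_field x : L2 P (xi x).
Proof.
apply: L2_lty; first exact: measurable_field_pt.
under eq_integral do rewrite expr2.
by rewrite field_cov ltry.
Qed.

Lemma ip_field x y : ip P (xi x) (xi y) = spectral_cov n.+1 phi (dist_Rn x y).
Proof. by rewrite /ip /Rintegral field_cov. Qed.

Lemma field_mean x : \int[P]_w xi x w = 0.
Proof. by case: field => _ [_ [/(_ x) + _]]; rewrite unlock /Rintegral => ->. Qed.

Lemma dist_xx k (x : k.-tuple R) : dist_Rn x x = 0.
Proof. by rewrite /dist_Rn big1 ?sqrtr0// => i _; rewrite subrr expr0n. Qed.

Lemma Rintegral_sum_L2 I (s : seq I) (e : I -> T -> R) : (forall i, List.In i s -> L2 P (e i)) ->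
  \int[P]_w (\sum_(i <- s) e i w) = \sum_(i <- s) \int[P]_w e i w.
Proof.
move=> Le; have := ip_suml Le (L2_1 P); rewrite /ip.
under eq_Rintegral do rewrite mulr1.
by move=> ->; apply: eq_bigr => i _; under eq_Rintegral do rewrite mulr1.
Qed.

Lemma gaussian_family_like I (D : set I) (Y : I -> T -> R) (s : seq (R * I)) :
  gaussian_family P D Y -> (forall p, List.In p s -> D p.2) ->
  (forall i, D i -> L2 P (Y i)) -> (forall i, D i -> \int[P]_w Y i w = 0) ->
  gauss_like P (fun w => \sum_(p <- s) p.1 * Y p.2 w).
Proof.
move=> gf sD LY Y0; have [a [v nl]] := gf s sD.
have Ls p : List.In p s -> L2 P (fun w => p.1 * Y p.2 w).
  by move=> /sD/LY; exact: L2Z.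
apply: (normal_gauss_like nl).
  exact: (L2_sum Ls).
rewrite (Rintegral_sum_L2 Ls).
elim: s sD {gf nl Ls} => [|p s IH] sD; first by rewrite big_nil.
rewrite big_cons IH ?addr0; last by move=> q qs; apply: sD; right.
have Dp : D p.2 by apply: sD; left.
rewrite RintegralZl//; first by rewrite Y0// mulr0.
have L1 := L2_1 P.
by have i := L2_mul (LY _ Dp) L1; apply: eq_integrable i => // x _; rewrite mulr1.
Qed.

Lemma eq_big_In I (s : seq I) (F G : I -> R) : (forall i, List.In i s -> F i = G i) ->
  \sum_(i <- s) F i = \sum_(i <- s) G i.
Proof.
elim: s => [|i s IH] H; first by rewrite !big_nil.
by rewrite !big_cons IH ?H//; [left|move=> l ls; apply: H; right].
Qed.

Lemma ip_lincomb (d1 : measure_display) (T1 : measurableType d1) (m1 : {measure set T1 -> \bar R})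
  I (s : seq (R * I)) (e1 : I -> T1 -> R) : (forall p, List.In p s -> L2 m1 (e1 p.2)) ->
  ip m1 (fun t => \sum_(p <- s) p.1 * e1 p.2 t) (fun t => \sum_(p <- s) p.1 * e1 p.2 t) =
  \sum_(p <- s) \sum_(q <- s) p.1 * q.1 * ip m1 (e1 p.2) (e1 q.2).
Proof.
move=> Le; have Ls (p : R * I) : List.In p s -> L2 m1 (fun w => p.1 * e1 p.2 w) by move=> ps; apply: L2Z; exact: Le.
have LS : L2 m1 (fun t => \sum_(p <- s) p.1 * e1 p.2 t) by apply: (@L2_sum _ _ _ _ _ _ (fun p t => p.1 * e1 p.2 t)).
rewrite (@ip_suml _ _ _ _ _ _ (fun p t => p.1 * e1 p.2 t))//.
apply: eq_big_In => p ps; rewrite ipC (@ip_suml _ _ _ _ _ _ (fun p t => p.1 * e1 p.2 t))//; last exact: Ls.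
by apply: eq_big_In => q qs; rewrite ipZl ?ipZr 1?ipC; [ring|exact: Le..|exact: Ls].
Qed.

Variables (F : n.+1.-tuple R -> R) (Fh : R -> R).
Hypothesis iF : (@leb R n.+1).-integrable setT (EFin \o F).
Hypothesis HF : forall l, \int[@leb R n.+1]_x (F x * (cos (inner_Rn l x) + sin (inner_Rn l x))) = Fh (norm_Rn l).

Let e1 : n.+1.-tuple R := [tuple of 1 :: nseq n 0].
Let lam (u : R) := scaleT u e1.

Let norm_e1 : norm_Rn e1 = 1.
Proof.
rewrite /norm_Rn /inner_Rn big_ord_recl big1 ?addr0 ?mulr1 ?sqrtr1// => i _.
by rewrite (tnth_nth 0)/= nth_nseq ltn_ord mulr0.
Qed.

(** The transform along the ray spanned by [e1]. It is measurable in [u] as an integral with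
    parameter, and this is how measurability of [Fh] on the half-line is obtained. *)
Let FT u := \int[@leb R n.+1]_x (F x * (cos (inner_Rn (lam u) x) + sin (inner_Rn (lam u) x))).

Let FTE u : 0 <= u -> FT u = Fh u.
Proof. by move=> u0; rewrite /FT HF norm_scale norm_e1 mulr1 ger0_norm. Qed.

Let mF : measurable_fun setT F.
Proof. by have /integrableP[/measurable_EFinP] := iF. Qed.

Let mFT : measurable_fun [set: measurableTypeR R] FT.
Proof.
apply: (@measurableT_comp _ _ _ _ _ _ (@fine R)); first exact: fine_measurable.
have mk : measurable_fun setT (fun p : measurableTypeR R * n.+1.-tuple R => (F p.2 * (cos (inner_Rn (lam p.1) p.2) + sin (inner_Rn (lam p.1) p.2)))%:E).
  apply/measurable_EFinP; apply: measurable_funM; first exact: (measurableT_comp mF measurable_snd).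
  apply: measurable_cas.
  rewrite (_ : (fun p => _) = (fun p : measurableTypeR R * n.+1.-tuple R => p.1 * inner_Rn e1 p.2)); last first.
    by apply/funext => p; rewrite inner_scalel.
  apply: measurable_funM; first exact: measurable_fst.
  have h := @measurable_inner R _ _ n.+1 (fun _ : measurableTypeR R * n.+1.-tuple R => e1) (fun p => p.2) (measurable_cst _) measurable_snd.
  exact: h.
have h := @measurable_integral_param R _ _ (measurableTypeR R) _ (@leb R n.+1) _ mk.
exact h.
Qed.

Let i2 l : (@leb R n.+1).-integrable setT (fun x => (F x * (cos (inner_Rn l x) + sin (inner_Rn l x)))%:E).
Proof.
have mc : measurable_fun setT (fun x => cos (inner_Rn l x) + sin (inner_Rn l x)).
  apply: measurable_cas.
  exact: (@measurable_inner R _ _ n.+1 (fun _ => l) (fun p => p) (measurable_cst _) (@measurable_id _ _ setT)).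
have i1 : (@leb R n.+1).-integrable setT (fun x => (2 * `|F x|)%:E).
  by have i := integrableZl measurableT 2 (integrable_norm iF); apply: eq_integrable i.
apply: le_integrable i1 => //; first by apply/measurable_EFinP; exact: measurable_funM.
move=> x _; rewrite /= lee_fin normrM mulrC [leRHS]ger0_norm ?mulr_ge0//.
by apply: ler_wpM2r => //; exact: cas_le.
Qed.

Let bFT u : `|FT u| <= 2 * \int[@leb R n.+1]_x `|F x|.
Proof.
have b x : `|F x * (cos (inner_Rn (lam u) x) + sin (inner_Rn (lam u) x))| <= 2 * `|F x|.
  by rewrite normrM mulrC; apply: ler_wpM2r => //; exact: cas_le.
have i1 : (@leb R n.+1).-integrable setT (fun x => (2 * `|F x|)%:E).
  by have i := integrableZl measurableT 2 (integrable_norm iF); apply: eq_integrable i.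
apply: le_trans (le_normr_Rintegral measurableT (i2 (lam u))) _.
rewrite -RintegralZl//; last exact: integrable_norm iF.
by apply: le_Rintegral => //; exact: integrable_norm (i2 (lam u)).
Qed.

(** At [(u, y)] the model integrates [F] against the wave of frequency [(u / |y|) y], whose length
    is [u]; as the transform of [F] is radial, the direction disappears. The point [y = 0] is
    negligible, and negative radii have zero density. *)
Let superp_hartley : {ae m2, forall p, superp (@leb R n.+1) (hartley phi) F p =
  Num.sqrt (radial_density n phi p.1) * Num.sqrt (gaussT p.2) * FT p.1}.
Proof.
apply: (@negligibleS _ _ _ _ (setT `*` [set y : n.+1.-tuple R | norm_Rn y = 0])); last first.
  have [N [mN N0 sN]] := @norm0_null R n.
  exists (setT `*` N); split; first exact: measurableX.
    have E := @product_measure1E _ _ _ _ R mu (@leb R n.+1) setT N measurableT mN.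
    exact: etrans E (etrans (congr1 (mule _) N0) (mule0 _)).
  by move=> p [_ ?]; split => //; exact: sN.
move=> [u y] /= h; split => //=; apply: contrapT => y0; apply: h.
have [u0|u0] := leP 0 u; last first.
  rewrite /radial_density leNgt u0/= mulr0 sqrtr0 !mul0r /superp /hartley.
  under eq_Rintegral do rewrite /= /radial_density leNgt u0/= mulr0 sqrtr0 !mul0r mulr0.
  by rewrite /Rintegral integral0.
rewrite FTE// /superp.
have -> : Fh u = Fh (norm_Rn (scaleT (u / norm_Rn y) y)).
  rewrite norm_scale normrM normfV !ger0_norm ?norm_ge0// divfK//; exact/eqP.
rewrite -HF -RintegralZl//.
- apply: eq_Rintegral => x _; rewrite inner_scalel innerC.
  by rewrite /hartley/= /dir innerC -!mulrA [_^-1 * _]mulrC; ring.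
apply: i2 (scaleT (u / norm_Rn y) y).
Qed.

Lemma field_superp : gauss_like P (superp (@leb R n.+1) xi F) /\
  ip P (superp (@leb R n.+1) xi F) (superp (@leb R n.+1) xi F) =
  sphere_area n * \int[mu]_(u in `[0, +oo[%classic) (u ^+ n * phi u * Fh u ^+ 2).
Proof.
pose K := spectral_cov n.+1 phi 0.
have iphi := field_density.
have K1 x : ip P (xi x) (xi x) <= K by rewrite ip_field dist_xx.
have K2 x : ip m2 (hartley phi x) (hartley phi x) <= K by rewrite (ip_hartley iphi phi0) dist_xx.
have Lh := L2_hartley iphi phi0.
have mh := measurable_hartley iphi.
have [s [c1 c2]] := @greedy_cvg _ _ _ T _ (measurableTypeR R * n.+1.-tuple R)%type R (@leb R n.+1) P m2 _ _ _ _ e1 measurable_field mh iF L2_field K1 Lh K2.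
have L1 := L2_superp measurable_field iF L2_field K1.
have L2' := L2_superp mh iF Lh K2.
have LS d' (T' : measurableType d') (m' : {measure set T' -> \bar R}) (e' : n.+1.-tuple R -> T' -> R) (r : seq (R * n.+1.-tuple R)) :
    (forall x, L2 m' (e' x)) -> L2 m' (fun t => \sum_(p <- r) p.1 * e' p.2 t).
  by move=> H; apply: (@L2_sum _ _ _ _ _ _ (fun p t => p.1 * e' p.2 t)) => p _; exact: L2Z.
split.
  apply: (gauss_like_lim _ L1 c1) => k.
  case: field => _ [gf _].
  apply: (gaussian_family_like gf) => // x _; [exact: L2_field|exact: field_mean].
have {}c1 := ip_cvg (fun k => LS _ _ _ _ (s k) L2_field) L1 c1.
have {}c2 := ip_cvg (fun k => LS _ _ _ _ (s k) Lh) L2' c2.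
(* Both Gram matrices equal [spectral_cov], so the two sequences of squared norms coincide term by
   term and have one limit. *)
have E : ip P (superp (@leb R n.+1) xi F) (superp (@leb R n.+1) xi F) =
    ip m2 (superp (@leb R n.+1) (hartley phi) F) (superp (@leb R n.+1) (hartley phi) F).
  suff EE : (fun k => ip P (fun t => \sum_(p <- s k) p.1 * xi p.2 t) (fun t => \sum_(p <- s k) p.1 * xi p.2 t)) =
      (fun k => ip m2 (fun t => \sum_(p <- s k) p.1 * hartley phi p.2 t) (fun t => \sum_(p <- s k) p.1 * hartley phi p.2 t)).
    by rewrite EE in c1; exact: (cvg_unique _ c1 c2).
  apply/funext => k; rewrite ip_lincomb => [|p _]; last exact: L2_field.
  rewrite ip_lincomb => [|p _]; last exact: Lh.
  by apply: eq_bigr => p _; apply: eq_bigr => q _; rewrite ip_field ip_hartley.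
rewrite {}E.
have mFT2 : measurable_fun setT (fun p : measurableTypeR R * n.+1.-tuple R => FT p.1 ^+ 2).
  by apply: measurable_funX; exact: (measurableT_comp mFT measurable_fst).
have bFT2 (p : measurableTypeR R * n.+1.-tuple R) : `|FT p.1 ^+ 2| <= (2 * \int[@leb R n.+1]_x `|F x|) ^+ 2.
  by rewrite normrX; apply: lerXn2r; rewrite ?nnegrE// (le_trans _ (bFT p.1)).
have [i E] := prod_gaussT (integrable_radial_density iphi) mFT2 bFT2.
rewrite /ip (_ : \int[m2]_p _ = \int[m2]_p (radial_density n phi p.1 * (FT p.1 ^+ 2 * gaussT p.2))); last first.
  congr fine; apply: ae_eq_integral => //.
  - by apply/measurable_EFinP; apply: measurable_funM; exact: L2_meas L2'.
  - by have /integrableP[] := i.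
  apply: filterS superp_hartley => p -> _; congr EFin.
  by rewrite -[in RHS](sqr_sqrtr (radial_density_ge0 n phi0 p.1)) -[in RHS](sqr_sqrtr (gaussT_ge0 p.2)); ring.
rewrite E Rintegral_radial_density -RintegralZl//; last first.
  have mI : measurable (`[0, +oo[%classic : set (measurableTypeR R)) by exact: measurable_itv.
  have i3 := integrableZr mI ((2 * \int[@leb R n.+1]_x `|F x|) ^+ 2) iphi.
  apply: le_integrable i3 => //.
    apply/measurable_EFinP; apply: measurable_funM; first by have /integrableP[/measurable_EFinP] := iphi.
    apply: (@eq_measurable_fun _ _ _ _ _ (fun u => FT u ^+ 2)).
      by move=> u; rewrite inE/= in_itv/= andbT => u0; rewrite FTE.
    by apply: measurable_funTS; exact: measurable_funX.
  move=> u; rewrite /= in_itv/= andbT => u0; rewrite lee_fin normrM [leRHS]normrM -FTE//.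
  by apply: ler_wpM2l => //; apply: le_trans (bFT2 (u, e1)) _; exact: ler_norm.
apply: eq_Rintegral => u; rewrite inE/= in_itv/= andbT => u0.
rewrite RintegralZl//=; last first.
  have i1 := @integrable_gaussT_bounded R n (cst 1) 1 (measurable_cst _).
  by apply: eq_integrable (i1 _) => // [v _|v]; rewrite /= ?mul1r ?normr1.
rewrite FTE// {1}/Rintegral integral_gaussT/=.
have sp : Num.sqrt pi ^+ n.+1 != 0 :> R by rewrite expf_neq0// gt_eqF// sqrtr_gt0 pi_gt0.
move: (Fh u) (phi u) (u ^+ n) (Num.sqrt pi ^+ n.+1) sp (sphere_area n) => *.
by field.
Qed.

End field.

(** * Asymptotics of the variance *)

Section one_sided.
Context {R : realType}.
Local Notation mu := (@lebesgue_measure R).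
Variables (alpha C s0 L : R) (n : nat) (q G : R -> R) (r : nat -> R).
Hypotheses (an : alpha < n.+1%:R) (C0 : 0 <= C)
  (mq : measurable_fun setT q) (q0 : forall w, 0 <= q w) (iq : mu.-integrable setT (EFin \o q))
  (mG : measurable_fun setT G) (G0 : forall v, 0 <= G v)
  (iG : mu.-integrable setT (fun v => (if 0 < v then v `^ (alpha - 1) * G v else 0)%:E))
  (GC : forall v, s0 <= v -> 0 < v -> G v <= C * v ^- n.+1)
  (qL : forall e, 0 < e -> exists2 eta, 0 < eta & forall w, 0 < w < eta -> `|q w * w `^ (1 - alpha) - L| <= e)
  (r0 : forall k, 0 < r k) (roo : r k @[k --> \oo] --> +oo).

Lemma powR_rescale (v s : R) : 0 < v -> 0 < s ->
  v `^ (alpha - 1) * (v / s) `^ (1 - alpha) = s `^ alpha / s.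
Proof.
move=> v0 s0'; rewrite powRM ?invr_ge0 ?(ltW v0) ?(ltW s0')// mulrA -powRD; last by rewrite (gt_eqF v0) implybT.
rewrite (_ : alpha - 1 + (1 - alpha) = 0); last by ring.
rewrite powRr0 mul1r -powR_inv1 ?(ltW s0')// -powRrM -powRD; last by rewrite (gt_eqF s0') implybT.
by congr (_ `^ _); ring.
Qed.

Lemma cvg_powR_neg (p : R) : 0 < p -> r k `^ (- p) @[k --> \oo] --> (0 : R).
Proof.
move=> p0; apply/cvgrPdist_le => e e0.
have /cvgryPge/(_ (e^-1 `^ p^-1)) := roo; apply: filterS => k rk.
rewrite sub0r normrN ger0_norm ?powR_ge0// powRN -[leRHS]invrK lef_pV2 ?posrE ?powR_gt0 ?invr_gt0//.
apply: (@le_trans _ _ ((e^-1 `^ p^-1) `^ p)).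
  by rewrite -powRrM mulVf ?gt_eqF// powRr1// invr_ge0 ltW.
by apply: ge0_ler_powR; rewrite ?nnegrE ?powR_ge0 ?(ltW p0) ?(ltW (r0 k)).
Qed.

Lemma measurable_fun_if_pos (f : R -> R) : measurable_fun [set: R] f ->
  measurable_fun [set: R] (fun v => if 0 < v then f v else 0).
Proof.
move=> mf; apply: measurable_fun_ifT => //.
by apply: measurable_fun_ltr => //; exact: measurable_id.
Qed.

Lemma measurable_fun_if_lt (d : R) (f : R -> R) : measurable_fun [set: R] f ->
  measurable_fun [set: R] (fun v => if v < d then f v else 0).
Proof.
move=> mf; apply: measurable_fun_ifT => //.
by apply: measurable_fun_ltr => //; exact: measurable_id.
Qed.

(** The half-line is cut at a fixed [de]. Below it, rescaling by [r] gives an integrand dominated by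
    a multiple of [v^(alpha - 1) G v]. Above it [q] is only integrable, and the decay of [G]
    contributes [r^(alpha - n - 1)], which vanishes as [alpha < n + 1]. *)
Lemma one_sided :
  r k `^ alpha * \int[mu]_w (if 0 < w then q w * G (r k * w) else 0) @[k --> \oo] -->
  L * \int[mu]_v (if 0 < v then v `^ (alpha - 1) * G v else 0).
Proof.
(* Tolerance 1 is enough here: it makes [q w * w^(1 - alpha)] at most [|L| + 1] below [de]. *)
have [de de0 qde] := qL ltr01.
pose p w := if w < de then q w * w `^ (1 - alpha) else 0.
have mGr k : measurable_fun [set: measurableTypeR R] (fun w : measurableTypeR R => G (r k * w)).
  apply: (measurableT_comp mG); exact: measurable_funM.
have mp : measurable_fun [set: measurableTypeR R] p.
  apply: measurable_fun_if_lt; apply: measurable_funM => //; exact: measurable_powR.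
have pb w : 0 < w -> 0 <= p w <= `|L| + 1.
  move=> w0; rewrite /p; case: ifPn => wd; last by rewrite lexx addr_ge0.
  rewrite mulr_ge0 ?powR_ge0//=; have := qde w; rewrite w0 wd => /(_ isT).
  have := ler_norm L; have := ler_norm (q w * w `^ (1 - alpha) - L); lra.
have p_L v : 0 < v -> p (v / r k) @[k --> \oo] --> L.
  move=> v0; apply/cvgrPdist_le => e e0; have [eta eta0 qe] := qL e0.
  have /cvgryPgt/(_ (v / Num.min de eta)) := roo; apply: filterS => k rk.
  have m0 : 0 < Num.min de eta by rewrite lt_min de0.
  move: rk; rewrite ltr_pdivrMr// mulrC -ltr_pdivrMr// lt_min => /andP[h1 h2].
  by rewrite /p h1 distrC qe// divr_gt0.
pose hA k v := if 0 < v then v `^ (alpha - 1) * G v * p (v / r k) else 0.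
have mhA k : measurable_fun [set: measurableTypeR R] (hA k).
  apply: measurable_fun_if_pos; apply: measurable_funM.
    by apply: measurable_funM => //; exact: measurable_powR.
  apply: (measurableT_comp mp); exact: measurable_funM.
have hA0 k v : 0 <= hA k v.
  rewrite /hA; case: ifP => // v0; rewrite mulr_ge0 ?mulr_ge0 ?powR_ge0//.
  by have /andP[] := pb (v / r k) (divr_gt0 v0 (r0 k)).
pose g v := (`|L| + 1) * (if 0 < v then v `^ (alpha - 1) * G v else 0).
have ig : mu.-integrable setT (EFin \o g).
  have i := integrableZl measurableT (`|L| + 1) iG.
  by apply: eq_integrable i.
have hAg k v : `|hA k v| <= g v.
  rewrite ger0_norm// /hA /g; case: ifP => v0; last by rewrite mulr0.
  rewrite mulrC; apply: ler_wpM2r; first by rewrite mulr_ge0 ?powR_ge0.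
  by have /andP[] := pb (v / r k) (divr_gt0 v0 (r0 k)).
have ihA k : mu.-integrable setT (EFin \o hA k).
  apply: le_integrable ig => //; first exact/measurable_EFinP.
  by move=> v _; rewrite /= lee_fin (le_trans (hAg k v))// ler_norm.
have cA : \int[mu]_v hA k v @[k --> \oo] --> L * \int[mu]_v (if 0 < v then v `^ (alpha - 1) * G v else 0).
  rewrite -RintegralZl//.
  apply: (@Rintegral_dominated_cvg _ _ R mu setT hA _ g) => //.
  - apply: measurable_funM => //; apply: measurable_fun_if_pos; apply: measurable_funM => //.
  - move=> v _; rewrite /hA; case: ifP => v0; last by rewrite mulr0; exact: cvg_cst.
    by rewrite [X in _ --> X]mulrC; apply: cvgMr; exact: p_L.
(* The parts below and above the cut [de]. *)
pose fA k w := if 0 < w then (if w < de then q w * G (r k * w) else 0) else 0.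
pose fB k w := if 0 < w then (if w < de then 0 else q w * G (r k * w)) else 0.
have mqG k : measurable_fun [set: measurableTypeR R] (fun w : measurableTypeR R => q w * G (r k * w)) by exact: measurable_funM.
have mfA k : measurable_fun [set: measurableTypeR R] (fA k).
  apply: measurable_fun_if_pos; apply: measurable_fun_if_lt; exact: (mqG k).
have mfB k : measurable_fun [set: measurableTypeR R] (fB k).
  apply: measurable_fun_if_pos; apply: measurable_fun_ifT => //.
    by apply: measurable_fun_ltr => //; exact: measurable_id.
  exact: (mqG k).
have fA0 k w : 0 <= fA k w by rewrite /fA; case: ifP => // _; case: ifP => // _; rewrite mulr_ge0.
have fB0 k w : 0 <= fB k w by rewrite /fB; case: ifP => // _; case: ifP => // _; rewrite mulr_ge0.
have hAE k v : hA k v = r k `^ alpha / r k * fA k ((r k)^-1 * v + 0).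
  rewrite addr0 /hA /fA pmulr_rgt0 ?invr_gt0//; case: ifP => v0; last by rewrite mulr0.
  rewrite /p mulrC [_^-1 * v]mulrC; case: ifP => vd; last by rewrite !(mulr0, mul0r).
  have -> : r k * (v / r k) = v by rewrite mulrCA divff ?mulr1// gt_eqF.
  by rewrite -(powR_rescale v0 (r0 k)); ring.
have rA k : (\int[mu]_v (hA k v)%:E = (r k `^ alpha)%:E * \int[mu]_v (fA k v)%:E)%E.
  have rk0 : (r k)^-1 != 0 by rewrite invr_eq0 gt_eqF.
  have mf : measurable_fun [set: measurableTypeR R] (EFin \o fA k) by exact/measurable_EFinP.
  have := @ge0_integral_affine R (r k)^-1 0 (EFin \o fA k) rk0 mf (fun w => fA0 k w).
  rewrite ger0_norm ?invr_ge0 ?(ltW (r0 k))// => <-.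
  have mf' : measurable_fun [set: measurableTypeR R] (fun v : measurableTypeR R => (fA k ((r k)^-1 * v + 0))%:E).
    apply/measurable_EFinP; apply: (measurableT_comp (mfA k)); apply: measurable_funD => //.
  rewrite muleA -EFinM -ge0_integralZl//.
  - by apply: eq_integral => v _; rewrite hAE.
  - by move=> v _; rewrite lee_fin.
  - by rewrite lee_fin mulr_ge0 ?powR_ge0// invr_ge0 ltW.
(* Integrability is pulled back through the rescaling: an infinite integral would stay infinite
   after multiplication by [r^alpha]. *)
have ifA k : mu.-integrable setT (EFin \o fA k).
  apply/integrableP; split; first exact/measurable_EFinP.
  have rp : 0 < r k `^ alpha by rewrite powR_gt0.
  have : ((r k `^ alpha)%:E * \int[mu]_v (fA k v)%:E < +oo)%E.
    by rewrite -rA ltey_eq (integrable_fin_num measurableT (ihA k)).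
  rewrite (_ : (\int[mu]_x _)%E = (\int[mu]_v (fA k v)%:E)%E); last first.
    by apply: eq_integral => v _; rewrite gee0_abs// lee_fin.
  by rewrite !ltey; apply: contraNN => /eqP ->; rewrite gt0_muley ?lte_fin.
have {}rA k : r k `^ alpha * \int[mu]_v fA k v = \int[mu]_v hA k v.
  by rewrite /Rintegral rA fineM//; exact: integrable_fin_num (ifA k).
(* Beyond the cut [r w >= r de], where the decay of [G] applies as soon as [r de >= s0]. *)
have bB k w : s0 <= r k * de -> fB k w <= C * (r k * de) ^- n.+1 * q w.
  move=> sr; rewrite /fB; have Cq : 0 <= C * (r k * de) ^- n.+1 * q w.
    by rewrite mulr_ge0// mulr_ge0// invr_ge0 exprn_ge0// mulr_ge0 ?(ltW (r0 k)) ?ltW.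
  case: ifP => // w0; case: ltP => // dw.
  rewrite mulrC; apply: ler_wpM2r => //.
  have rw : r k * de <= r k * w by rewrite ler_pM2l.
  apply: le_trans (GC (le_trans sr rw) (mulr_gt0 (r0 k) w0)) _.
  apply: ler_wpM2l => //; rewrite lef_pV2 ?posrE ?exprn_gt0 ?mulr_gt0//.
  by apply: lerXn2r; rewrite ?nnegrE ?mulr_ge0 ?(ltW (r0 k)) ?(ltW de0) ?(ltW w0).
have iB' k : mu.-integrable setT (EFin \o (fun w => C * (r k * de) ^- n.+1 * q w)).
  by have i := integrableZl measurableT (C * (r k * de) ^- n.+1) iq; apply: eq_integrable i.
have ifB k : s0 <= r k * de -> mu.-integrable setT (EFin \o fB k).
  move=> sr; apply: le_integrable (iB' k) => //; first exact/measurable_EFinP.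
  by move=> w _; rewrite /= lee_fin ger0_norm// (le_trans (bB k w sr))// ler_norm.
have sr : \forall k \near \oo, s0 <= r k * de.
  have /cvgryPge/(_ (s0 / de)) := roo; apply: filterS => k.
  by rewrite ler_pdivrMr.
have cB : r k `^ alpha * \int[mu]_w fB k w @[k --> \oo] --> 0.
  pose K := C * de ^- n.+1 * \int[mu]_w q w.
  have c0 : K * r k `^ (- (n.+1%:R - alpha)) @[k --> \oo] --> 0.
    by rewrite -[X in _ --> X](mulr0 K); apply: cvgMr; apply: cvg_powR_neg; rewrite subr_gt0.
  apply: (squeeze_cvgr _ (cvg_cst 0) c0); apply: filterS sr => k sr.
  rewrite mulr_ge0 ?powR_ge0//=; last by apply: Rintegral_ge0.
  have : \int[mu]_w fB k w <= C * (r k * de) ^- n.+1 * \int[mu]_w q w.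
    rewrite -RintegralZl//; apply: le_Rintegral => //; first exact: ifB.
    by move=> w _; exact: bB.
  move=> h; apply: (@le_trans _ _ (r k `^ alpha * (C * (r k * de) ^- n.+1 * \int[mu]_w q w))).
    by apply: ler_wpM2l => //; exact: powR_ge0.
  rewrite opprB powRD; last by rewrite (gt_eqF (r0 k)) implybT.
  rewrite powRN powR_mulrn ?(ltW (r0 k))// exprMn invfM /K le_eqVlt; apply/orP; left; apply/eqP.
  ring.
have E : \forall k \near \oo, \int[mu]_v hA k v + r k `^ alpha * \int[mu]_v fB k v =
    r k `^ alpha * \int[mu]_w (if 0 < w then q w * G (r k * w) else 0).
  apply: filterS sr => k sr; rewrite -rA -mulrDr -RintegralD//; last exact: ifB.
  congr (_ * _); apply: eq_Rintegral => w _; rewrite /fA /fB.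
  by case: ifP => _; [case: ifP => _|]; rewrite ?addr0 ?add0r.
by rewrite -[X in _ --> X]addr0; apply: cvg_trans (cvgD cA cB); exact: near_eq_cvg E.
Qed.

End one_sided.

Section fold.
Context {R : realType}.
Local Notation mu := (@lebesgue_measure R).

Lemma integral_fold (H : R -> R) : measurable_fun [set: R] H -> (forall w, 0 <= H w) ->
  \int[mu]_w H w = \int[mu]_w (if 0 < w then H w + H (- w) else 0).
Proof.
move=> mH H0.
pose H1 w := if 0 < w then H w else 0.
pose H2 w := if 0 < w then H (- w) else 0.
have mN : measurable_fun [set: R] (fun w => H (- w)).
  by apply: (measurableT_comp mH); exact: oppr_measurable.
have m1 : measurable_fun [set: measurableTypeR R] H1 by exact: measurable_fun_if_pos.
have mm2 : measurable_fun [set: measurableTypeR R] H2 by exact: measurable_fun_if_pos.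
have H10 w : 0 <= H1 w by rewrite /H1; case: ifP.
have H20 w : 0 <= H2 w by rewrite /H2; case: ifP.
have m2' : measurable_fun [set: measurableTypeR R] (fun w : measurableTypeR R => H2 (- w)).
  by apply: (measurableT_comp mm2); exact: oppr_measurable.
have E2 : (\int[mu]_w (H2 (- w))%:E = \int[mu]_w (H2 w)%:E)%E.
  have n0 : -1 != 0 :> R by rewrite oppr_eq0 oner_eq0.
  have mf : measurable_fun [set: measurableTypeR R] (EFin \o H2) by exact/measurable_EFinP.
  have := @ge0_integral_affine R (-1) 0 (EFin \o H2) n0 mf (fun w => H20 w).
  rewrite normrN1 mul1e => <-.
  by apply: eq_integral => w _; rewrite /= mulN1r addr0.
congr fine.
transitivity (\int[mu]_w ((H1 w)%:E + (H2 (- w))%:E))%E.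
  apply: ae_eq_integral => //.
  - exact/measurable_EFinP.
  - by apply: emeasurable_funD; exact/measurable_EFinP.
  exists [set 0]; split; first exact: measurable_set1.
    exact: lebesgue_measure_set1.
  move=> w /= h; apply: contrapT => w0; apply: h => _.
  rewrite /H1 /H2 oppr_gt0 opprK; have [wp|wn|we] := ltgtP w 0; last by exfalso; apply: w0.
    by rewrite add0e.
  by rewrite adde0.
rewrite ge0_integralD//; try by [move=> w _; rewrite lee_fin|exact/measurable_EFinP].
rewrite E2 -ge0_integralD//; try by [move=> w _; rewrite lee_fin|exact/measurable_EFinP].
apply: eq_integral => w _; rewrite /H1 /H2 -EFinD; case: ifP => // _.
by rewrite addr0.
Qed.

Lemma integral_shift (b : R) (H : R -> R) : measurable_fun [set: R] H -> (forall w, 0 <= H w) ->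
  (\int[mu]_w (H w)%:E = \int[mu]_w (H (b + w))%:E)%E.
Proof.
move=> mH H0.
have mf : measurable_fun [set: measurableTypeR R] (EFin \o H) by exact/measurable_EFinP.
have := @ge0_integral_affine R 1 b (EFin \o H) (oner_neq0 _) mf (fun w => H0 w).
rewrite normr1 mul1e => <-.
by apply: eq_integral => w _; rewrite /= mul1r addrC.
Qed.

Lemma integral_opp (H : R -> R) : measurable_fun [set: R] H -> (forall w, 0 <= H w) ->
  (\int[mu]_w (H w)%:E = \int[mu]_w (H (- w))%:E)%E.
Proof.
move=> mH H0.
have mf : measurable_fun [set: measurableTypeR R] (EFin \o H) by exact/measurable_EFinP.
have n0 : -1 != 0 :> R by rewrite oppr_eq0 oner_eq0.
have := @ge0_integral_affine R (-1) 0 (EFin \o H) n0 mf (fun w => H0 w).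
rewrite normrN1 mul1e => <-.
by apply: eq_integral => w _; rewrite /= mulN1r addr0.
Qed.

Lemma integrable_ge0_eq (H1 H2 : R -> R) : measurable_fun [set: R] H2 -> (forall w, 0 <= H1 w) -> (forall w, 0 <= H2 w) ->
  (\int[mu]_w (H1 w)%:E = \int[mu]_w (H2 w)%:E)%E -> mu.-integrable setT (EFin \o H1) -> mu.-integrable setT (EFin \o H2).
Proof.
move=> mH2 H10 H20 E /integrableP[_ foo]; apply/integrableP; split; first exact/measurable_EFinP.
have E' (H : R -> R) : (forall w, 0 <= H w) -> (\int[mu]_w `|(EFin \o H) w| = \int[mu]_w (H w)%:E)%E.
  by move=> h0; apply: eq_integral => w _; rewrite gee0_abs// lee_fin.
by rewrite E'// -E -E'.
Qed.

Section two_sided.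
Variables (alpha C s0 L a : R) (n : nat) (q G : R -> R) (r : nat -> R).
Hypotheses (an : alpha < n.+1%:R) (C0 : 0 <= C)
  (mq : measurable_fun [set: R] q) (q0 : forall w, 0 <= q w) (iq : mu.-integrable setT (EFin \o q))
  (mG : measurable_fun [set: R] G) (G0 : forall v, 0 <= G v) (Geven : forall v, G (- v) = G v)
  (iG : mu.-integrable setT (fun v => (if 0 < v then v `^ (alpha - 1) * G v else 0)%:E))
  (GC : forall v, s0 <= v -> 0 < v -> G v <= C * v ^- n.+1)
  (qL : (q (a + w) + q (a - w)) * w `^ (1 - alpha) @[w --> 0^'+] --> L)
  (r0 : forall k, 0 < r k) (roo : r k @[k --> \oo] --> +oo).

(** Folding the line at [a] and using that [G] is even reduces to [one_sided] for the sum
    [q (a + w) + q (a - w)], so only this sum needs a limit. *)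
Lemma two_sided :
  r k `^ alpha * \int[mu]_u (q u * G (r k * (u - a))) @[k --> \oo] -->
  L * \int[mu]_v (if 0 < v then v `^ (alpha - 1) * G v else 0).
Proof.
have mq1 : measurable_fun [set: R] (fun w => q (a + w)).
  by apply: (measurableT_comp mq); exact: measurable_funD.
have mq2 : measurable_fun [set: R] (fun w => q (a - w)).
  by apply: (measurableT_comp mq); apply: measurable_funB.
have iq1 : mu.-integrable setT (EFin \o (fun w => q (a + w))).
  by apply: (integrable_ge0_eq mq1 q0 _ _ iq) => //; exact: integral_shift.
have iq2 : mu.-integrable setT (EFin \o (fun w => q (a - w))).
  apply: (integrable_ge0_eq mq2 _ _ _ iq1) => //.
  exact: (@integral_opp (fun w => q (a + w))).
have mq' : measurable_fun [set: R] (fun w => q (a + w) + q (a - w)) by exact: measurable_funD.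
have iq' : mu.-integrable setT (EFin \o (fun w => q (a + w) + q (a - w))).
  have i := integrableD measurableT iq1 iq2; exact: eq_integrable i.
have q0' w : 0 <= q (a + w) + q (a - w) by rewrite addr_ge0.
have qL' e : 0 < e -> exists2 eta, 0 < eta & forall w, 0 < w < eta ->
    `|(q (a + w) + q (a - w)) * w `^ (1 - alpha) - L| <= e.
  move=> e0; move/cvgrPdist_le : qL => /(_ e e0); rewrite near_withinE => /nbhs_ballP[eta eta0 h].
  exists eta => // w /andP[w0 we]; rewrite distrC; apply: h => //.
  by rewrite /ball/= sub0r normrN gtr0_norm.
have := one_sided an C0 mq' q0' iq' mG G0 iG GC qL' r0 roo.
apply: cvg_trans; apply: near_eq_cvg; apply: nearW => k; congr (_ * _).
have mH : measurable_fun [set: R] (fun u => q u * G (r k * (u - a))).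
  apply: measurable_funM => //; apply: (measurableT_comp mG).
  by apply: measurable_funM => //; exact: measurable_funB.
have mH' : measurable_fun [set: R] (fun w => q (a + w) * G (r k * w)).
  by apply: measurable_funM => //; apply: (measurableT_comp mG); exact: measurable_funM.
rewrite [RHS](_ : _ = \int[mu]_w (q (a + w) * G (r k * w))); last first.
  congr fine; rewrite (@integral_shift a) => [|//|w]; last by rewrite mulr_ge0.
  by apply: eq_integral => w _; rewrite [a + w - a]addrAC subrr add0r.
rewrite (integral_fold mH'); last by move=> w; rewrite mulr_ge0.
by apply: eq_Rintegral => w _; case: ifP => // _; rewrite mulrN Geven mulrDl.
Qed.
End two_sided.
End fold.

(** * Local behaviour of the spectral density *)

Section density.
Context {R : realType}.
Variables (n k : nat) (a alpha : nat -> R) (h : nat -> R -> R) (j : nat).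
Hypotheses (a0 : a 0%N = 0) (aS : forall i, (i < k)%N -> a i < a i.+1)
  (alpha0 : 0 < alpha 0%N < n.+1%:R)
  (alphaS : forall i, (1 <= i <= k)%N -> 0 < alpha i < 1)
  (hb : forall i, (i <= k)%N -> exists M : R, forall x, - a i <= x -> 0 <= h i x <= M)
  (hc : exists2 delta : R, 0 < delta &
     {within `[- a j, +oo[%classic `&` `]- delta, delta[%classic, continuous h j})
  (jk : (j <= k)%N).

(** Puts the singular term at the origin, of exponent [n + 1 - alpha_0], on the same footing as
    those on spheres. *)
Let beta i : R := (if i == 0%N then n.+1%:R else 1) - alpha i.
Let term i u := h i (u - a i) / `|u - a i| `^ beta i.

Let a_lt i l : (i < l)%N -> (l <= k)%N -> a i < a l.
Proof.
elim: l => // l IH; rewrite ltnS leq_eqVlt => /predU1P[->|il] lk; first exact: aS.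
by apply: lt_trans (aS lk); apply: IH => //; exact: ltnW.
Qed.

Let a_ge0 i : (i <= k)%N -> 0 <= a i.
Proof. by case: i => [|i] ik; [rewrite a0|rewrite -a0 ltW//; exact: a_lt]. Qed.

Let a_neq i : (i <= k)%N -> i != j -> a i != a j.
Proof.
move=> ik ij; have [lt|lt|e] := ltngtP i j; last by rewrite e eqxx in ij.
  by rewrite lt_eqF// a_lt.
by rewrite gt_eqF// a_lt.
Qed.

Let beta_gt0 i : (i <= k)%N -> 0 < beta i.
Proof.
case: i => [|i] ik; rewrite /beta/= subr_gt0; first by have /andP[] := alpha0.
by have /andP[] := @alphaS i.+1 ik.
Qed.

Lemma spec_density_terms u : 0 <= u -> spec_density n.+1 k a alpha h u = \sum_(0 <= i < k.+1) term i u.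
Proof.
move=> u0; rewrite /spec_density [RHS]big_nat_recl//; congr (_ + _).
  by rewrite /term a0 subr0 ger0_norm.
by rewrite [LHS]big_add1; apply: eq_big_nat => i _.
Qed.

Lemma term_ge0 i u : (i <= k)%N -> 0 <= u -> 0 <= term i u.
Proof.
move=> ik u0; rewrite mulr_ge0 ?invr_ge0 ?powR_ge0//.
have [M /(_ (u - a i))] := hb ik; rewrite lerBrDr addrC subrr => /(_ u0).
by case/andP.
Qed.

Lemma spec_density_ge0 u : 0 <= u -> 0 <= spec_density n.+1 k a alpha h u.
Proof.
move=> u0; rewrite spec_density_terms// big_nat; apply: sumr_ge0 => i /andP[_ ik].
exact: term_ge0.
Qed.

(** The other singularities sit at a positive distance from [a j], so their terms stay bounded near
    it. *)
Let rest_bounded (s : seq nat) : {in s, forall i, (i <= k)%N && (i != j)} ->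
  exists eta B, [/\ 0 < eta, 0 <= B & forall u, 0 <= u -> `|u - a j| < eta ->
     0 <= \sum_(i <- s) term i u <= B].
Proof.
elim: s => [|i s IH] sP.
  by exists 1, 0; split => // u _ _; rewrite big_nil lexx.
have [|eta [B [eta0 B0 H]]] := IH; first by move=> l ls; apply: sP; rewrite inE ls orbT.
have /andP[ik ij] : (i <= k)%N && (i != j) by apply: sP; rewrite inE eqxx.
(* Half the distance between the two singularities: staying within [c] of [a j] keeps [u] at least
   [c] away from [a i]. *)
have [c cE c0] : exists2 c, `|a i - a j| = c + c & 0 < c.
  by exists (`|a i - a j| / 2); [exact: splitr|rewrite divr_gt0// normr_gt0 subr_eq0 a_neq].
have [M hM] := hb ik.
have M0 : 0 <= M.
  by have /andP[] := hM (- a i) (lexx _); exact: le_trans.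
exists (Num.min eta c), (M / c `^ beta i + B); split.
- by rewrite lt_min eta0.
- by rewrite addr_ge0// mulr_ge0// invr_ge0 powR_ge0.
move=> u u0; rewrite lt_min => /andP[ue uc]; rewrite big_cons.
have /andP[h1 h2] := H u u0 ue; rewrite addr_ge0 ?term_ge0//=.
apply: lerD => //; rewrite /term; have /hM/andP[h3 h4] : - a i <= u - a i by rewrite lerBrDr addrC subrr.
have cu : c <= `|u - a i|.
  have := ler_distD u (a i) (a j); rewrite (distrC (a i) u) cE => h5; lra.
apply: ler_pM => //.
by rewrite lef_pV2 ?posrE ?powR_gt0 ?(lt_le_trans c0)// ge0_ler_powR ?nnegrE ?(ltW c0)// ltW// beta_gt0.
Qed.

Let rest u := \sum_(i <- [seq i <- index_iota 0 k.+1 | i != j]) term i u.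

Let density_split u : 0 <= u -> spec_density n.+1 k a alpha h u = term j u + rest u.
Proof.
move=> u0; rewrite spec_density_terms// (bigD1_seq j) ?mem_index_iota ?iota_uniq//.
by rewrite /rest big_filter.
Qed.

Let h_cont e : 0 < e -> exists2 eta, 0 < eta & forall x, - a j <= x -> `|x| < eta -> `|h j x - h j 0| <= e.
Proof.
move=> e0; have [de de0 /subspace_continuousP/(_ 0)] := hc.
have A0 : (`[- a j, +oo[%classic `&` `]- de, de[%classic) (0 : R).
  by split => /=; rewrite in_itv/= ?andbT ?oppr_le0 ?a_ge0// oppr_lt0 de0.
move=> /(_ A0)/cvgrPdist_le/(_ e e0); rewrite near_withinE => /nbhs_ballP[eta eta0 H].
exists (Num.min eta de); first by rewrite lt_min eta0.
move=> x ax; rewrite lt_min => /andP[xe xd]; rewrite distrC; apply: H.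
  by rewrite /ball/= sub0r normrN.
by split => /=; rewrite in_itv/= ?andbT// -ltr_norml.
Qed.

(** Extended by 0 to negative radii, so that for [a 0 = 0] the left half contributes nothing. *)
Let qt u := if 0 <= u then u ^+ n * spec_density n.+1 k a alpha h u else 0.

Let near_right (P : R -> Prop) eta : 0 < eta -> (forall w, 0 < w < eta -> P w) -> \forall w \near 0^'+, P w.
Proof.
move=> eta0 H; rewrite near_withinE; apply/nbhs_ballP; exists eta => // w.
rewrite /ball/= sub0r normrN => we w0; apply: H; rewrite w0 /=.
by rewrite gtr0_norm in we.
Qed.

(** The sign [s] is the side from which the radius approaches [a j]; the lower side exists only if
    [a j > 0], and then [- w] stays in the domain of [h j]. *)
Let cvg_h (s : R) : s = 1 \/ (s = -1 /\ 0 < a j) -> h j (s * w) @[w --> 0^'+] --> h j 0.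
Proof.
move=> sP; apply/cvgrPdist_le => e e0; have [eta eta0 H] := h_cont e0.
have s1 : `|s| = 1 by case: sP => [->|[-> _]]; rewrite ?normrN ?normr1.
pose c := if s == 1 then 1 else a j.
have c0 : 0 < c by rewrite /c; case: sP => [->|[-> ?]]; rewrite ?eqxx//; case: ifP.
apply: (@near_right _ (Num.min eta c)); first by rewrite lt_min eta0.
move=> w; rewrite lt_min => /andP[w0 /andP[we wc]]; rewrite distrC; apply: H; last first.
  by rewrite normrM s1 mul1r gtr0_norm.
case: sP => [->|[se aj]]; first by rewrite mul1r (le_trans _ (ltW w0))// oppr_le0 a_ge0.
move: wc; rewrite /c se eqNr oner_eq0 => wc.
by rewrite mulN1r lerN2 ltW.
Qed.

(** The origin of [A_const]. At [a 0 = 0] only the right half counts and the factor [u^n] is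
    absorbed by the exponent [n + 1 - alpha_0]; at [a j > 0] each side contributes [a_j^n h_j(0)],
    hence the factor 2. The bounded remaining terms are killed by a positive power of [w]. *)
Lemma density_limit :
  (qt (a j + w) + qt (a j - w)) * w `^ (1 - alpha j) @[w --> 0^'+] --> A_const n.+1 a j * h j 0.
Proof.
have [|eta [B [eta0 B0 HB]]] := rest_bounded (s := [seq i <- index_iota 0 k.+1 | i != j]).
  by move=> i; rewrite mem_filter mem_index_iota/= ltnS => /andP[-> ->].
have nz (s : R) : s = 1 \/ (s = -1 /\ 0 < a j) -> exists2 c, 0 < c & forall w, 0 < w < c -> 0 < a j + s * w.
  case=> [->|[-> aj]].
    by exists 1 => // w /andP[w0 _]; rewrite mul1r ltr_wpDl// a_ge0.
  by exists (a j) => // w /andP[_ wa]; rewrite mulN1r subr_gt0.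
have cpow (p : R) (s : R) : 0 < p -> (s = 1 \/ (s = -1 /\ 0 < a j)) ->
    rest (a j + s * w) * w `^ p @[w --> 0^'+] --> 0.
  move=> p0 sP; have [c cgt0 cw] := nz s sP.
  have s1 : `|s| = 1 by case: sP => [->|[-> _]]; rewrite ?normrN ?normr1.
  have c0 : B * w `^ p @[w --> 0^'+] --> 0.
    by rewrite -[X in _ --> X](mulr0 B); apply: cvgMr; exact: powR_cvg0.
  apply: (squeeze_cvgr _ (cvg_cst 0) c0).
  apply: (@near_right _ (Num.min eta c)); first by rewrite lt_min eta0.
  move=> w; rewrite lt_min => /andP[w0 /andP[we wc]].
  have /andP[h1 h2] : 0 <= rest (a j + s * w) <= B.
    apply: HB; first by rewrite ltW// cw// w0.
    by rewrite addrAC subrr add0r normrM s1 mul1r gtr0_norm.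
  by rewrite mulr_ge0 ?powR_ge0//= ler_wpM2r// powR_ge0.
have cid (s : R) : (a j + s * w) @[w --> 0^'+] --> a j.
  have : (a j + s * w) @[w --> 0] --> a j + s * 0.
    by apply: cvgD; [exact: cvg_cst|apply: cvgMr; exact: cvg_id].
  by rewrite mulr0 addr0; exact: cvg_at_right_filter.
have [j0|jn0] := eqVneq j 0%N.
  rewrite /A_const j0 eqxx mul1r -{2 3 4}j0.
  have c1 : h j (1 * w) + rest (a j + 1 * w) * w `^ (n.+1%:R - alpha j) @[w --> 0^'+] --> h j 0.
    rewrite -[X in _ --> X]addr0; apply: cvgD; [exact: cvg_h (or_introl erefl)|apply: cpow; last by left].
    by rewrite subr_gt0 j0; have /andP[] := alpha0.
  apply: cvg_trans c1; apply: near_eq_cvg; apply: (@near_right _ 1) => // w /andP[w0 _].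
  rewrite !j0 !a0 !add0r !mul1r /qt ltW// lerNr oppr0 leNgt w0/= addr0.
  rewrite density_split ?(ltW w0)// /term j0 a0 subr0 /beta/= gtr0_norm//.
  have E : w `^ (n.+1%:R - alpha 0%N) = w ^+ n * w `^ (1 - alpha 0%N).
    rewrite -powR_mulrn ?(ltW w0)// -powRD; last by rewrite (gt_eqF w0) implybT.
    by congr (_ `^ _); rewrite -natr1; ring.
  have : w ^+ n * w `^ (1 - alpha 0%N) != 0 by rewrite -E gt_eqF// powR_gt0.
  rewrite E mulf_eq0 negb_or => /andP[].
  by move: (w ^+ n) (_ `^ _) (h _ _) (rest _) => A D x y A0 D0; field; rewrite A0 D0.
have aj : 0 < a j.
  by have := @a_lt 0%N j; rewrite a0 lt0n => H; apply: H.
have side (s : R) : s = 1 \/ (s = -1 /\ 0 < a j) ->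
    qt (a j + s * w) * w `^ (1 - alpha j) @[w --> 0^'+] --> a j ^+ n * h j 0.
  move=> sP; have [c cgt0 cw] := nz s sP.
  have s1 : `|s| = 1 by case: sP => [->|[-> _]]; rewrite ?normrN ?normr1.
  have c1 : (a j + s * w) ^+ n * (h j (s * w) + rest (a j + s * w) * w `^ (1 - alpha j)) @[w --> 0^'+] --> a j ^+ n * h j 0.
    apply: cvgM; first by apply: (continuous_cvg _ (@exprn_continuous R n _)); exact: cid.
    rewrite -[X in _ --> X]addr0; apply: cvgD; [exact: cvg_h|apply: cpow => //].
    have /(@alphaS j)/andP[] : (1 <= j <= k)%N by rewrite lt0n jn0.
    by rewrite subr_gt0.
  apply: cvg_trans c1; apply: near_eq_cvg; apply: (@near_right _ c) => // w /andP[w0 wc].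
  have uw : 0 < a j + s * w by apply: cw; rewrite w0.
  rewrite /qt ltW// density_split ?(ltW uw)// /term addrAC subrr add0r normrM s1 mul1r gtr0_norm//.
  rewrite -mulrA; congr (_ * _); rewrite mulrDl; congr (_ + _).
  by rewrite /beta (negbTE jn0) divfK// gt_eqF// powR_gt0.
rewrite /A_const (negbTE jn0)/= (_ : 2 * a j ^+ n * h j 0 = a j ^+ n * h j 0 + a j ^+ n * h j 0); last by ring.
have c1 : (qt (a j + 1 * w) * w `^ (1 - alpha j) + qt (a j + -1 * w) * w `^ (1 - alpha j)) @[w --> 0^'+] -->
    a j ^+ n * h j 0 + a j ^+ n * h j 0.
  by apply: cvgD; apply: side; [left|right].
move: c1; under eq_fun do rewrite mul1r mulN1r -mulrDl.
exact.
Qed.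
End density.

(** * Wiener integrals *)

Section wiener.
Context {R : realType} d (T : measurableType d) (P : probability T R) (n : nat).
Variable Z : set (n.-tuple R) -> T -> R.
Hypothesis wn : white_noise P Z.
Local Notation simp := (seq (R * set (n.-tuple R))).

Definition fin_simple (s : simp) := forall p, List.In p s -> finite_borel p.2.

Lemma leb_RnE (A : set (n.-tuple R)) : measurable A -> leb_Rn A = @leb R n A.
Proof.
move=> mA; rewrite /leb_Rn ge0_int_RnE ?integral_indic ?setIT//.
by apply/measurable_EFinP; exact: measurable_indic.
Qed.

Lemma L2_indic (A : set (n.-tuple R)) : finite_borel A -> L2 (@leb R n) (\1_A).
Proof.
move=> [mA Aoo]; apply: L2_lty; first exact: measurable_indic.
rewrite (_ : (\int[_]_x _)%E = (\int[@leb R n]_x (\1_A x)%:E)%E).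
  by rewrite integral_indic// setIT; move: Aoo; rewrite leb_RnE.
by apply: eq_integral => x _; rewrite indicE; case: (_ \in _); rewrite ?expr1n ?expr0n.
Qed.

Lemma ip_indic (A B : set (n.-tuple R)) : measurable A -> measurable B ->
  ip (@leb R n) (\1_A) (\1_B) = fine (@leb R n (A `&` B)).
Proof.
move=> mA mB; rewrite -[in RHS](setIT (A `&` B)) -integral_indic//; last exact: measurableI.
by congr fine; apply: eq_integral => x _; rewrite indicI.
Qed.

Lemma L2_noise (A : set (n.-tuple R)) : finite_borel A -> L2 P (Z A).
Proof.
move=> fA; have [gf [_ cov]] := wn; have [mA Aoo] := fA.
have [|m [v [mZ _]]] := gf [:: (1, A)]; first by move=> p [<-|[]].
have {}mZ : measurable_fun setT (Z A).
  by apply: eq_measurable_fun mZ => w _; rewrite big_seq1 mul1r.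
apply: L2_lty => //; have := cov A A fA fA; rewrite unlock setIid => E.
by under eq_integral do rewrite expr2; rewrite E.
Qed.

Lemma ip_noise (A B : set (n.-tuple R)) : finite_borel A -> finite_borel B ->
  ip P (Z A) (Z B) = ip (@leb R n) (\1_A) (\1_B).
Proof.
move=> fA fB; have [_ [_ cov]] := wn; have [mA _] := fA; have [mB _] := fB.
have := cov A B fA fB; rewrite unlock /ip /Rintegral => ->.
by rewrite leb_RnE; [rewrite -ip_indic|exact: measurableI].
Qed.

Lemma gauss_like_simple s : fin_simple s -> gauss_like P (simple_Z Z s).
Proof.
move=> fs; have [gf [mean _]] := wn.
apply: (gaussian_family_like gf fs); first exact: L2_noise.
by move=> A fA; have := mean A fA; rewrite unlock /Rintegral => ->.
Qed.

Lemma L2_simple s : fin_simple s -> L2 (@leb R n) (simple_Rn s).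
Proof.
move=> fs; apply: (@L2_sum _ _ _ _ _ _ (fun p u => p.1 * \1_(p.2) u)) => p ps.
by apply: L2Z; apply: L2_indic; exact: fs.
Qed.

Lemma ip_simple s : fin_simple s -> ip P (simple_Z Z s) (simple_Z Z s) = ip (@leb R n) (simple_Rn s) (simple_Rn s).
Proof.
move=> fs; rewrite /simple_Z /simple_Rn (@ip_lincomb _ _ _ _ _ s Z); last by move=> p /fs; exact: L2_noise.
rewrite (@ip_lincomb _ _ _ _ _ s (fun A => \1_A)); last by move=> p /fs; exact: L2_indic.
by apply: eq_big_In => p ps; apply: eq_big_In => q qs; rewrite ip_noise//; exact: fs.
Qed.

(** The relation between a kernel and its Wiener integral, with real L2 distances instead of
    extended ones; in this form it is closed under linear combinations. *)
Definition wpair (K : n.-tuple R -> R) (W : T -> R) := [/\ L2 (@leb R n) K, L2 P W &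
  exists S : nat -> simp, [/\ forall k, fin_simple (S k),
    ip (@leb R n) (fun u => simple_Rn (S k) u - K u) (fun u => simple_Rn (S k) u - K u) @[k --> \oo] --> 0 &
    ip P (fun w => simple_Z Z (S k) w - W w) (fun w => simple_Z Z (S k) w - W w) @[k --> \oo] --> 0]].

(** On simple kernels the white noise is Gaussian and isometric; both properties pass to L2
    limits. *)
Lemma wpair_gauss K W : wpair K W -> gauss_like P W /\ ip P W W = ip (@leb R n) K K.
Proof.
move=> [LK LW [S [fS cK cW]]]; split.
  by apply: (gauss_like_lim _ LW cW) => k; exact: gauss_like_simple.
have {}cK := ip_cvg (fun k => L2_simple (fS k)) LK cK.
have {}cW := ip_cvg (fun k => (gauss_like_simple (fS k)).1) LW cW.
suff E : (fun k => ip P (simple_Z Z (S k)) (simple_Z Z (S k))) = (fun k => ip (@leb R n) (simple_Rn (S k)) (simple_Rn (S k))).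
  by rewrite E in cW; exact: (cvg_unique _ cW cK).
by apply/funext => k; exact: ip_simple.
Qed.

Definition scale_simple (c : R) (s : simp) : simp := [seq (c * p.1, p.2) | p <- s].

Lemma simple_comb (c : R) s1 s2 u : simple_Rn (scale_simple c s1 ++ s2) u = c * simple_Rn s1 u + simple_Rn s2 u.
Proof.
rewrite /simple_Rn big_cat big_map/= mulr_sumr; congr (_ + _).
by apply: eq_bigr => p _; rewrite mulrA.
Qed.

Lemma simple_Z_comb (c : R) s1 s2 w : simple_Z Z (scale_simple c s1 ++ s2) w = c * simple_Z Z s1 w + simple_Z Z s2 w.
Proof.
rewrite /simple_Z big_cat big_map/= mulr_sumr; congr (_ + _).
by apply: eq_bigr => p _; rewrite mulrA.
Qed.

Lemma ip_comb_le (d1 : measure_display) (T1 : measurableType d1) (m1 : {measure set T1 -> \bar R}) (c : R) f g :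
  L2 m1 f -> L2 m1 g -> ip m1 (fun x => c * f x + g x) (fun x => c * f x + g x) <= 2 * c ^+ 2 * ip m1 f f + 2 * ip m1 g g.
Proof.
move=> Lf Lg; have := ip_ge0 m1 (fun x => c * f x + -1 * g x).
have := ip_cross c 1 Lf Lg; have -> := ip_cross c (-1) Lf Lg.
rewrite (eq_ip m1 (f' := fun x => c * f x + g x) (g' := fun x => c * f x + g x)); last 2 first.
- by move=> x; rewrite mul1r.
- by move=> x; rewrite mul1r.
move=> ->; rewrite sqrrN expr1n; lra.
Qed.

Lemma wpair_comb (c : R) K1 W1 K2 W2 : wpair K1 W1 -> wpair K2 W2 ->
  wpair (fun u => c * K1 u + K2 u) (fun w => c * W1 w + W2 w).
Proof.
move=> [LK1 LW1 [S1 [fS1 cK1 cW1]]] [LK2 LW2 [S2 [fS2 cK2 cW2]]]; split.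
- by apply: L2D => //; exact: L2Z.
- by apply: L2D => //; exact: L2Z.
have lim0 (A B : nat -> R) : A k @[k --> \oo] --> 0 -> B k @[k --> \oo] --> 0 ->
    2 * c ^+ 2 * A k + 2 * B k @[k --> \oo] --> 0.
  move=> cA cB; rewrite -[X in _ --> X]addr0 -[X in X + _](mulr0 (2 * c ^+ 2)) -[X in _ + X](mulr0 2).
  by apply: cvgD; apply: cvgMr.
exists (fun k => scale_simple c (S1 k) ++ S2 k); split.
- move=> k p /(@List.in_app_or _ _ _ _)[|/fS2//].
  by move/List.in_map_iff => [q [<- /fS1]].
- apply: (squeeze_cvgr _ (cvg_cst 0) (lim0 _ _ cK1 cK2)); apply: nearW => k.
  rewrite ip_ge0/=; apply: le_trans (ip_comb_le c (L2B (L2_simple (fS1 k)) LK1) (L2B (L2_simple (fS2 k)) LK2)).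
  rewrite le_eqVlt; apply/orP; left; apply/eqP; apply: eq_ip => u; rewrite simple_comb; ring.
- apply: (squeeze_cvgr _ (cvg_cst 0) (lim0 _ _ cW1 cW2)); apply: nearW => k.
  rewrite ip_ge0/=; apply: le_trans (ip_comb_le c (L2B (gauss_like_simple (fS1 k)).1 LW1) (L2B (gauss_like_simple (fS2 k)).1 LW2)).
  rewrite le_eqVlt; apply/orP; left; apply/eqP; apply: eq_ip => u; rewrite simple_Z_comb; ring.
Qed.

Lemma wpair0 : wpair (fun=> 0) (fun=> 0).
Proof.
split; [exact: L2_0|exact: L2_0|exists (fun=> [::]); split => //].
- rewrite (_ : (fun k => _) = cst 0); first exact: cvg_cst.
  by apply/funext => k; rewrite /ip /Rintegral integral0_eq// => x _; rewrite /simple_Rn big_nil subrr mul0r.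
- rewrite (_ : (fun k => _) = cst 0); first exact: cvg_cst.
  by apply/funext => k; rewrite /ip /Rintegral integral0_eq// => x _; rewrite /simple_Z big_nil subrr mul0r.
Qed.

Lemma wpair_sum I (s : seq I) (th : I -> R) (K : I -> n.-tuple R -> R) (W : I -> T -> R) :
  (forall i, wpair (K i) (W i)) -> wpair (fun u => \sum_(i <- s) th i * K i u) (fun w => \sum_(i <- s) th i * W i w).
Proof.
move=> KW; elim: s => [|i s IH].
  by under eq_fun do rewrite big_nil; under [X in wpair _ X]eq_fun do rewrite big_nil; exact: wpair0.
under eq_fun do rewrite big_cons; under [X in wpair _ X]eq_fun do rewrite big_cons.
exact: wpair_comb.
Qed.

Lemma L2_RnE (F : n.-tuple R -> R) : L2_Rn F -> L2 (@leb R n) F.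
Proof.
move=> [mF]; rewrite ge0_int_RnE; [exact: L2_lty| |].
  by apply/measurable_EFinP; exact: measurable_funX.
by move=> x; rewrite lee_fin sqr_ge0.
Qed.

Lemma wiener_wpair F Y : wiener_integral P Z F Y -> wpair F Y.
Proof.
move=> [/L2_RnE LF [mY [S [fS [c1 c2]]]]].
have mS k : measurable_fun setT (simple_Z Z (S k)) by have [[]] := gauss_like_simple (fS k).
have mD k : measurable_fun setT (fun w => simple_Z Z (S k) w - Y w) by exact: measurable_funB.
have ipE (d1 : measure_display) (T1 : measurableType d1) (m1 : {measure set T1 -> \bar R}) (D : T1 -> R) :
    ip m1 D D = fine (\int[m1]_x (D x ^+ 2)%:E)%E.
  by rewrite /ip /Rintegral; congr fine; apply: eq_integral => x _; rewrite expr2.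
have c2' : (\int[P]_w ((simple_Z Z (S k) w - Y w) ^+ 2)%:E)%E @[k --> \oo] --> 0%E.
  by move: c2; under eq_fun do rewrite unlock.
have /fine_cvgP[fin2 c2''] := c2'.
split => //; last first.
  exists S; split => //.
  have /fine_cvgP[_] := c1.
    rewrite (_ : fine \o _ = (fun k => ip (@leb R n) (fun u => simple_Rn (S k) u - F u) (fun u => simple_Rn (S k) u - F u)))//.
    apply/funext => k; rewrite ipE /= ge0_int_RnE//; last by move=> x; rewrite lee_fin sqr_ge0.
    by apply/measurable_EFinP; apply: measurable_funX; apply: measurable_funB; [exact: L2_meas (L2_simple (fS k))|exact: L2_meas LF].
(* Square-integrability of [Y] is extracted from the convergence: from some rank on the distance to
   a simple integral is finite, and simple integrals are in L2. *)
have [N _ /(_ N (leqnn _))] := fin2.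
rewrite ge0_fin_numE => [foo|]; last by apply: integral_ge0 => w _; rewrite lee_fin sqr_ge0.
have LD := L2_lty (mD N) foo.
by apply: eq_L2 (L2B (gauss_like_simple (fS N)).1 LD) => w; ring.
Qed.

End wiener.

Section lincomb.
Context {R : realType} d (X : measurableType d) (mu : {measure set X -> \bar R}) (I : Type).
Variables (c : I -> R) (f : I -> X -> R).
Hypothesis fi : forall i, mu.-integrable setT (EFin \o f i).

Lemma Rintegral_lincomb (s : seq I) : mu.-integrable setT (fun x => (\sum_(i <- s) c i * f i x)%:E) /\
  \int[mu]_x (\sum_(i <- s) c i * f i x) = \sum_(i <- s) c i * \int[mu]_x f i x.
Proof.
elim: s => [|i s [ii IH]].
  split; last by under eq_Rintegral do rewrite big_nil; rewrite big_nil /Rintegral integral0.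
  by apply: (eq_integrable _ (cst 0%E)) => //; [move=> x _; rewrite big_nil|exact: integrable0].
have ci : mu.-integrable setT (fun x => (c i * f i x)%:E).
  by have h := integrableZl measurableT (c i) (fi i); apply: eq_integrable h.
split.
  have h := integrableD measurableT ci ii; apply: eq_integrable h => // x _.
  by rewrite big_cons.
under eq_Rintegral do rewrite big_cons.
by rewrite RintegralD// IH RintegralZl// big_cons.
Qed.
End lincomb.

(** * Linear combinations of integrals of the field *)

Section xlink.
Context {R : realType} d (T : measurableType d) (P : probability T R).
Variables (n : nat) (phi : R -> R) (xi : n.+1.-tuple R -> T -> R).
Local Notation mu := (@lebesgue_measure R).
Hypothesis field : iso_gaussian_field P xi phi.
Hypothesis phi0 : forall u, 0 <= u -> 0 <= phi u.

(** Needed because [Rint_Rn] and [superp] agree only at those [w] whose trajectory is integrable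
    against the weight. *)
Lemma gauss_like_ae (W W' : T -> R) : measurable_fun setT W' -> {ae P, forall w, W w = W' w} ->
  gauss_like P W -> gauss_like P W' /\ ip P W' W' = ip P W W.
Proof.
move=> mW' ae [LW gW].
have mW := LW.1.
have E (h : R -> R) : measurable_fun [set: R] h -> (\int[P]_w (h (W' w))%:E = \int[P]_w (h (W w))%:E)%E.
  move=> mh; apply: ae_eq_integral => //.
  - by apply/measurable_EFinP; exact: measurableT_comp mh mW'.
  - by apply/measurable_EFinP; exact: measurableT_comp mh mW.
  by apply: filterS ae => w -> _.
have ipE : ip P W' W' = ip P W W.
  by congr fine; apply: (E (fun x => x * x)); exact: measurable_funM.
split => //; split.
  apply: L2_lty => //; rewrite (E (fun x => x ^+ 2)); last exact: measurable_funX.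
  have [_ i] := LW; have /integrableP[_] := i.
  by under eq_integral do rewrite gee0_abs ?lee_fin ?sqr_ge0//.
move=> c; rewrite ipE -gW; congr fine; apply: (E (fun x => cos (x + c))).
apply: (measurableT_comp (continuous_measurable_fun (@continuous_cos R))).
exact: measurable_funD.
Qed.

Lemma L1_RnE (F : n.+1.-tuple R -> R) : L1_Rn F -> (@leb R n.+1).-integrable setT (EFin \o F).
Proof.
move=> [mF foo]; apply/integrableP; split; first exact/measurable_EFinP.
move: foo; rewrite ge0_int_RnE//.
by apply/measurable_EFinP; exact: measurableT_comp.
Qed.

Lemma measurable_Rint_field (F : n.+1.-tuple R -> R) : measurable_fun setT F ->
  measurable_fun setT (fun w => Rint_Rn (fun x => F x * xi x w)).
Proof.
move=> mF; apply: (@measurableT_comp _ _ _ _ _ _ (@fine R)); first exact: fine_measurable.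
apply: (@measurable_int_Rn _ _ _ _ (fun p : T * n.+1.-tuple R => (F p.2 * xi p.2 p.1)%:E)).
apply/measurable_EFinP; apply: measurable_funM.
  exact: (measurableT_comp mF measurable_snd).
exact: (measurableT_comp (measurable_field field) (@measurable_swap _ _ T (n.+1.-tuple R))).
Qed.

(** [superp_integrable] tested on the constant 1, which is square-integrable for a probability. *)
Lemma ae_field_integrable (F : n.+1.-tuple R -> R) : (@leb R n.+1).-integrable setT (EFin \o F) ->
  {ae P, forall w, (@leb R n.+1).-integrable setT (fun x => (F x * xi x w)%:E)}.
Proof.
move=> iF; pose K := spectral_cov n.+1 phi 0.
have K1 x : ip P (xi x) (xi x) <= K by rewrite (ip_field field) dist_xx.
have i := superp_integrable (measurable_field field) iF (L2_field field) K1 (L2_1 P).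
apply: filterS (ae_integrable2 i) => w; apply: eq_integrable => // x _.
by rewrite /= mulr1.
Qed.

Variables (m : nat) (kap rho : 'I_m -> R) (f : R -> n.+1.-tuple R -> R) (g : R -> R) (aj : R).
Hypotheses (fL1 : forall i, L1_Rn (f (rho i)))
  (fhat : forall i l, Rint_Rn (fun x => cos (inner_Rn l x) * f (rho i) x) = rho i ^+ n.+1 * g (rho i * (norm_Rn l - aj)) /\
     Rint_Rn (fun x => sin (inner_Rn l x) * f (rho i) x) = 0).

(** A combination of integrals is the integral of the combined weight, so [field_superp] yields
    joint Gaussianity and all covariances at once. *)
Lemma field_combination :
  let W w := \sum_i kap i * Rint_Rn (fun x => f (rho i) x * xi x w) in
  gauss_like P W /\ ip P W W = sphere_area n *
    \int[mu]_(u in `[0, +oo[%classic) (u ^+ n * phi u * (\sum_i kap i * (rho i ^+ n.+1 * g (rho i * (u - aj)))) ^+ 2).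
Proof.
move=> W; pose F x := \sum_i kap i * f (rho i) x.
have fi i := L1_RnE (fL1 i).
have [iF _] := Rintegral_lincomb kap (fun i => fi i) (index_enum 'I_m).
have mf i : measurable_fun setT (f (rho i)) by have [] := fL1 i.
have trig_int (h : R -> R) i l : measurable_fun [set: R] h -> (forall x, `|h x| <= 1) ->
    (@leb R n.+1).-integrable setT (fun x => (h (inner_Rn l x) * f (rho i) x)%:E) /\
    \int[@leb R n.+1]_x (h (inner_Rn l x) * f (rho i) x) = Rint_Rn (fun x => h (inner_Rn l x) * f (rho i) x).
  move=> mh hb.
  have ii : (@leb R n.+1).-integrable setT (fun x => (h (inner_Rn l x) * f (rho i) x)%:E).
    apply: le_integrable (fi i) => //.
      apply/measurable_EFinP; apply: measurable_funM => //; apply: (measurableT_comp mh).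
      exact: (@measurable_inner R _ _ n.+1 (fun _ => l) (fun p => p) (measurable_cst _) (@measurable_id _ _ setT)).
    by move=> x _; rewrite /= lee_fin normrM ler_piMl.
  by split => //; rewrite /Rint_Rn int_RnE.
have mcos := continuous_measurable_fun (@continuous_cos R).
have msin := continuous_measurable_fun (@continuous_sin R).
have bcos (x : R) : `|cos x| <= 1 by rewrite ler_norml cos_geN1 cos_le1.
have bsin (x : R) : `|sin x| <= 1 by rewrite ler_norml sin_geN1 sin_le1.
(* The kernel [cos + sin] adds the cosine and sine transforms; the latter vanish, which leaves the
   radial profile. *)
have HF l : \int[@leb R n.+1]_x (F x * (cos (inner_Rn l x) + sin (inner_Rn l x))) =
    \sum_i kap i * (rho i ^+ n.+1 * g (rho i * (norm_Rn l - aj))).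
  pose F2 i x := cos (inner_Rn l x) * f (rho i) x + sin (inner_Rn l x) * f (rho i) x.
  have iF2 i : (@leb R n.+1).-integrable setT (EFin \o F2 i).
    by have h := integrableD measurableT (trig_int cos i l mcos bcos).1 (trig_int sin i l msin bsin).1; apply: eq_integrable h.
  have [_ E] := Rintegral_lincomb kap iF2 (index_enum 'I_m).
  transitivity (\int[@leb R n.+1]_x (\sum_i kap i * F2 i x)).
    by apply: eq_Rintegral => x _; rewrite /F mulr_suml; apply: eq_bigr => i _; rewrite /F2; ring.
  rewrite E; apply: eq_bigr => i _; congr (_ * _).
  have [ic Ec] := trig_int cos i l mcos bcos; have [is_ Es] := trig_int sin i l msin bsin.
  rewrite RintegralD// Ec Es; have [-> ->] := fhat i l.
  by rewrite addr0.
have [gl ipE] := @field_superp _ _ _ _ _ _ _ field phi0 F (fun u => \sum_i kap i * (rho i ^+ n.+1 * g (rho i * (u - aj)))) iF HF.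
have mW : measurable_fun setT W.
  by rewrite /W; apply: measurable_sum => i; apply: measurable_funM => //; exact: measurable_Rint_field.
rewrite -ipE; apply: gauss_like_ae => //.
have ae : {ae P, forall w, forall i, (@leb R n.+1).-integrable setT (fun x => (f (rho i) x * xi x w)%:E)}.
  by apply: filter_forall => i; exact: ae_field_integrable.
apply: filterS ae => w iw.
have [_ E] := Rintegral_lincomb kap iw (index_enum 'I_m).
rewrite /superp /W; transitivity (\int[@leb R n.+1]_x (\sum_i kap i * (f (rho i) x * xi x w))).
  by apply: eq_Rintegral => x _; rewrite /F mulr_suml; apply: eq_bigr => i _; rewrite mulrA.
by rewrite E; apply: eq_bigr => i _; rewrite /Rint_Rn int_RnE.
Qed.
End xlink.

(** * Approximation by trigonometric polynomials *)

Section walk.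
Context {R : realType} (I : eqType).
Variables (step : R) (p : I -> R).

Definition shift (s : I -> R) (i : I) : I -> R := fun l => s l + (if l == i then step else 0).

(* Expectation of [f] after a random walk started at [s], whose successive moves along the
   coordinates listed in [l] are Bernoulli with parameters [p]: a multivariate Bernstein operator. *)
Fixpoint walk (l : seq I) (f : (I -> R) -> R) (s : I -> R) : R :=
  if l is i :: l' then p i * walk l' f (shift s i) + (1 - p i) * walk l' f s else f s.

Lemma walk_cst l c s : walk l (fun=> c) s = c.
Proof. by elim: l s => //= i l IH s; rewrite !IH; ring. Qed.

Lemma walk_comb l a f g s : walk l (fun x => a * f x + g x) s = a * walk l f s + walk l g s.
Proof. by elim: l s => //= i l IH s; rewrite !IH; ring. Qed.

Lemma walk_sum J (r : seq J) l (f : J -> (I -> R) -> R) s :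
  walk l (fun x => \sum_(j <- r) f j x) s = \sum_(j <- r) walk l (f j) s.
Proof.
elim: r => [|j r IH]; first by under eq_fun do rewrite big_nil; rewrite walk_cst big_nil.
under eq_fun do rewrite big_cons -[f j _]mul1r; rewrite walk_comb IH big_cons; ring.
Qed.

(** Squared bias plus variance: coordinate [i] makes [count_mem i l] independent Bernoulli moves. *)
Lemma walk_sqr l i c s : walk l (fun x => (x i - c) ^+ 2) s =
  (s i + (count_mem i l)%:R * step * p i - c) ^+ 2 + (count_mem i l)%:R * step ^+ 2 * (p i * (1 - p i)).
Proof.
elim: l s => [|l ls IH] s /=; first by rewrite !mul0r !addr0.
rewrite !IH /shift eq_sym natrD; case: eqP => [->|_] /=; ring.
Qed.

Hypothesis p01 : forall i, 0 <= p i <= 1.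

Lemma walk_le l f g s : (forall x, f x <= g x) -> walk l f s <= walk l g s.
Proof.
move=> fg; elim: l s => //= i l IH s; have /andP[p0 p1] := p01 i.
by apply: lerD; apply: ler_wpM2l; rewrite ?subr_ge0.
Qed.

Lemma walk_abs l f s : `|walk l f s| <= walk l (fun x => `|f x|) s.
Proof.
rewrite ler_norml; apply/andP; split.
  have -> : - walk l (fun x => `|f x|) s = walk l (fun x => (-1) * `|f x| + 0) s.
    by rewrite walk_comb walk_cst mulN1r addr0.
  by apply: walk_le => x; rewrite mulN1r addr0 lerNl -normrN ler_norm.
by apply: walk_le => x; exact: ler_norm.
Qed.
End walk.

Section trig.
Context {R : realType} (m : nat).
Local Notation V := ('I_m -> R).

Definition trig_sum (s : seq (R * (V * R))) (x : V) : R :=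
  \sum_(q <- s) q.1 * cos (\sum_i q.2.1 i * x i + q.2.2).

Lemma trig_sum_cons q s x : trig_sum (q :: s) x = q.1 * cos (\sum_i q.2.1 i * x i + q.2.2) + trig_sum s x.
Proof. by rewrite /trig_sum big_cons. Qed.

Lemma trig_sum_cat s t x : trig_sum (s ++ t) x = trig_sum s x + trig_sum t x.
Proof. by rewrite /trig_sum big_cat. Qed.

Definition trig (f : V -> R) := exists s, forall x, f x = trig_sum s x.

Lemma trig_cst c : trig (fun=> c).
Proof.
exists [:: (c, (fun=> 0, 0))] => x; rewrite /trig_sum big_seq1/= big1 ?addr0 ?cos0 ?mulr1// => i _.
by rewrite mul0r.
Qed.

Lemma trigD f g : trig f -> trig g -> trig (fun x => f x + g x).
Proof. by move=> [s fs] [t gt]; exists (s ++ t) => x; rewrite trig_sum_cat fs gt. Qed.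

Lemma trigM f g : trig f -> trig g -> trig (fun x => f x * g x).
Proof.
move=> [s fs] [t gt].
suff: trig (fun x => trig_sum s x * trig_sum t x).
  by move=> [u H]; exists u => x; rewrite fs gt.
elim: s {fs} => [|q s [u IH]].
  by have [u H] := trig_cst 0; exists u => x; rewrite -H /trig_sum big_nil mul0r.
suff [v H] : trig (fun x => q.1 * cos (\sum_i q.2.1 i * x i + q.2.2) * trig_sum t x).
  by exists (v ++ u) => x; rewrite trig_sum_cat trig_sum_cons mulrDl H -IH.
elim: t {gt u IH} => [|r t [u IH]].
  by have [u H] := trig_cst 0; exists u => x; rewrite -H /trig_sum big_nil mulr0.
exists [:: (q.1 * r.1 / 2, (fun i => q.2.1 i - r.2.1 i, q.2.2 - r.2.2)),
  (q.1 * r.1 / 2, (fun i => q.2.1 i + r.2.1 i, q.2.2 + r.2.2)) & u] => x.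
rewrite !trig_sum_cons/= mulrDr IH addrA; congr (_ + _).
have -> : \sum_i (q.2.1 i - r.2.1 i) * x i + (q.2.2 - r.2.2) =
   (\sum_i q.2.1 i * x i + q.2.2) - (\sum_i r.2.1 i * x i + r.2.2).
  have -> : \sum_i (q.2.1 i - r.2.1 i) * x i = \sum_i q.2.1 i * x i - \sum_i r.2.1 i * x i.
    by rewrite -sumrB; apply: eq_bigr => i _; rewrite mulrBl.
  ring.
have -> : \sum_i (q.2.1 i + r.2.1 i) * x i + (q.2.2 + r.2.2) =
   (\sum_i q.2.1 i * x i + q.2.2) + (\sum_i r.2.1 i * x i + r.2.2).
  have -> : \sum_i (q.2.1 i + r.2.1 i) * x i = \sum_i q.2.1 i * x i + \sum_i r.2.1 i * x i.
    by rewrite -big_split; apply: eq_bigr => i _; rewrite mulrDl.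
  ring.
move: (\sum_i q.2.1 i * x i + q.2.2) (\sum_i r.2.1 i * x i + r.2.2) => A B.
by rewrite cosB cosD; field.
Qed.

Lemma trig_sin i c : trig (fun x => sin (c * x i)).
Proof.
exists [:: (1, (fun l => if l == i then c else 0, - (pi / 2)))] => x.
rewrite /trig_sum big_seq1/= mul1r cosBpihalf (bigD1 i)//= eqxx big1 ?addr0// => l li.
by rewrite (negbTE li) mul0r.
Qed.

(** Unfolded, [walk] is a polynomial in the probabilities [p x i] with values of [f] as
    coefficients. *)
Lemma trig_walk (step : R) (p : V -> V) l f s : (forall i, trig (fun x => p x i)) ->
  trig (fun x => walk step (p x) l f s).
Proof.
move=> tp; elim: l s => [|i l IH] s /=; first exact: trig_cst.
apply: trigD; apply: trigM => //; apply: trigD; first exact: trig_cst.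
have [u H] := trigM (trig_cst (-1)) (tp i).
by exists u => x; rewrite -H mulN1r.
Qed.

(** The second point may leave [K]. This matters because [walk_le] compares functions at all points,
    not only at those in the cube. *)
Lemma unif_cont (X Y : pseudoMetricType R) (f : X -> Y) (K : set X) (e : R) : continuous f -> compact K -> 0 < e ->
  exists2 de : R, 0 < de & forall x y, K x -> ball x de y -> ball (f x) e (f y).
Proof.
move=> cf /compact_near_coveringP cK e0.
pose Q (de : R) x := forall y, ball x de y -> ball (f x) e (f y).
have : \forall de \near 0^'+, K `<=` Q de.
  apply: cK => x Kx.
  have e2 : 0 < e / 2 by rewrite divr_gt0.
  have /cvg_ballP/(_ _ e2)/nbhs_ballP[r /= r0 H] := cf x.
  have r2 : 0 < r / 2 by rewrite divr_gt0.
  exists (ball x (r / 2), [set de : R | de < r / 2]).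
    split; first exact: nbhsx_ballx.
    exact: nbhs_right_lt.
  move=> [x' de]/= [xx' dr] y x'y; rewrite [e]splitr.
  apply: (@ball_triangle _ _ (f x)).
    apply: ball_sym; apply: H; apply: le_ball xx'; lra.
  apply: H; rewrite [r]splitr; apply: ball_triangle xx' _.
  by apply: le_ball x'y; exact: ltW.
rewrite near_withinE => /nbhs_ballP[de de0 H].
exists (de / 2) => [|x y Kx]; first by rewrite divr_gt0.
apply: (H (de / 2)) => //=; last by rewrite divr_gt0.
by rewrite /ball/= sub0r normrN gtr0_norm ?divr_gt0// ltr_pdivrMr// ltr_pMr// ltr1n.
Qed.

Variables (F : 'rV[R]_m -> R) (M : R).
Hypotheses (cF : continuous F) (FM : forall v, `|F v| <= M).

(** Bernstein approximation in the variables [sin (x_i / (2 L))], rescaled to [[0, 1]]: a polynomial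
    in sines is a trigonometric sum. An average of values of [F] keeps the bound [M] on the whole
    space, which controls the approximant outside the box. *)
Lemma trig_approx (L e : R) : 0 < L -> 0 < e -> exists phi, [/\ trig phi,
  forall x, `|phi x| <= M & forall x : V, (forall i, `|x i| <= L) -> `|phi x - F (\row_i x i)| <= e].
Proof.
move=> L0 e0.
(* On the box [x_i / (2 L)] stays in [[- 1/2, 1/2]], so clamping at [sin (1/2)] changes nothing
   there; it keeps the argument of [asin] inside the open interval where [asin] is continuous. *)
pose s1 : R := sin (2^-1).
have pi2 := @pi_ge2 R.
have s1lt : s1 < 1.
  have c0 : 0 < cos (2^-1 : R) by apply: cos_gt0_pihalf; lra.
  have := cos2Dsin2 (2^-1 : R); rewrite -/s1; have := exprn_gt0 2 c0; nra.
have s10 : 0 < s1 by apply: sin_gt0_pi; lra.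
pose clamp (y : R) := Num.max (- s1) (Num.min s1 (2 * y - 1)).
have clamp_itv y : - s1 <= clamp y <= s1.
  by rewrite /clamp le_max lexx/= ge_max ge_min lexx/= andbT; lra.
pose tau y := 2 * L * asin (clamp y).
have cclamp : continuous clamp.
  move=> y; apply: (@continuous_max R R (cst (- s1)) ((cst s1) \min (fun y => 2 * y - 1))); first exact: cvg_cst.
  apply: (@continuous_min R R (cst s1) (fun y => 2 * y - 1)); first exact: cvg_cst.
  by apply: cvgB; [apply: cvgMr; exact: cvg_id|exact: cvg_cst].
have ctau : continuous tau.
  move=> y; apply: cvgMr; apply: (@cvg_comp _ _ _ clamp asin _ (nbhs (clamp y))).
    exact: cclamp.
  apply: continuous_asin; have /andP[] := clamp_itv y; lra.
pose P (x : V) : V := fun i => (1 + sin ((2 * L)^-1 * x i)) / 2.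
have P01 x i : 0 <= P x i <= 1.
  by rewrite /P; have := sin_geN1 ((2 * L)^-1 * x i); have := sin_le1 ((2 * L)^-1 * x i); lra.
have tauP x : (forall i, `|x i| <= L) -> forall i, tau (P x i) = x i.
  move=> xL i; rewrite /tau /P; set z := (2 * L)^-1 * x i.
  have zb : `|z| <= 2^-1.
    rewrite /z normrM gtr0_norm ?invr_gt0 ?mulr_gt0// invfM -mulrA ler_piMr ?invr_ge0//.
    by rewrite mulrC ler_pdivrMr// mul1r.
  have /andP[z1 z2] : - 2^-1 <= z <= 2^-1 by rewrite -ler_norml.
  have zpi : z \in `[- (pi / 2), pi / 2] by rewrite in_itv/=; apply/andP; split; lra.
  have hpi : 2^-1 \in `[- (pi / 2), pi / 2 : R] by rewrite in_itv/=; apply/andP; split; lra.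
  have hpiN : - 2^-1 \in `[- (pi / 2), pi / 2 : R] by rewrite in_itv/=; apply/andP; split; lra.
  have s_le : sin z <= s1 by rewrite /s1 leNgt ltr_sin// -leNgt.
  have s_ge : - s1 <= sin z by rewrite /s1 -sinN leNgt ltr_sin// -leNgt.
  have -> : clamp ((1 + sin z) / 2) = sin z.
    rewrite /clamp (_ : 2 * ((1 + sin z) / 2) - 1 = sin z); last by field.
    by rewrite (min_idPr s_le) (max_idPr s_ge).
  by rewrite sinK// /z; field; rewrite gt_eqF.
have e2 : 0 < e / 2 by rewrite divr_gt0.
(* This box contains all values of [tau], since [|asin|] is at most [pi / 2]. *)
have cbox : compact [set v : 'rV[R]_m | forall i, `[- (pi * L), pi * L]%classic (v ord0 i)].
  by apply: (@rV_compact R m (fun=> `[- (pi * L), pi * L]%classic)) => i; exact: segment_compact.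
have [eta eta0 ucF] := @unif_cont 'rV[R]_m R F _ (e / 2) cF cbox e2.
have [de de0 uct] := @unif_cont R R tau _ eta ctau (@segment_compact R 0 1) eta0.
pose G (s : V) := F (\row_i tau (s i)).
have GP x s : (forall i, `|s i - P x i| < de) -> `|G s - G (P x)| <= e / 2.
  move=> H; rewrite distrC; apply/ltW; apply: ucF.
    move=> i /=; rewrite mxE in_itv/= -ler_norml /tau.
    have := clamp_itv (P x i); move: (clamp _) => c /andP[c1 c2].
    have [/andP[a1 a2] _] : - (pi / 2) <= asin c <= pi / 2 /\ sin (asin c) = c by apply: asin_def; lra.
    rewrite normrM ger0_norm ?mulr_ge0 ?(ltW L0)//.
    have : `|asin c| <= pi / 2 by rewrite ler_norml a1.
    move=> /(ler_wpM2l (ltW (mulr_gt0 (ltr0n R 2) L0))) h; apply: (le_trans h).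
    by rewrite le_eqVlt; apply/orP; left; apply/eqP; field.
  split => // i l; rewrite !mxE; apply: uct; first by rewrite /= in_itv/= P01.
  by rewrite /ball/= distrC.
have M0 : 0 <= M by apply: le_trans (FM 0).
(* Chebyshev's constant: if some coordinate deviates by [de] or more, [K] times its squared
   deviation is at least [2 M], the largest possible error. *)
pose K := 2 * M / de ^+ 2.
have K0 : 0 <= K by rewrite divr_ge0 ?exprn_ge0 ?(ltW de0)// mulr_ge0.
have GPK x s : `|G s - G (P x)| <= K * (\sum_i (s i - P x i) ^+ 2) + e / 2.
  have [H|] := pselect (forall i, `|s i - P x i| < de).
    by apply: le_trans (GP x s H) _; rewrite lerDr mulr_ge0// sumr_ge0// => i _; rewrite sqr_ge0.
  move=> /existsNP[i /negP]; rewrite -leNgt => dei.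
  apply: (@le_trans _ _ (2 * M)).
    by apply: le_trans (ler_normB _ _) _; have := FM (\row_i tau (s i)); have := FM (\row_i tau (P x i)); rewrite /G; lra.
  apply: (@le_trans _ _ (K * (s i - P x i) ^+ 2)).
    rewrite /K -mulrA ler_peMr ?mulr_ge0// mulrC ler_pdivlMr ?exprn_gt0// mul1r.
    by rewrite -[leRHS]real_normK ?num_real//; apply: lerXn2r; rewrite ?nnegrE ?(ltW de0).
  rewrite -[leLHS]addr0; apply: lerD; last exact: ltW.
  apply: ler_wpM2l => //; rewrite (bigD1 i)//= lerDl sumr_ge0// => l _; exact: sqr_ge0.
have [N HN] : exists N : nat, K * m%:R / N.+1%:R <= e / 2.
  exists (Num.truncn (K * m%:R / (e / 2))); have h := truncnS_gt (K * m%:R / (e / 2)).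
  by rewrite ltr_pdivrMr// in h; rewrite ler_pdivrMr//; apply/ltW; rewrite [ltRHS]mulrC.
(* With [N + 1] moves of length [1 / (N + 1)] along each coordinate, the walk has mean [P x] and
   coordinate variances at most [1 / (N + 1)]. *)
have [l lN] : exists l : seq 'I_m, forall i, count_mem i l = N.+1.
  elim: N.+1 => [|N' [l IH]]; first by exists [::].
  by exists (enum 'I_m ++ l) => i; rewrite count_cat IH count_uniq_mem ?enum_uniq// mem_enum add1n.
pose phi (x : V) := walk (N.+1%:R^-1) (P x) l G (fun=> 0).
exists phi; split.
- apply: trig_walk => i; rewrite /P; apply: trigM; last exact: trig_cst.
  by apply: trigD; [exact: trig_cst|exact: trig_sin].
- move=> x; apply: le_trans (walk_abs _ (P01 x) _ _ _) _.
  by rewrite -[leRHS](walk_cst (N.+1%:R^-1) (P x) l _ (fun=> 0)); apply: walk_le => // s; exact: FM.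
move=> x xL; have -> : F (\row_i x i) = G (P x).
  by congr F; apply/rowP => i; rewrite !mxE tauP.
have -> : phi x - G (P x) = walk (N.+1%:R^-1) (P x) l (fun s => 1 * G s + - G (P x)) (fun=> 0).
  by rewrite walk_comb walk_cst mul1r.
apply: le_trans (walk_abs _ (P01 x) _ _ _) _.
apply: (@le_trans _ _ (walk (N.+1%:R^-1) (P x) l (fun s => K * (\sum_i (s i - P x i) ^+ 2) + e / 2) (fun=> 0))).
  by apply: walk_le => // s; rewrite mul1r.
rewrite walk_comb walk_cst walk_sum [leRHS]splitr lerD2r; apply: le_trans HN; rewrite -mulrA; apply: ler_wpM2l => //.
apply: (@le_trans _ _ (\sum_(i < m) N.+1%:R^-1)); last by rewrite sumr_const card_ord mulr_natl.
apply: ler_sum => i _; rewrite walk_sqr lN add0r divff ?pnatr_eq0// mul1r subrr expr0n add0r.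
rewrite (_ : N.+1%:R * N.+1%:R^-1 ^+ 2 = N.+1%:R^-1 :> R); last by rewrite expr2 mulrA divff ?pnatr_eq0// mul1r.
rewrite ler_piMr ?invr_ge0//.
have /andP[p0 p1] := P01 x i; nra.
Qed.
End trig.

(** * From cosines to bounded continuous functions *)

Section weak.
Context {R : realType} d (T : measurableType d) (P : probability T R)
  d' (T' : measurableType d') (P' : probability T' R) (m : nat).
Variables (F : 'rV[R]_m -> R) (M : R).
Hypotheses (cF : continuous F) (FM : forall v, `|F v| <= M).

Lemma trig_integral d0 (T0 : measurableType d0) (Q : probability T0 R) (X : 'I_m -> T0 -> R) s :
  (forall i, measurable_fun setT (X i)) ->
  [/\ measurable_fun setT (fun w => trig_sum s (X^~ w)), Q.-integrable setT (fun w => (trig_sum s (X^~ w))%:E) &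
  \int[Q]_w trig_sum s (X^~ w) = \sum_(q <- s) q.1 * \int[Q]_w cos (\sum_i q.2.1 i * X i w + q.2.2)].
Proof.
move=> mX; have ii (q : R * (('I_m -> R) * R)) : Q.-integrable setT (EFin \o (fun w => cos (\sum_i q.2.1 i * X i w + q.2.2))).
  apply: integrable_cos_comp; apply: measurable_sum => i; exact: measurable_funM.
have [i E] := Rintegral_lincomb (fun q : R * (('I_m -> R) * R) => q.1) ii s.
by split => //; have /integrableP[/measurable_EFinP] := i.
Qed.

Let M0 : 0 <= M. Proof. by apply: le_trans (FM 0). Qed.

(** A pointwise limit of trigonometric sums on growing boxes, which relies only on the measurability
    of the coordinates. *)
Lemma measurable_F_comp d0 (T0 : measurableType d0) (Q : probability T0 R) (X : 'I_m -> T0 -> R) :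
  (forall i, measurable_fun setT (X i)) -> measurable_fun setT (fun w => F (\row_i X i w)).
Proof.
move=> mX.
have H k : exists phi : ('I_m -> R) -> R, [/\ trig phi,
    forall x, `|phi x| <= M & forall x : 'I_m -> R, (forall i, `|x i| <= k.+1%:R) -> `|phi x - F (\row_i x i)| <= k.+1%:R^-1].
  by apply: (trig_approx cF FM) => //; rewrite invr_gt0.
have [phi Hphi] := choice H.
apply: (@measurable_fun_cvg _ _ _ _ (fun k w => phi k (X^~ w))).
  move=> k; have [[s sE] _ _] := Hphi k.
  rewrite (_ : (fun w => _) = (fun w => trig_sum s (X^~ w))); last by apply/funext => w; rewrite sE.
  by have [] := @trig_integral _ _ Q X s mX.
move=> w _; apply/cvgrPdist_le => e e0.
have h1 : \forall k \near \oo, k.+1%:R^-1 <= e.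
  have /cvgrPdist_le/(_ e e0) := @cvg_harmonic R; apply: filterS => k.
  by rewrite sub0r normrN /harmonic/= ger0_norm ?invr_ge0.
have h2 : \forall k \near \oo, forall i, `|X i w| <= k.+1%:R.
  apply: filter_forall => i; exists (Num.truncn `|X i w|) => // k /= hk.
  by apply: le_trans (ltW (truncnS_gt _)) _; rewrite ler_nat ltnS.
apply: filterS2 h1 h2 => k h1 h2; rewrite distrC.
by have [_ _ Hk] := Hphi k; apply: le_trans h1; exact: Hk.
Qed.

(** Inside the box the error is at most [e]. Outside, it is at most [2 M] while some [X_i^2] exceeds
    [L^2], so second moments pay for it. *)
Lemma trig_approx_integral d0 (T0 : measurableType d0) (Q : probability T0 R) (X : 'I_m -> T0 -> R) (s : seq (R * (('I_m -> R) * R))) (L e V : R) :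
  0 < L -> 0 <= e -> (forall i, L2 Q (X i)) -> \sum_i ip Q (X i) (X i) <= V ->
  (forall x, `|trig_sum s x| <= M) -> (forall x : 'I_m -> R, (forall i, `|x i| <= L) -> `|trig_sum s x - F (\row_i x i)| <= e) ->
  `|\int[Q]_w trig_sum s (X^~ w) - \int[Q]_w F (\row_i X i w)| <= e + 2 * M / L ^+ 2 * V.
Proof.
move=> L0 e0 LX XV sM sF.
have mX i := L2_meas (LX i).
have [_ is_ _] := @trig_integral _ _ Q X s mX.
have iF : Q.-integrable setT (EFin \o (fun w => F (\row_i X i w))).
  by apply: (@integrable_bounded _ _ _ _ _ M) => //; exact: measurable_F_comp Q X mX.
rewrite -RintegralB//.
have i1 : Q.-integrable setT (EFin \o (fun w => trig_sum s (X^~ w) - F (\row_i X i w))).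
  by have h := integrableB measurableT is_ iF; apply: eq_integrable h.
apply: le_trans (le_normr_Rintegral measurableT i1) _.
have ix i : Q.-integrable setT (EFin \o (fun w => X i w * X i w)) by exact: L2_mul.
have [isx Esx] := Rintegral_lincomb (fun=> 1) ix (index_enum 'I_m).
pose c := 2 * M / L ^+ 2.
have c0 : 0 <= c by rewrite divr_ge0 ?exprn_ge0 ?(ltW L0)// mulr_ge0.
have ic : Q.-integrable setT (EFin \o (fun w => c * (\sum_i 1 * (X i w * X i w)))).
  by have h := integrableZl measurableT c isx; apply: eq_integrable h.
have ie : Q.-integrable setT (EFin \o (fun=> e)) by exact: finite_measure_integrable_cst.
apply: (@le_trans _ _ (\int[Q]_w (e + c * (\sum_i 1 * (X i w * X i w))))).
  apply: le_Rintegral => //.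
  - exact: integrable_norm i1.
  - by have h := integrableD measurableT ie ic; apply: eq_integrable h.
  move=> w _; have sq0 i : 0 <= 1 * (X i w * X i w) by rewrite mul1r -expr2 sqr_ge0.
  have [H|] := pselect (forall i, `|X i w| <= L).
    by apply: le_trans (sF _ H) _; rewrite lerDl mulr_ge0// sumr_ge0.
  move=> /existsNP[i /negP]; rewrite -ltNge => LX'.
  apply: (@le_trans _ _ (2 * M)).
    by apply: le_trans (ler_normB _ _) _; have := FM (\row_i X i w); have := sM (X^~ w); lra.
  apply: (@le_trans _ _ (c * (1 * (X i w * X i w)))).
    rewrite /c -[leRHS]mulrA ler_peMr ?mulr_ge0// mulrC ler_pdivlMr ?exprn_gt0// !mul1r -expr2.
    by rewrite -[leRHS]real_normK ?num_real//; apply: lerXn2r; rewrite ?nnegrE ?(ltW L0)// ltW.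
  rewrite -[leLHS]add0r; apply: lerD => //; apply: ler_wpM2l => //.
  by rewrite (bigD1 i)//= lerDl sumr_ge0.
rewrite RintegralD// Rintegral_prob_cst lerD2l RintegralZl// Esx; apply: ler_wpM2l => //.
by apply: le_trans XV; rewrite le_eqVlt; apply/orP; left; apply/eqP; apply: eq_bigr => i _; rewrite mul1r.
Qed.

Variables (X : nat -> 'I_m -> T -> R) (Y : 'I_m -> T' -> R) (V : R).
Hypotheses (LX : forall k i, L2 P (X k i)) (LY : forall i, L2 P' (Y i))
  (XV : \forall k \near \oo, \sum_i ip P (X k i) (X k i) <= V) (YV : \sum_i ip P' (Y i) (Y i) <= V)
  (cos_cvg : forall (th : 'I_m -> R) c, \int[P]_w cos (\sum_i th i * X k i w + c) @[k --> \oo] -->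
    \int[P']_w cos (\sum_i th i * Y i w + c)).

Lemma weak_cvg : \int[P]_w F (\row_i X k i w) @[k --> \oo] --> \int[P']_w F (\row_i Y i w).
Proof.
apply/cvgrPdist_le => e e0.
have V0 : 0 <= V by apply: le_trans YV; apply: sumr_ge0 => i _; exact: ip_ge0.
(* Large enough for [2 M V / L^2 <= e / 5]. Of the five parts of [e], each law uses two (inside and
   outside the box) and the trigonometric sum one; the [+ 1] makes [L] positive. *)
pose L := Num.sqrt (10 * M * V / e) + 1.
have L0 : 0 < L by rewrite ltr_wpDl// sqrtr_ge0.
have e5 : 0 < e / 5 by rewrite divr_gt0.
have [phi [[s sE] pM pF]] := trig_approx cF FM L0 e5.
have sM x : `|trig_sum s x| <= M by rewrite -sE.
have sF (x : 'I_m -> R) : (forall i, `|x i| <= L) -> `|trig_sum s x - F (\row_i x i)| <= e / 5 by rewrite -sE; exact: pF.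
have b : 2 * M / L ^+ 2 * V <= e / 5.
  have h : 10 * M * V / e <= L ^+ 2.
    have q0 : 0 <= 10 * M * V / e by rewrite divr_ge0 ?(ltW e0)// mulr_ge0// mulr_ge0.
    rewrite -[leLHS]sqr_sqrtr//; apply: lerXn2r; rewrite ?nnegrE ?sqrtr_ge0 ?(ltW L0)//.
    by rewrite /L lerDl.
  rewrite mulrAC ler_pdivrMr ?exprn_gt0//; move: h; rewrite ler_pdivrMr//; lra.
have cs : \int[P]_w trig_sum s ((X k)^~ w) @[k --> \oo] --> \int[P']_w trig_sum s (Y^~ w).
  have [_ _ ->] := @trig_integral _ _ P' Y s (fun i => L2_meas (LY i)).
  have E : (fun k => \int[P]_w trig_sum s ((X k)^~ w)) = (fun k => \sum_(q <- s) q.1 * \int[P]_w cos (\sum_i q.2.1 i * X k i w + q.2.2)).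
    by apply/funext => k; have [_ _ ->] := @trig_integral _ _ P (X k) s (fun i => L2_meas (LX k i)).
  rewrite {}E; elim: (s) => [|q r IH].
    by under eq_fun do rewrite big_nil; rewrite big_nil; exact: cvg_cst.
  under eq_fun do rewrite big_cons; rewrite big_cons.
  by apply: cvgD IH; apply: cvgMr; exact: cos_cvg.
have hY := trig_approx_integral L0 (ltW e5) LY YV sM sF.
move/cvgrPdist_le : cs => /(_ _ e5) cs; apply: filterS2 cs XV => k cs XVk.
have hX := trig_approx_integral L0 (ltW e5) (LX k) XVk sM sF.
move: hX hY cs b; move: (2 * M / L ^+ 2 * V) (\int[P]_w trig_sum s _) (\int[P']_w trig_sum s _) (\int[P]_w F _) (\int[P']_w F _) => z a1 a2 a3 a4.
rewrite !ler_norml => /andP[? ?] /andP[? ?] /andP[? ?] ?; apply/andP; split; lra.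
Qed.
End weak.

(** * Convergence of the finite-dimensional distributions *)

Section limit_variance.
Context {R : realType}.
Local Notation mu := (@lebesgue_measure R).
Variables (n : nat) (alpha : R).
Hypothesis alpha_lt : alpha < n.+1%:R.

Definition decays (H : R -> R) := exists s0 C, 0 <= C /\ forall v, s0 <= v -> 0 < v -> H v ^+ 2 <= C * v ^- n.+1.

Lemma decays0 : decays (fun=> 0).
Proof. by exists 0, 0; split => // v _ v0; rewrite expr0n mul0r. Qed.

Lemma decaysD H1 H2 : decays H1 -> decays H2 -> decays (fun v => H1 v + H2 v).
Proof.
move=> [s1 [C1 [C10 h1]]] [s2 [C2 [C20 h2]]]; exists (Num.max s1 s2), (2 * C1 + 2 * C2).
split=> [|v]; first by rewrite addr_ge0 ?mulr_ge0.
rewrite ge_max => /andP[v1 v2] v0; have := h1 v v1 v0; have := h2 v v2 v0.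
have := sqr_ge0 (H1 v - H2 v); move: (v ^- n.+1) => D; nra.
Qed.

Lemma decays_scale (c s : R) H : 0 < s -> decays H -> decays (fun v => c * H (v * s)).
Proof.
move=> sgt0 [s0 [C [C0 h]]]; exists (s0 / s), (c ^+ 2 * C * s ^- n.+1); split=> [|v vs v0].
  by rewrite mulr_ge0 ?invr_ge0 ?exprn_ge0 ?(ltW sgt0)// mulr_ge0 ?sqr_ge0.
have sv : s0 <= v * s by rewrite -ler_pdivrMr.
have := h _ sv (mulr_gt0 v0 sgt0); rewrite !exprMn invfM => H1.
have -> : c ^+ 2 * C * s ^- n.+1 * v ^- n.+1 = c ^+ 2 * (C * (v ^- n.+1 * s ^- n.+1)) by ring.
by apply: ler_wpM2l => //; exact: sqr_ge0.
Qed.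

Lemma decays_sum I (r : seq I) (H : I -> R -> R) : (forall i, decays (H i)) -> decays (fun v => \sum_(i <- r) H i v).
Proof.
move=> dH; elim: r => [|i r IH].
  by under eq_fun do rewrite big_nil; exact: decays0.
by under eq_fun do rewrite big_cons; exact: decaysD.
Qed.

(** Infinite integrals are covered, since [fine] sends both sides to 0. *)
Lemma RintegralZl_ge0 (c : R) (f : R -> R) : 0 < c -> measurable_fun [set: R] f -> (forall x, 0 <= f x) ->
  \int[mu]_x (c * f x) = c * \int[mu]_x f x.
Proof.
move=> c0 mf f0; have mf' : measurable_fun [set: measurableTypeR R] (EFin \o f) by exact/measurable_EFinP.
have E : (\int[mu]_x (c * f x)%:E = c%:E * \int[mu]_x (f x)%:E)%E.
  by rewrite -ge0_integralZl_EFin ?(ltW c0)// => x _; rewrite lee_fin.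
rewrite /Rintegral E; case: (\int[mu]_x (f x)%:E)%E => [r| |] //.
  by rewrite gt0_muley ?lte_fin//= mulr0.
by rewrite gt0_muleNy ?lte_fin//= mulr0.
Qed.

(** In polar coordinates [u^n] times [u^(- (n + 1 - alpha))] is [u^(alpha - 1)]. The same identity
    turns square-integrability of the Wiener integrand into the integrability that dominates the
    rescaled spectral integrals. *)
Lemma radial_variance (H : R -> R) : measurable_fun [set: R] H ->
  L2 (@leb R n.+1) (fun x => H (norm_Rn x) / norm_Rn x `^ ((n.+1%:R - alpha) / 2)) ->
  mu.-integrable setT (fun v => (if 0 < v then v `^ (alpha - 1) * H v ^+ 2 else 0)%:E) /\
  ip (@leb R n.+1) (fun x => H (norm_Rn x) / norm_Rn x `^ ((n.+1%:R - alpha) / 2))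
    (fun x => H (norm_Rn x) / norm_Rn x `^ ((n.+1%:R - alpha) / 2)) =
  sphere_area n * \int[mu]_v (if 0 < v then v `^ (alpha - 1) * H v ^+ 2 else 0).
Proof.
move=> mH [_ LK].
pose Q (u : R) := (H u * (u `^ ((n.+1%:R - alpha) / 2)) `^ (-1)) ^+ 2.
pose q v := if 0 < v then v `^ (alpha - 1) * H v ^+ 2 else 0.
have sa0 := @sphere_area_gt0 R n.
have mQ : measurable_fun [set: R] Q.
  apply: measurable_funX; apply: measurable_funM => //.
  by apply: (measurableT_comp (measurable_powR _)); exact: measurable_powR.
have mq : measurable_fun [set: measurableTypeR R] q.
  apply: measurable_fun_if_pos; apply: measurable_funM; [exact: measurable_powR|exact: measurable_funX].
have q0 v : 0 <= q v by rewrite /q; case: ifP => // _; rewrite mulr_ge0 ?powR_ge0 ?sqr_ge0.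
have E : (\int[@leb R n.+1]_x ((H (norm_Rn x) / norm_Rn x `^ ((n.+1%:R - alpha) / 2)) ^+ 2)%:E =
   \int[mu]_v (sphere_area n * q v)%:E)%E.
  transitivity (\int[@leb R n.+1]_x (EFin \o Q) (norm_Rn x))%E.
    by apply: eq_integral => x _; rewrite /Q /= powR_inv1 ?powR_ge0.
  rewrite radial_integral; last 2 first.
  - exact/measurable_EFinP.
  - by move=> u; rewrite lee_fin sqr_ge0.
  rewrite integral_mkcond; apply: ae_eq_integral => //.
  - apply/(measurable_restrictT _ (measurable_itv _)); apply: measurable_funTS; apply: emeasurable_funM.
      exact/measurable_EFinP.
    by apply/measurable_EFinP; apply: measurable_funM => //; exact: measurable_funX.
  - by apply/measurable_EFinP; exact: measurable_funM.
  exists [set 0]; split; first exact: measurable_set1.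
    exact: lebesgue_measure_set1.
  move=> u /= h; apply: contrapT => u0; apply: h => _.
  rewrite patchE mem_setE in_itv/= andbT le_eqVlt eq_sym /q; have /eqP/negbTE -> /= : u <> 0 by [].
  case: ifPn => ugt; last by rewrite mulr0.
  rewrite /Q -EFinM; congr EFin.
  have -> : (u `^ ((n.+1%:R - alpha) / 2)) `^ (-1) = u `^ (- ((n.+1%:R - alpha) / 2)) by rewrite -powRrM mulrN1.
  have P2 : u `^ (- ((n.+1%:R - alpha) / 2)) ^+ 2 * u ^+ n = u `^ (alpha - 1).
    rewrite -powR_mulrn ?powR_ge0// -powRrM -powR_mulrn ?(ltW ugt)// -powRD; last by rewrite (gt_eqF ugt) implybT.
    by congr (_ `^ _); rewrite -natr1; field.
  by rewrite exprMn -P2; ring.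
have iq : mu.-integrable setT (fun v => (sphere_area n * q v)%:E).
  apply/integrableP; split; first by apply/measurable_EFinP; exact: measurable_funM.
  rewrite (_ : (\int[mu]_x _)%E = (\int[mu]_v (sphere_area n * q v)%:E)%E); last first.
    by apply: eq_integral => v _; rewrite gee0_abs// lee_fin mulr_ge0// ltW.
  rewrite -E; have /integrableP[_] := LK.
  by under eq_integral do rewrite gee0_abs ?lee_fin ?sqr_ge0//.
split.
  have h := integrableZl measurableT (sphere_area n)^-1 iq; apply: eq_integrable h => // v _.
  by rewrite -EFinM mulKf// gt_eqF.
rewrite /ip -RintegralZl_ge0//; congr fine.
by rewrite -E; apply: eq_integral => x _; rewrite expr2.
Qed.

End limit_variance.

(** * The variance before the limit *)

Section field_variance.
Context {R : realType} d (T : measurableType d) (P : probability T R).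
Local Notation mu := (@lebesgue_measure R).
Variables (n : nat) (phi : R -> R) (xi : n.+1.-tuple R -> T -> R).
Hypothesis field : iso_gaussian_field P xi phi.
Hypothesis phi0 : forall u, 0 <= u -> 0 <= phi u.
Variables (f : R -> n.+1.-tuple R -> R) (g : R -> R) (Aj hj alpha aj : R).
Hypotheses (B0 : 0 < Aj * hj) (mg : measurable_fun [set: R] g)
 (fL1 : forall r, 0 < r -> L1_Rn (f r))
 (fhat : forall r, 0 < r -> forall l : n.+1.-tuple R,
       r ^- n.+1 * Rint_Rn (fun x => cos (inner_Rn l x) * f r x) = g (r * (norm_Rn l - aj)) /\
       r ^- n.+1 * Rint_Rn (fun x => sin (inner_Rn l x) * f r x) = 0).
Variables (m : nat) (t : 'I_m -> R).
Hypothesis t0 : forall i, 0 <= t i.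

Definition profile (i : 'I_m) (v : R) : R := if t i == 0 then 0 else t i * g (v * t i `^ n.+1%:R^-1).

(** The transform of [f] at scale [rho_i = r t_i^(1/n)] brings [rho_i^n = r^n t_i]; against the
    normalisation [r^(n - alpha/2)] this leaves [r^(alpha/2)], that is [r^alpha] in the variance.
    The dimension is [n + 1] in the code. *)
Lemma X_variance (r : R) (th : 'I_m -> R) : 0 < r ->
  gauss_like P (fun w => \sum_i th i * X_rj xi f Aj hj alpha r (t i) w) /\
  ip P (fun w => \sum_i th i * X_rj xi f Aj hj alpha r (t i) w) (fun w => \sum_i th i * X_rj xi f Aj hj alpha r (t i) w) =
  sphere_area n / (Aj * hj) * (r `^ alpha *
    \int[mu]_u ((if 0 <= u then u ^+ n * phi u else 0) * (\sum_i th i * profile i (r * (u - aj))) ^+ 2)).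
Proof.
move=> r0.
pose c := (Num.sqrt (Aj * hj) * r `^ (n.+1%:R - alpha / 2))^-1.
pose kap i := if t i == 0 then 0 else th i * c.
(* At time 0 a dummy scale 1 with coefficient 0, because [f] is specified only at positive
   scales. *)
pose rho i := if t i == 0 then 1 else r * t i `^ n.+1%:R^-1.
have rho0 i : 0 < rho i.
  rewrite /rho; case: eqVneq => // ti; rewrite mulr_gt0// powR_gt0//.
  by rewrite lt_neqAle eq_sym ti t0.
have fh i l : Rint_Rn (fun x => cos (inner_Rn l x) * f (rho i) x) = rho i ^+ n.+1 * g (rho i * (norm_Rn l - aj)) /\
     Rint_Rn (fun x => sin (inner_Rn l x) * f (rho i) x) = 0.
  have rN : rho i ^+ n.+1 != 0 by rewrite expf_neq0// gt_eqF.
  have [<- h] := fhat (rho0 i) l; rewrite mulVKf//; split => //.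
  by rewrite -[LHS](mulVKf rN) h mulr0.
have XE : (fun w => \sum_i th i * X_rj xi f Aj hj alpha r (t i) w) =
    (fun w => \sum_i kap i * Rint_Rn (fun x => f (rho i) x * xi x w)).
  apply/funext => w; apply: eq_bigr => i _; rewrite /X_rj /kap /rho; case: eqVneq => // _.
    by rewrite mulr0 mul0r.
  by rewrite mulrA.
have [gl ipE] := field_combination field phi0 kap (fun i => fL1 (rho0 i)) fh.
rewrite XE; split; first exact: gl.
rewrite {}ipE -mulrA; congr (_ * _); rewrite mulrA.
have sB : Num.sqrt (Aj * hj) != 0 by rewrite gt_eqF// sqrtr_gt0.
(* What remains of the normalisation after division by [r^(n + 1)]; it is common to all times. *)
pose s := r `^ (alpha / 2) / Num.sqrt (Aj * hj).
have s2 : s ^+ 2 = (Aj * hj)^-1 * r `^ alpha.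
  rewrite /s expr_div_n sqr_sqrtr ?(ltW B0)// -powR_mulrn ?powR_ge0// -powRrM mulrC.
  by rewrite divfK ?pnatr_eq0.
have term i w : kap i * (rho i ^+ n.+1 * g (rho i * w)) = s * (th i * profile i (r * w)).
  rewrite /kap /rho /profile; case: eqVneq => ti; first by rewrite !(mul0r, mulr0).
  have tE : (t i `^ n.+1%:R^-1) ^+ n.+1 = t i.
    by rewrite -powR_mulrn ?powR_ge0// -powRrM mulVf ?pnatr_eq0// powRr1.
  have rE : r ^+ n.+1 = r `^ (n.+1%:R - alpha / 2) * r `^ (alpha / 2).
    rewrite -powRD; last by rewrite (gt_eqF r0) implybT.
    by rewrite subrK powR_mulrn// ltW.
  rewrite exprMn tE rE (mulrAC r) /c /s.
  have : r `^ (n.+1%:R - alpha / 2) != 0 by rewrite gt_eqF// powR_gt0.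
  move: (g (r * w * t i `^ n.+1%:R^-1)) => g'.
  move: (r `^ (n.+1%:R - alpha / 2)) (r `^ (alpha / 2)) (Num.sqrt (Aj * hj)) sB => x y z z0 x0.
  by field; rewrite x0 z0.
have mprof i : measurable_fun [set: R] (profile i).
  rewrite /profile; case: eqVneq => // _; apply: measurable_funM => //.
  by apply: (measurableT_comp mg); exact: measurable_funM.
have mS : measurable_fun [set: R] (fun u => \sum_i th i * profile i (r * (u - aj))).
  apply: measurable_sum => i; apply: measurable_funM => //; apply: (measurableT_comp (mprof i)).
  by apply: measurable_funM => //; exact: measurable_funB.
have mq : measurable_fun [set: R] (fun u => if 0 <= u then u ^+ n * phi u else 0).
  have sp : Num.sqrt pi ^+ n.+1 != 0 :> R by rewrite expf_neq0// gt_eqF// sqrtr_gt0 pi_gt0.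
  have /integrableP[/measurable_EFinP mr _] := integrable_radial_density (field_density field).
  have h : measurable_fun [set: measurableTypeR R] (fun u => (sphere_area n)^-1 * Num.sqrt pi ^+ n.+1 * radial_density n phi u) by exact: measurable_funM.
  apply: eq_measurable_fun h => u _; rewrite /radial_density.
  have sa := @sphere_area_gt0 R n; move: (if _ then _ else _) (sphere_area n) (gt_eqF sa) => x y /negbT y0.
  by move: (Num.sqrt pi ^+ n.+1) sp => z z0; field; rewrite y0 z0.
rewrite -s2 -RintegralZl_ge0.
- rewrite Rintegral_mkcond; apply: eq_Rintegral => u _.
  rewrite patchE mem_setE in_itv/= andbT; case: ifP => u0; last by rewrite !(mul0r, mulr0).
  rewrite (_ : \sum_i kap i * (rho i ^+ n.+1 * g (rho i * (u - aj))) = s * \sum_i th i * profile i (r * (u - aj))).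
    by rewrite exprMn; ring.
  by rewrite mulr_sumr; apply: eq_bigr => i _; exact: term.
- by rewrite s2 mulr_gt0 ?invr_gt0 ?powR_gt0.
- by apply: measurable_funM => //; exact: measurable_funX.
by move=> u; case: ifP => u0; rewrite ?mul0r// mulr_ge0 ?sqr_ge0// mulr_ge0 ?exprn_ge0 ?phi0.
Qed.
End field_variance.

Section endgame.
Context {R : realType}.
Local Notation mu := (@lebesgue_measure R).

(** Recovers single coordinates from statements about linear combinations. *)
Definition unit_coef m (i l : 'I_m) : R := (l == i)%:R.

Lemma sum_unit_coef m T (W : 'I_m -> T -> R) i : (fun w => \sum_l unit_coef i l * W l w) = W i.
Proof.
apply/funext => w; rewrite (bigD1 i)//= /unit_coef eqxx mul1r big1 ?addr0// => l li.
by rewrite (negbTE li) mul0r.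
Qed.

Lemma integrable_ray (q : R -> R) : mu.-integrable `[0, +oo[%classic (fun u => (q u)%:E) ->
  mu.-integrable setT (EFin \o (fun u => if 0 <= u then q u else 0)).
Proof.
have mI : measurable (`[0, +oo[%classic : set (measurableTypeR R)) by exact: measurable_itv.
move=> /(integrable_mkcond _ mI) i; apply: eq_integrable i => // u _.
by rewrite patchE mem_setE in_itv/= andbT; case: ifP.
Qed.

(** Measurability of [g] is drawn from the Wiener integrand at time 1: restricted to a line through
    the origin it determines [g] off 0 by evenness, and the value at 0 is patched separately. *)
Lemma measurable_integrand_even n (g : R -> R) (alpha : R) :
  measurable_fun [set: n.+1.-tuple R] (Xj_integrand g alpha 1 : n.+1.-tuple R -> R) -> (forall s, g (- s) = g s) ->
  measurable_fun [set: R] g.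
Proof.
move=> mX gev.
pose e1 : n.+1.-tuple R := [tuple of 1 :: nseq n 0].
have ne1 : norm_Rn e1 = 1.
  rewrite /norm_Rn /inner_Rn big_ord_recl big1 ?addr0 ?mulr1 ?sqrtr1// => i _.
  by rewrite (tnth_nth 0)/= nth_nseq ltn_ord mulr0.
have ml : measurable_fun [set: R] (fun v => scaleT v e1).
  apply/measurable_fun_tnthP => i.
  rewrite (_ : _ \o _ = fun v => v * tnth e1 i); first by apply: measurable_funM.
  by apply/funext => v /=; rewrite tnth_map.
pose gp v := Xj_integrand g alpha 1 (scaleT v e1) * `|v| `^ ((n.+1%:R - alpha) / 2).
have mgp : measurable_fun [set: R] gp.
  apply: measurable_funM; first exact: (measurableT_comp mX ml).
  by apply: (measurableT_comp (measurable_powR _)); exact: normr_measurable.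
have -> : g = (fun v => if v == 0 then g 0 else gp v).
  apply/funext => v; case: eqVneq => [->//|v0].
  rewrite /gp /Xj_integrand norm_scale ne1 powR1 !mulr1 mul1r divfK; last first.
    by rewrite gt_eqF// powR_gt0// normr_gt0.
  by have [vp|vn] := ger0P v; rewrite ?gev.
apply: measurable_fun_ifT => //; apply: measurable_fun_eqr => //; exact: measurable_id.
Qed.
End endgame.

Section fdd.
Context {R : realType}.
Local Notation mu := (@lebesgue_measure R).
Variables (n k : nat) (a alpha : nat -> R) (h : nat -> R -> R)
  (d : measure_display) (T : measurableType d) (P : probability T R) (xi : n.+1.-tuple R -> T -> R)
  (j : nat) (f : R -> n.+1.-tuple R -> R) (g : R -> R).
Hypotheses (a0 : a 0%N = 0) (aS : forall i, (i < k)%N -> a i < a i.+1)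
  (alpha0 : 0 < alpha 0%N < n.+1%:R)
  (alphaS : forall i, (1 <= i <= k)%N -> 0 < alpha i < 1)
  (hb : forall i, (i <= k)%N -> exists M : R, forall x, - a i <= x -> 0 <= h i x <= M)
  (hc : exists2 delta : R, 0 < delta &
     {within `[- a j, +oo[%classic `&` `]- delta, delta[%classic, continuous h j})
  (hj0 : h j 0 != 0)
  (field : iso_gaussian_field P xi (spec_density n.+1 k a alpha h))
  (jk : (j <= k)%N)
  (fL1 : forall r, 0 < r -> L1_Rn (f r))
  (fhat : forall r, 0 < r -> forall l : n.+1.-tuple R,
       r ^- n.+1 * Rint_Rn (fun x => cos (inner_Rn l x) * f r x) = g (r * (norm_Rn l - a j)) /\
       r ^- n.+1 * Rint_Rn (fun x => sin (inner_Rn l x) * f r x) = 0)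
  (gev : forall s, g (- s) = g s)
  (gdec : exists s0 C : R, 0 <= s0 /\ 0 < C /\ forall s, s0 <= s -> 0 < s -> g s ^+ 2 <= C * s ^- n.+1).
Variables (d' : measure_display) (T' : measurableType d') (P' : probability T' R)
  (Z : set (n.+1.-tuple R) -> T' -> R) (Y : R -> T' -> R).
Hypotheses (wn : white_noise P' Z) (Y0 : forall w, Y 0 w = 0)
  (YW : forall t, 0 < t <= 1 -> wiener_integral P' Z (Xj_integrand g (alpha j) t) (Y t)).
Variables (m : nat) (t : 'I_m -> R).
Hypothesis t01 : forall i, 0 <= t i <= 1.

Local Notation Aj := (A_const n.+1 a j).
Local Notation X r i := (X_rj xi f Aj (h j 0) (alpha j) r (t i)).
Local Notation prof := (profile n g t).

Let t0 i : 0 <= t i. Proof. by have /andP[] := t01 i. Qed.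

Let a_ge0 : 0 <= a j.
Proof.
elim: j jk => [|l IH] lk; first by rewrite a0.
by apply: le_trans (IH (ltnW lk)) _; apply/ltW/aS.
Qed.

Let a_gt0 : j != 0%N -> 0 < a j.
Proof.
case: j jk => // l lk _; have : forall i, (i <= k)%N -> 0 <= a i.
  elim=> [|i IH] ik; first by rewrite a0.
  by apply: le_trans (IH (ltnW ik)) _; apply/ltW/aS.
by move=> /(_ l (ltnW lk)) al; apply: le_lt_trans al _; exact: aS.
Qed.

Let B_gt0 : 0 < Aj * h j 0.
Proof.
rewrite mulr_gt0//.
  rewrite /A_const; case: eqVneq => // /a_gt0 aj.
  by rewrite mulr_gt0// exprn_gt0.
have [M /(_ 0)] := hb jk; rewrite oppr_le0 => /(_ a_ge0)/andP[h0 _].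
by rewrite lt_neqAle eq_sym hj0.
Qed.

Let alpha_lt : alpha j < n.+1%:R.
Proof.
have [->|jn0] := eqVneq j 0%N; first by have /andP[] := alpha0.
have /alphaS/andP[_ al] : (1 <= j <= k)%N by rewrite lt0n jn0.
by apply: lt_le_trans al _; rewrite ler1n.
Qed.

Let mg : measurable_fun [set: R] g.
Proof.
have t1 : 0 < (1 : R) <= 1 by rewrite ltr01 lexx.
have [[mX _] _] := YW t1.
exact: measurable_integrand_even mX gev.
Qed.

Let mprof i : measurable_fun [set: R] (prof i).
Proof.
rewrite /profile; case: eqVneq => // _; apply: measurable_funM => //.
by apply: (measurableT_comp mg); exact: measurable_funM.
Qed.

Let phi0 u : 0 <= u -> 0 <= spec_density n.+1 k a alpha h u.
Proof. exact: spec_density_ge0. Qed.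

(** Time 0, where [Y] is prescribed instead of being a Wiener integral, is covered by the zero
    pair. *)
Let wpair_Y i : wpair P' Z (fun u => prof i (norm_Rn u) / norm_Rn u `^ ((n.+1%:R - alpha j) / 2)) (Y (t i)).
Proof.
have [ti|ti] := eqVneq (t i) 0.
  have -> : Y (t i) = (fun=> 0) by rewrite ti; apply/funext => w; exact: Y0.
  rewrite /profile ti eqxx; under eq_fun do rewrite mul0r; exact: wpair0.
have /YW/(wiener_wpair wn) : 0 < t i <= 1 by rewrite lt_neqAle eq_sym ti; exact: t01.
rewrite (_ : Xj_integrand _ _ _ = (fun u => prof i (norm_Rn u) / norm_Rn u `^ ((n.+1%:R - alpha j) / 2)))//.
by apply/funext => u; rewrite /profile (negbTE ti) /Xj_integrand mulrA.
Qed.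

Lemma variance_cvg (r : nat -> R) (th : 'I_m -> R) : (forall l, 0 < r l) -> r l @[l --> \oo] --> +oo ->
  ip P (fun w => \sum_i th i * X (r l) i w) (fun w => \sum_i th i * X (r l) i w) @[l --> \oo] -->
  ip P' (fun w => \sum_i th i * Y (t i) w) (fun w => \sum_i th i * Y (t i) w).
Proof.
move=> r0 roo.
pose H v := \sum_i th i * prof i v.
have mH : measurable_fun [set: R] H by apply: measurable_sum => i; exact: measurable_funM.
have := wpair_sum wn (index_enum 'I_m) th wpair_Y.
rewrite (_ : (fun u => \sum_(i <- _) _) = (fun u => H (norm_Rn u) / norm_Rn u `^ ((n.+1%:R - alpha j) / 2))); last first.
  by apply/funext => u; rewrite /H mulr_suml; apply: eq_bigr => i _; rewrite mulrA.
move=> wp; have [_ ->] := wpair_gauss wn wp.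
have [LK _ _] := wp; have [iH ->] := radial_variance mH LK.
have dH : decays n H.
  apply: decays_sum => i; rewrite /profile; case: eqVneq => ti.
    by under eq_fun do rewrite mulr0; exact: decays0.
  under eq_fun do rewrite mulrA; apply: decays_scale.
    by rewrite powR_gt0// lt_neqAle eq_sym ti t0.
  by have [s0 [C [_ [C0 hg]]]] := gdec; exists s0, C; split => //; exact: ltW.
have [s0 [C [C0 HC]]] := dH.
have Hev v : H (- v) ^+ 2 = H v ^+ 2.
  congr (_ ^+ 2); apply: eq_bigr => i _; rewrite /profile; case: eqVneq => // _.
  by rewrite mulNr gev.
have iq := integrable_ray (field_density field).
have mq : measurable_fun [set: R] (fun u => if 0 <= u then u ^+ n * spec_density n.+1 k a alpha h u else 0).
  by have /integrableP[/measurable_EFinP] := iq.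
have q0 u : 0 <= (if 0 <= u then u ^+ n * spec_density n.+1 k a alpha h u else 0).
  by case: ifP => // u0; rewrite mulr_ge0 ?exprn_ge0 ?phi0.
have mH2 : measurable_fun [set: R] (fun v => H v ^+ 2) by exact: measurable_funX.
have lim := two_sided alpha_lt C0 mq q0 iq mH2 (fun v => sqr_ge0 (H v)) Hev iH HC
  (density_limit a0 aS alpha0 alphaS hb hc jk) r0 roo.
have E l : ip P (fun w => \sum_i th i * X (r l) i w) (fun w => \sum_i th i * X (r l) i w) =
    sphere_area n / (Aj * h j 0) * (r l `^ alpha j *
    \int[mu]_u ((if 0 <= u then u ^+ n * spec_density n.+1 k a alpha h u else 0) * H (r l * (u - a j)) ^+ 2)).
  by have [_ ->] := X_variance field phi0 (alpha j) B_gt0 mg fL1 fhat t0 th (r0 l).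
under eq_fun do rewrite E.
(* The local constant [A_j h_j(0)] of the density cancels the normalisation of [X]. *)
set J := \int[mu]_v _.
have -> : sphere_area n * J = sphere_area n / (Aj * h j 0) * (Aj * h j 0 * J).
  by rewrite mulrA divfK// gt_eqF.
by apply: cvgMr; exact: lim.
Qed.

Lemma fdd_cvg_seq (r : nat -> R) (F : 'rV[R]_m -> R) (M : R) : continuous F -> (forall v, `|F v| <= M) ->
  (forall l, 0 < r l) -> r l @[l --> \oo] --> +oo ->
  \int[P]_w F (\row_i X (r l) i w) @[l --> \oo] --> \int[P']_w F (\row_i Y (t i) w).
Proof.
move=> cF FM r0 roo.
have gX l th := X_variance field phi0 (alpha j) B_gt0 mg fL1 fhat t0 th (r0 l).
have LX l i : L2 P (X (r l) i) by have [[LW _] _] := gX l (unit_coef i); rewrite sum_unit_coef in LW.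
have LY i : L2 P' (Y (t i)) by have [_ LW _] := wpair_Y i.
have cV : \sum_i ip P (X (r l) i) (X (r l) i) @[l --> \oo] --> \sum_i ip P' (Y (t i)) (Y (t i)).
  elim: (index_enum _) => [|i s IH].
    by under eq_fun do rewrite big_nil; rewrite big_nil; exact: cvg_cst.
  under eq_fun do rewrite big_cons; rewrite big_cons; apply: cvgD IH.
  have := variance_cvg (th := unit_coef i) r0 roo; rewrite (sum_unit_coef (fun l => Y (t l))).
  by under eq_fun do rewrite sum_unit_coef.
(* Convergence of the total variance makes its limit plus 1 an eventual bound, which serves as the
   common second moment. *)
apply: (weak_cvg cF FM LX LY (V := \sum_i ip P' (Y (t i)) (Y (t i)) + 1)).
- move/cvgrPdist_le : cV => /(_ 1 ltr01); apply: filterS => l.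
  by rewrite ler_norml => /andP[+ _]; rewrite lerBrDr; lra.
- by rewrite lerDl.
move=> th c.
have [gY _] := wpair_gauss wn (wpair_sum wn (index_enum 'I_m) th wpair_Y).
rewrite gY.2; have EX l : \int[P]_w cos (\sum_i th i * X (r l) i w + c) =
    gauss_cos (ip P (fun w => \sum_i th i * X (r l) i w) (fun w => \sum_i th i * X (r l) i w)) c.
  by have [gl _] := gX l th; exact: gl.2.
by under eq_fun do rewrite EX; apply: gauss_cos_cvg; exact: variance_cvg.
Qed.

Lemma fdd_cvg (F : 'rV[R]_m -> R) (M : R) : continuous F -> (forall v, `|F v| <= M) ->
  (\int[P]_w (F (\row_i X r i w))%:E)%E @[r --> +oo] --> (\int[P']_w (F (\row_i Y (t i) w))%:E)%E.
Proof.
move=> cF FM.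
have finF d1 (T1 : measurableType d1) (Q : probability T1 R) (W : 'I_m -> T1 -> R) : (forall i, measurable_fun setT (W i)) ->
    (\int[Q]_w (F (\row_i W i w))%:E)%E \is a fin_num.
  move=> mW; apply: integrable_fin_num => //; apply: (@integrable_bounded _ _ _ _ _ M) => //.
  exact: (measurable_F_comp cF FM Q).
have mX r i : 0 < r -> measurable_fun setT (X r i).
  by move=> r0; have [[LW _] _] := X_variance field phi0 (alpha j) B_gt0 mg fL1 fhat t0 (unit_coef i) r0; rewrite sum_unit_coef in LW; exact: LW.1.
have mY i : measurable_fun setT (Y (t i)) by have [_ LW _] := wpair_Y i; exact: LW.1.
rewrite -(fineK (finF _ _ P' _ mY)).
apply/fine_cvgP; split.
  by near=> r; apply: finF => i; apply: mX; near: r; exact: nbhs_pinfty_gt.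
apply/cvg_pinftyP => u uoo.
(* A sequence tending to infinity is only eventually positive; finitely many terms are replaced,
   which does not affect the limit. *)
pose r l := if 0 < u l then u l else 1.
have ur : \forall l \near \oo, r l = u l.
  by have /cvgryPgt/(_ 0) := uoo; apply: filterS => l ul; rewrite /r ul.
have r0 l : 0 < r l by rewrite /r; case: ifP.
have roo : r l @[l --> \oo] --> +oo.
  by apply: cvg_trans uoo; apply: near_eq_cvg; apply: filterS ur => l ->.
apply: cvg_trans (fdd_cvg_seq cF FM r0 roo); apply: near_eq_cvg.
by apply: filterS ur => l ->.
Unshelve. all: by end_near. Qed.
End fdd.

Theorem theorem1 (R : realType) (n k : nat) (a alpha : nat -> R)
  (h : nat -> R -> R)
  (d : measure_display) (T : measurableType d) (P : probability T R)
  (xi : n.-tuple R -> T -> R)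
  (j : nat) (f : R -> n.-tuple R -> R) (g : R -> R) :
  (1 <= n)%N ->
  (* 0 = a_0 < a_1 < ... < a_k *)
  a 0%N = 0 -> (forall i, (i < k)%N -> a i < a i.+1) ->
  (* 0 < alpha_0 < n, 0 < alpha_i < 1 *)
  0 < alpha 0%N < n%:R ->
  (forall i, (1 <= i <= k)%N -> 0 < alpha i < 1) ->
  (* h_i >= 0 bounded on [-a_i, oo), continuous near 0, h_i(0) <> 0 *)
  (forall i, (i <= k)%N ->
     (exists M : R, forall x, - a i <= x -> 0 <= h i x <= M) /\
     (exists2 delta : R, 0 < delta &
        {within `[- a i, +oo[%classic `&` `]- delta, delta[%classic,
           continuous h i}) /\
     h i 0 != 0) ->
  (* phi(|.|) in L_1(R^n) *)
  L1_Rn (fun x : n.-tuple R => spec_density n k a alpha h (norm_Rn x)) ->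
  (* the field *)
  iso_gaussian_field P xi (spec_density n k a alpha h) ->
  (* the functions f_{j,r} and g_j *)
  (j <= k)%N ->
  (forall r : R, 0 < r ->
     radial (f r) /\ essentially_nonzero (f r) /\
     L1_Rn (f r) /\ L2_Rn (f r) /\
     forall lambda : n.-tuple R,
       r ^- n * Rint_Rn (fun x => cos (inner_Rn lambda x) * f r x)
         = g (r * (norm_Rn lambda - a j)) /\
       r ^- n * Rint_Rn (fun x => sin (inner_Rn lambda x) * f r x) = 0) ->
  (forall s, g (- s) = g s) ->
  (exists s0 C : R, 0 <= s0 /\ 0 < C /\
     forall s, s0 <= s -> 0 < s -> g s ^+ 2 <= C * s ^- n) ->
  (* conclusion: weak convergence of finite-dimensional distributions *)
  forall (d' : measure_display) (T' : measurableType d')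
         (P' : probability T' R) (Z : set (n.-tuple R) -> T' -> R)
         (Y : R -> T' -> R),
    white_noise P' Z ->
    (forall w, Y 0 w = 0) ->
    (forall t, 0 < t <= 1 ->
       wiener_integral P' Z (Xj_integrand g (alpha j) t) (Y t)) ->
    forall (m : nat) (t : 'I_m -> R), (forall i, 0 <= t i <= 1) ->
    forall F : 'rV[R]_m -> R, continuous F ->
      (exists M : R, forall v, `|F v| <= M) ->
      ('E_P[fun w => F (\row_i X_rj xi f (A_const n a j) (h j 0) (alpha j)
                              r (t i) w)%R])%E @[r --> +oo]
        --> ('E_P'[fun w => F (\row_i Y (t i) w)%R])%E.
Proof.
case: n xi f => [|n] xi f; first by [].
move=> _ a0 aS alpha0 alphaS hh _ field jk ff gev gdec d' T' P' Z Y wn Y0 YW m t t01 F cF [M FM].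
rewrite unlock; apply: (fdd_cvg a0 aS alpha0 alphaS _ _ _ field jk _ _ gev gdec wn Y0 YW t01 cF FM).
- by move=> i /hh[].
- by have [_ []] := hh j jk.
- by have [_ []] := hh j jk.
- by move=> r /ff[_ [_ []]].
- by move=> r /ff[_ [_ [_ []]]].
Qed.
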